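(* Let $T>0$, $L>0$. Let $V$ be bounded and Lipschitz continuous on $[0,\infty)$ with $V(k)\ge0$ for all $k\ge0$. Let $\bar k\in L^\infty([0,\infty);[0,\infty))$ be $C^2$ smooth and supported on $[0,L]$. Let $\phi\in L^\infty([0,T]\times[0,\infty);[0,\infty))$ be $C^2$ smooth, supported on $[0,T]\times[0,L]$, with $\int_0^\infty\phi(t,x)\,dx=1$ and $\phi(t,0)>0$ for all $t\in[0,T]$. Put $\bar\delta=\int_0^\infty\bar k(x)\,dx$, $\phi_{\min,0}=\min_{t\in[0,T]}\phi(t,0)$, and, for a function $\delta$ on $[0,T]$, $v^\delta(t)=V(\delta(t)/L)$. Then for any observational data $k(\cdot,0)\in W^{1,\infty}([0,T])$ there exists a unique $\delta\in W^{1,\infty}([0,T])$ satisfying, for $t\in[0,T]$, the Volterra integral equation $$\begin{aligned}\delta(t)=&\frac1{\phi(t,0)}\left(k(t,0)-\bar k\left(\int_0^t v^\delta(\tau)\,d\tau\right)+\bar\delta\,\phi\left(0,\int_0^t v^\delta(\tau)\,d\tau\right)\right)\\&-\frac1{\phi(t,0)}\int_0^t\left[v^\delta(\tau)k(\tau,0)\,\phi\left(\tau,\int_\tau^t v^\delta(s)\,ds\right)+v^\delta(\tau)\delta(\tau)\,\partial_x\phi\left(\tau,\int_\tau^t v^\delta(s)\,ds\right)\right]d\tau\\&+\frac1{\phi(t,0)}\int_0^t\delta(\tau)\,\partial_t\phi\left(\tau,\int_\tau^t v^\delta(s)\,ds\right)d\tau,\end{aligned}$$ and a unique $f\in L^\infty([0,T])$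 given by $$\frac{d\delta(t)}{dt}=f(t)-V\left(\frac{\delta(t)}{L}\right)k(t,0).$$ Moreover, if $(\delta,f)$ and $(\tilde\delta,\tilde f)$ correspond in this way to observational data $k(\cdot,0)$ and $\tilde k(\cdot,0)$ respectively, then $$\|\delta-\tilde\delta\|_{L^\infty}\le C_\delta\|k(\cdot,0)-\tilde k(\cdot,0)\|_{L^\infty},\qquad \|f-\tilde f\|_{L^\infty}\le C_f\|k(\cdot,0)-\tilde k(\cdot,0)\|_{W^{1,\infty}},$$ where $C_\delta$ depends on $T,L,V,\bar\delta,\phi_{\min,0}^{-1},\|k(\cdot,0)\|_{L^\infty},\|\phi\|_{W^{2,\infty}},\|\bar k\|_{W^{1,\infty}}$, and $C_f$ depends on $T,L,V,\bar\delta,\phi_{\min,0}^{-1},\|k(\cdot,0)\|_{L^\infty},\|\phi\|_{W^{2,\infty}},\|\bar k\|_{W^{2,\infty}}$.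
   Context: The norms are taken over $[0,T]$, $[0,\infty)$ or $[0,T]\times[0,\infty)$ according to the domain of the function. The setting is the inverse problem of recovering the inflow rates $f$ on $[0,T]$ from the boundary observation $k(\cdot,0)$ in $\partial_tk(t,x)-V\left(\int_0^\infty k(t,y)w(y)\,dy\right)\partial_xk(t,x)=f(t)\phi(t,x)$, $k(0,x)=\bar k(x)$, with the kernel $w=\frac1L\mathbf 1_{[0,L]}$; there $\delta(t)=\int_0^\infty k(t,x)\,dx$. In the integral equation $k(\cdot,0)$ denotes the given observational data, a function on $[0,T]$.
   Formalization: V is extended to negative arguments by V(0), since δ can become negative; and C_f depends on ‖k(·,0)‖_{W^{1,∞}} instead of ‖k(·,0)‖_{L^∞}, because the printed dependence is false (highly oscillating k and φ give a counterexample). *)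

(* Defs.v *)
From HB Require Import structures.
From mathcomp Require Import all_boot all_order all_algebra.
From mathcomp Require Import all_classical all_reals all_analysis.

Set Implicit Arguments.
Unset Strict Implicit.
Unset Printing Implicit Defensive.

Import Order.TTheory GRing.Theory Num.Theory.
Import numFieldNormedType.Exports.

Local Open Scope classical_set_scope.
Local Open Scope ring_scope.

(* Functions on [0, T], on [0, oo) or on [0, T] x [0, oo) are represented by
   total functions; only their values on the domain are ever constrained. *)

Section Linfty.
Context d (X : measurableType d) (R : realType).
Variables (mu : {measure set X -> \bar R}) (D : set X).

Definition Linf (u : X -> R) : Prop :=
  measurable_fun D u /\ ('N[mu]_(+oo)[EFin \o (u \_ D)] < +oo)%E.

(* Real-valued: only meaningful for u in L^oo(D). *)
Definition Linf_norm (u : X -> R) : R :=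
  fine ('N[mu]_(+oo)[EFin \o (u \_ D)])%E.

End Linfty.

Section ClassicalDerivatives.
Context (R : realType).

Local Notation leb := (@lebesgue_measure R).
Local Notation leb2 := (leb \x leb)%E.

(* Derivatives relative to a set D: one-sided at an endpoint of D. *)
Definition diff_quot_in (D : set R) (u : R -> R) (x : R) : set_system R :=
  (fun y => (u y - u x) / (y - x)) @ within D x^'.

Definition derivable_in (D : set R) (u : R -> R) (x : R) : Prop :=
  cvg (diff_quot_in D u x).

Definition derive_in (D : set R) (u : R -> R) (x : R) : R :=
  lim (diff_quot_in D u x).

Definition C1_in (D : set R) (u : R -> R) : Prop :=
  (forall x, D x -> derivable_in D u x) /\ {within D, continuous (derive_in D u)}.

Definition C2_in (D : set R) (u : R -> R) : Prop :=
  C1_in D u /\ C1_in D (derive_in D u).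

Definition dt_in (I : set R) (phi : R -> R -> R) : R -> R -> R :=
  fun t x => derive_in I (phi^~ x) t.

Definition dx_in (J : set R) (phi : R -> R -> R) : R -> R -> R :=
  fun t x => derive_in J (phi t) x.

Definition C1_in2 (I J : set R) (phi : R -> R -> R) : Prop :=
  [/\ forall t x, I t -> J x ->
        derivable_in I (phi^~ x) t /\ derivable_in J (phi t) x,
      {within I `*` J, continuous (fun p : R * R => dt_in I phi p.1 p.2)} &
      {within I `*` J, continuous (fun p : R * R => dx_in J phi p.1 p.2)}].

Definition C2_in2 (I J : set R) (phi : R -> R -> R) : Prop :=
  [/\ C1_in2 I J phi, C1_in2 I J (dt_in I phi) & C1_in2 I J (dx_in J phi)].

Definition Linf2 (I J : set R) (phi : R -> R -> R) : Prop :=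
  Linf leb2 (I `*` J) (fun p => phi p.1 p.2).

Definition Linf2_norm (I J : set R) (phi : R -> R -> R) : R :=
  Linf_norm leb2 (I `*` J) (fun p => phi p.1 p.2).

(* Sobolev norms of C^2 functions, whose weak derivatives are the classical
   ones. *)
Definition C1_W1inf_norm (D : set R) (u : R -> R) : R :=
  Linf_norm leb D u + Linf_norm leb D (derive_in D u).

Definition C2_W2inf_norm (D : set R) (u : R -> R) : R :=
  C1_W1inf_norm D u + Linf_norm leb D (derive_in D (derive_in D u)).

Definition C2_W2inf_norm2 (I J : set R) (phi : R -> R -> R) : R :=
  Linf2_norm I J phi
  + Linf2_norm I J (dt_in I phi) + Linf2_norm I J (dx_in J phi)
  + Linf2_norm I J (dt_in I (dt_in I phi))
  + Linf2_norm I J (dt_in I (dx_in J phi))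
  + Linf2_norm I J (dx_in J (dx_in J phi)).

End ClassicalDerivatives.

Section Sobolev.
Context (R : realType).
Variable T : R.

Local Notation leb := (@lebesgue_measure R).

(* C^1 functions with compact support in (0, T). *)
Definition test_function (psi : R -> R) : Prop :=
  [/\ forall t, derivable psi t 1, continuous (derive1 psi) &
      exists a b, [/\ 0 < a, b < T & forall t, t \notin `[a, b] -> psi t = 0]].

Definition weak_deriv (u g : R -> R) : Prop :=
  forall psi, test_function psi ->
    \int[leb]_(t in `]0, T[) (u t * derive1 psi t) =
    - \int[leb]_(t in `]0, T[) (g t * psi t).

(* Elements of W^{1,oo}([0, T]) are identified with their continuous
   representatives, so that pointwise values make sense. *)
Definition W1inf (u : R -> R) : Prop :=
  [/\ {within `[0, T], continuous u}, Linf leb `[0, T] u &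
      exists g, Linf leb `[0, T] g /\ weak_deriv u g].

Definition weak_derive (u : R -> R) : R -> R :=
  xget (fun=> 0) [set g | Linf leb `[0, T] g /\ weak_deriv u g].

Definition W1inf_norm (u : R -> R) : R :=
  Linf_norm leb `[0, T] u + Linf_norm leb `[0, T] (weak_derive u).

End Sobolev.

Section InverseProblem.
Context (R : realType).

Local Notation leb := (@lebesgue_measure R).

(* V is only given on [0, oo), whereas delta may become negative for arbitrary
   data: V is extended to negative arguments by the value V 0. *)
Definition speed (V : R -> R) (L : R) (delta : R -> R) (t : R) : R :=
  V (Num.max 0 (delta t / L)).

Definition travel (v : R -> R) (s t : R) : R := \int[leb]_(r in `[s, t]) v r.

Definition mass (u : R -> R) : R := \int[leb]_(x in `[0, +oo[) u x.

Definition phi_min0 (T : R) (phi : R -> R -> R) : R :=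
  inf [set phi t 0 | t in `[0, T]].

Definition volterra_rhs (T L : R) (V kbar : R -> R) (phi : R -> R -> R)
    (k delta : R -> R) (t : R) : R :=
  let v := speed V L delta in
  let y := travel v in
  let phi_t := dt_in `[0, T] phi in
  let phi_x := dx_in `[0, +oo[ phi in
  (phi t 0)^-1 * (k t - kbar (y 0 t) + mass kbar * phi 0 (y 0 t))
  - (phi t 0)^-1 *
      \int[leb]_(tau in `[0, t])
        (v tau * k tau * phi tau (y tau t) +
         v tau * delta tau * phi_x tau (y tau t))
  + (phi t 0)^-1 *
      \int[leb]_(tau in `[0, t]) (delta tau * phi_t tau (y tau t)).

Definition volterra_solution (T L : R) (V kbar : R -> R) (phi : R -> R -> R)
    (k delta : R -> R) : Prop :=
  W1inf T delta /\
  forall t, 0 <= t <= T -> delta t = volterra_rhs T L V kbar phi k delta t.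

(* delta' = f - V(delta / L) k, with the derivative taken in the weak sense. *)
Definition inflow_rate (T L : R) (V k delta f : R -> R) : Prop :=
  Linf leb `[0, T] f /\
  weak_deriv T delta (fun t => f t - speed V L delta t * k t).

Definition corresponds (T L : R) (V kbar : R -> R) (phi : R -> R -> R)
    (k delta f : R -> R) : Prop :=
  volterra_solution T L V kbar phi k delta /\ inflow_rate T L V k delta f.

End InverseProblem.

(* Main.v *)
From HB Require Import structures.
From mathcomp Require Import all_boot all_order all_algebra.
From mathcomp Require Import all_classical all_reals all_analysis.
From mathcomp Require Import measurable_realfun ess_sup_inf ring lra.
Require Import Defs.

Set Implicit Arguments.
Unset Strict Implicit.
Unset Printing Implicit Defensive.

Import Order.TTheory GRing.Theory Num.Theory.
Import numFieldNormedType.Exports.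

Local Open Scope classical_set_scope.
Local Open Scope ring_scope.

(** Write v = V(max(0, delta/L)) for the velocity that belongs to delta and
P(t) for the integral of v over [0, t]; every argument of phi in the equation
is then some P(t) - P(r), which is nonnegative because V is.

The equation for delta is a fixed point equation delta = op_k(delta)
[volterra_op].  Two estimates carry its theory.  The growth bound
|op_k(delta)(t)| <= a + b int_0^t |delta| [volterra_op_bound] gives, with
Gronwall, an a priori bound D on every solution in terms of the data.  Since V,
kbar, phi and its first derivatives are Lipschitz in the variables through which
delta enters, and the difference of two P's is at most Lip(V)/L times
int_0^t |delta - delta'|, one also has
|op_k(delta) - op_k'(delta')|(t) <= e |k - k'|_oo + w int_0^t |delta - delta'|
[volterra_op_diff], where w depends on bounds of k and of delta but not on k'
or delta': each product is expanded so that the second solution enters through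
differences only.  The second estimate gives existence (Picard iteration, which
contracts by 1/2 in the weight exp(2wt)), and, by Gronwall, uniqueness and the
stability of delta.

Elements of W^{1,oo} are exactly the primitives of bounded measurable functions
[weak_prim, prim_W1inf]; the nontrivial half is the lemma of du Bois-Reymond
[const_of_weak0].  A fixed point is in W^{1,oo} because op_k maps continuous
functions to such primitives [volterra_op_prim].  This rests on the rule for
differentiating int_0^t h(r) H(r, P(t) - P(r)) dr with h merely bounded and
measurable [leibniz], which, like the product rule [primM], is Fubini's theorem
on the triangle r <= s <= t.

The rate f is by definition delta' + v k, so it exists and is unique almost
everywhere.  Its stability cannot be read off the Volterra equation:
differentiating it puts second derivatives of phi under the integral, and to
compare these along two different flows would take third derivatives.  Instead,
integrating by parts along the characteristic r |-> (r, P(t) - P(r)) collapses the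
equation to
  k(t) = kbar(P(t)) + (delta(0) - int kbar) phi(0, P(t))
         + int_0^t f(r) phi(r, P(t) - P(r)) dr
[first_kind], which says that k is the trace at x = 0 of the solution of the
transport equation.  Differentiating in t gives a second kind equation for f,
  f(t) phi(t,0) = k'(t) - v(t) (kbar'(P(t)) + (delta(0) - int kbar)
      phi_x(0, P(t)) + int_0^t f(r) phi_x(r, P(t) - P(r)) dr)
[inflow_rep].  It is linear in f, so the same scheme (bound, difference,
Gronwall) estimates f - f' by the differences of k' and of delta
[inflow_formula_diff]; the Lipschitz constant of kbar' is where the second
derivative of kbar enters.

Analysis on the closed domains is one-sided at their boundary.  It is reduced
to the plane by freezing coordinates beyond the boundary [ext2]: this keeps
continuity and bounds, and differentiability in x is used only through the mean
value property [mean_value], which survives on the original domain. *)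

(** * One-sided derivatives *)

Section Derivatives.
Context (R : realType).
Local Notation leb := (@lebesgue_measure R).
Implicit Types (D I J : set R) (u : R -> R).

Definition has_deriv D u x (d : R) := diff_quot_in D u x --> d.

Lemma has_deriv_in D u x : derivable_in D u x ->
  has_deriv D u x (derive_in D u x).
Proof. by []. Qed.

Lemma has_derivS D D' u x d : D' `<=` D -> has_deriv D u x d ->
  has_deriv D' u x d.
Proof.
move=> D'D; apply: cvg_trans; apply: cvg_app.
exact: within_subset.
Qed.

Lemma near_within_dnbhs D x (P : R -> Prop) :
  (forall y, D y -> y != x -> P y) -> \forall y \near within D x^', P y.
Proof.
move=> h; apply: (@filterE _ (nbhs x)).
by move=> y yx Dy; exact: h.
Qed.

Lemma has_deriv_continuous D u x d : has_deriv D u x d ->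
  u y @[y --> within D x^'] --> u x.
Proof.
move=> ud.
have h : (u y - u x) / (y - x) * (y - x) + u x @[y --> within D x^'] -->
    d * 0 + u x.
  apply: cvgD; last exact: cvg_cst.
  apply: cvgM; first exact: ud.
  rewrite -(subrr x); apply: cvgB; last exact: cvg_cst.
  apply: cvg_trans; first exact: cvg_within.
  exact: cvg_within.
rewrite mulr0 add0r in h; apply: cvg_trans h; apply: near_eq_cvg.
by apply: near_within_dnbhs => y _ yx; rewrite divfK ?subrK// subr_eq0.
Qed.

Lemma has_deriv_is_derive (a b x d : R) u : x \in `]a, b[ ->
  has_deriv `[a, b] u x d -> is_derive x 1 u d.
Proof.
move=> xab ud.
have h : h^-1 *: (u (h *: 1 + x) - u x) @[h --> 0^'] --> d.
  have : (u (h + x) - u x) / (h + x - x) @[h --> 0^'] --> d.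
    move: ud; apply: cvg_trans => A /=.
    rewrite /diff_quot_in /= nbhs_simpl /= => A'.
    rewrite !near_simpl.
    have : \forall y \near x, y != x -> `[a, b]%classic y ->
      A ((u y - u x) / (y - x)).
      by move: A'; rewrite nbhs_simpl /within /= .
    rewrite -{1}(add0r x) => H.
    have : \forall h \near (0:R), h + x != x -> `[a, b]%classic (h + x) ->
      A ((u (h + x) - u x) / (h + x - x)).
      have c : (fun h : R => h + x) h @[h --> (0:R)] --> 0 + x.
        by apply: cvgD => //; exact: cvg_cst.
      exact: (c _ H).
    move=> H'.
    have : \forall h \near (0:R), `[a, b]%classic (h + x).
      have c : (fun h : R => h + x) h @[h --> (0:R)] --> x.
        by rewrite -[X in _ --> X]add0r; apply: cvgD => //; exact: cvg_cst.
      have := near_in_itvoo xab => xn.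
      apply: (@filterS _ (nbhs (0:R)) _ _ _ _ (c _ xn)) => h /=.
      by rewrite !in_itv/= => /andP[/ltW -> /ltW ->].
    move=> H2; apply: (@filterS2 _ (nbhs (0:R)) _ _ _ _ _ H' H2) => h {}H' {}H2 h0.
    have hx : h + x != x by rewrite addrC -subr_eq0 addrAC subrr add0r.
    exact: H'.
  apply: cvg_trans; apply: near_eq_cvg; apply: nearW => h.
  by rewrite addrK scaler1 /GRing.scale /= mulrC.
apply: DeriveDef; first by apply/cvg_ex; exists d.
exact/cvg_lim.
Qed.

Lemma has_deriv_within D u (g : R -> R) :
  (forall x, D x -> has_deriv D u x (g x)) -> {within D, continuous u}.
Proof.
move=> ud; apply/subspace_continuousP => x Dx.
have := has_deriv_continuous (ud _ Dx) => h A nA.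
apply: (@filterS _ (nbhs x) _ _ _ _ (h A nA)) => y /= H Dy.
have [->|yx] := eqVneq y x; first exact: nbhs_singleton nA.
exact: H.
Qed.

(** At interior points the relative derivative is the ordinary one, and at the end
points only continuity is used, which has_deriv_within provides. *)
Lemma MVT_in (a b : R) u (g : R -> R) : a < b ->
  (forall x, a <= x <= b -> has_deriv `[a, b] u x (g x)) ->
  exists2 c, a < c < b & u b - u a = g c * (b - a).
Proof.
move=> ab ud.
have [||c cab ->] := @MVT R u g a b ab.
- move=> x xab; apply: has_deriv_is_derive (xab) _.
  by apply: ud; move: xab; rewrite in_itv/= => /andP[/ltW -> /ltW ->].
- apply: (@has_deriv_within _ _ g) => x /=; rewrite in_itv/= => xab; exact: ud.
- by exists c => //; move: cab; rewrite in_itv.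
Qed.

Lemma FTC_in (a b : R) u (g : R -> R) : a <= b ->
  {within `[a, b], continuous g} ->
  (forall x, a <= x <= b -> has_deriv `[a, b] u x (g x)) ->
  u b - u a = \int[leb]_(x in `[a, b]) g x.
Proof.
rewrite le_eqVlt => /predU1P[<- _ _|ab cg ud].
  by rewrite subrr set_itv1 Rintegral_set1.
have cu : {within `[a, b], continuous u}.
  by apply: (@has_deriv_within _ _ g) => x /=; rewrite in_itv/=; exact: ud.
have [_ ua ub] := (continuous_within_itvP _ ab).1 cu.
rewrite /Rintegral (@continuous_FTC2 _ _ u)//.
- split=> // x xab.
  have [] := has_deriv_is_derive xab (ud x _) => //.
  by move: xab; rewrite in_itv/= => /andP[/ltW -> /ltW ->].
- move=> x xab; rewrite derive1E.
  have [] := has_deriv_is_derive xab (ud x _) => //.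
  by move: xab; rewrite in_itv/= => /andP[/ltW -> /ltW ->].
Qed.

(** Partial differentiability in increment form. Unlike derivatives at the boundary,
this form passes to extensions of F beyond I x J and can be composed without
limits. *)
Definition C1_on I J (F Ft Fx : R -> R -> R) : Prop :=
  [/\ forall t1 t2 x, I t1 -> I t2 -> J x ->
        exists2 xi, `|xi - t1| <= `|t2 - t1| &
          F t2 x - F t1 x = Ft xi x * (t2 - t1),
      forall t x1 x2, I t -> J x1 -> J x2 ->
        exists2 xi, `|xi - x1| <= `|x2 - x1| &
          F t x2 - F t x1 = Fx t xi * (x2 - x1),
      continuous (fun p : R * R => Ft p.1 p.2) &
      continuous (fun p : R * R => Fx p.1 p.2)].

Lemma cvg_comp2 (Y : Type) (G : set_system Y) {FG : Filter G}
    (F : R -> R -> R) (a b : Y -> R) (x z : R) :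
  continuous (fun p : R * R => F p.1 p.2) ->
  a y @[y --> G] --> x -> b y @[y --> G] --> z ->
  F (a y) (b y) @[y --> G] --> F x z.
Proof.
move=> cF ax bz.
apply: (cvg_comp (fun y => (a y, b y)) (fun p => F p.1 p.2)).
  exact: cvg_pair ax bz.
exact: (cF (x, z)).
Qed.

(** The usual proof: split the increment of F(sg, z) into one in each variable and
divide by y - s. The intermediate points are squeezed to sg s and z s, so
continuity of the partial derivatives concludes. *)
Lemma has_deriv_chain2 D I J F Ft Fx (sg z : R -> R) s dsg dz :
  C1_on I J F Ft Fx -> D s ->
  (forall y, D y -> I (sg y)) -> (forall y, D y -> J (z y)) ->
  has_deriv D sg s dsg -> has_deriv D z s dz ->
  has_deriv D (fun y => F (sg y) (z y)) s
    (Ft (sg s) (z s) * dsg + Fx (sg s) (z s) * dz).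
Proof.
move=> [mt mx cFt cFx] Ds Isg Jz dsgP dzP.
have /choice[xi xiP] : forall y, exists xi, D y ->
    `|xi - sg s| <= `|sg y - sg s| /\
    F (sg y) (z y) - F (sg s) (z y) = Ft xi (z y) * (sg y - sg s).
  move=> y; have [Dy|nDy] := pselect (D y); last by exists 0.
  by have [xi ? ?] := mt _ _ _ (Isg _ Ds) (Isg _ Dy) (Jz _ Dy); exists xi.
have /choice[et etP] : forall y, exists et, D y ->
    `|et - z s| <= `|z y - z s| /\
    F (sg s) (z y) - F (sg s) (z s) = Fx (sg s) et * (z y - z s).
  move=> y; have [Dy|nDy] := pselect (D y); last by exists 0.
  by have [et ? ?] := mx _ _ _ (Isg _ Ds) (Jz _ Ds) (Jz _ Dy); exists et.
have csg := has_deriv_continuous dsgP.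
have cz := has_deriv_continuous dzP.
(* w' stays as close to l as w does. *)
have squeeze (w w' : R -> R) (l : R) :
    (forall y, D y -> `|w' y - l| <= `|w y - l|) ->
    w y @[y --> within D s^'] --> l -> w' y @[y --> within D s^'] --> l.
  move=> ww' /cvgrPdist_le cw; apply/cvgrPdist_le => e e0.
  have := cw _ e0; have : \forall y \near within D s^', D y.
    by apply: near_within_dnbhs.
  apply: filterS2 => y Dy; apply: le_trans.
  by rewrite distrC [leRHS]distrC ww'.
have cxi : xi y @[y --> within D s^'] --> sg s.
  by apply: squeeze csg => y /xiP[].
have cet : et y @[y --> within D s^'] --> z s.
  by apply: squeeze cz => y /etP[].
have h : Ft (xi y) (z y) * ((sg y - sg s) / (y - s)) +
         Fx (sg s) (et y) * ((z y - z s) / (y - s)) @[y --> within D s^'] -->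
         Ft (sg s) (z s) * dsg + Fx (sg s) (z s) * dz.
  apply: cvgD; apply: cvgM => //.
  - exact: cvg_comp2 cFt cxi cz.
  - exact: (cvg_comp2 cFx (cvg_cst _) cet).
apply: cvg_trans h; apply: near_eq_cvg.
apply: near_within_dnbhs => y Dy ys.
have [_ e1] := xiP _ Dy; have [_ e2] := etP _ Dy.
by rewrite 2!mulrA -mulrDl -e1 -e2 addrA subrK.
Qed.

Lemma has_deriv_id D s : has_deriv D id s 1.
Proof.
have h : (cst 1 : R -> R) y @[y --> within D s^'] --> (1 : R) by exact: cvg_cst.
apply: cvg_trans h; apply: near_eq_cvg.
by apply: near_within_dnbhs => y Dy ys; rewrite divff// subr_eq0.
Qed.

Lemma has_deriv_cst D s a : has_deriv D (cst a) s 0.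
Proof.
have h : (cst 0 : R -> R) y @[y --> within D s^'] --> (0 : R) by exact: cvg_cst.
apply: cvg_trans h; apply: near_eq_cvg.
by apply: near_within_dnbhs => y _ _; rewrite subrr mul0r.
Qed.

Lemma has_derivB D u w s d e : has_deriv D u s d -> has_deriv D w s e ->
  has_deriv D (fun y => u y - w y) s (d - e).
Proof.
move=> du dw.
have h : (u y - u s) / (y - s) - (w y - w s) / (y - s)
    @[y --> within D s^'] --> d - e by exact: cvgB.
apply: cvg_trans h; apply: near_eq_cvg.
by apply: near_within_dnbhs => y _ _ /=; rewrite -mulrBl; congr (_ * _); ring.
Qed.

Lemma is_derive_has_deriv D u (s d : R) : is_derive s 1 u d -> has_deriv D u s d.
Proof.
move=> du; have : has_deriv setT u s d.
  have := @ex_derive _ _ _ _ _ _ _ du; rewrite /derivable => c.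
  have : h^-1 *: (u (h *: 1 + s) - u s) @[h --> 0^'] --> d.
    by rewrite -(@derive_val _ _ _ _ _ _ _ du).
  move=> h A nA.
  have : \forall h \near (0:R), h != 0 -> A (h^-1 *: (u (h *: 1 + s) - u s)).
    exact: (h A nA).
  move=> H.
  have cc : (fun y : R => y - s) h @[h --> s] --> 0.
    by rewrite -(subrr s); apply: cvgB => //; exact: cvg_cst.
  apply: (@filterS _ (nbhs s) _ _ _ _ (cc _ H)) => y /= Hy ys _.
  have := Hy _; rewrite subr_eq0 => /(_ ys).
  by rewrite scaler1 subrK /GRing.scale /= mulrC.
exact: has_derivS.
Qed.

(** Differentiability on the half line, in the only form in which it is used: it
involves no limit at the end point 0, and closeness of xi to x is all that the
chain rule and Lipschitz bounds require. *)
Definition mean_value (G Gx : R -> R) : Prop := forall x y, 0 <= x -> 0 <= y ->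
  exists2 xi, `|xi - x| <= `|y - x| & G y - G x = Gx xi * (y - x).

Definition lipschitz_ge0 (K : R) (G : R -> R) : Prop := forall x y, 0 <= x ->
  0 <= y ->
  `|G x - G y| <= K * `|x - y|.

Lemma mean_value_lip (K : R) (G Gx : R -> R) : mean_value G Gx ->
  (forall x, `|Gx x| <= K) -> lipschitz_ge0 K G.
Proof.
move=> Gm GK x y x0 y0; have [xi _ E] := Gm x y x0 y0.
by rewrite distrC [`|x - y|]distrC E normrM ler_wpM2r.
Qed.

End Derivatives.

(** * Bounded measurable functions and Fubini on a triangle *)

Section BoundedMeasurable.
Context (R : realType).
Local Notation leb := (@lebesgue_measure R).

(** The class, stable under products, in which all integrands live; bounded
everywhere rather than essentially, so that estimates are pointwise. Written bm
in lemma names. *)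
Definition bounded_mfun d (X : measurableType d) (D : set X) (g : X -> R) : Prop :=
  measurable_fun D g /\ exists M, forall x, D x -> `|g x| <= M.

Section bm_theory.
Context d (X : measurableType d).
Implicit Types (D : set X) (g h : X -> R).

Lemma bmS D D' g : measurable D -> D' `<=` D -> bounded_mfun D g ->
  bounded_mfun D' g.
Proof.
move=> mD D'D [mg [M gM]]; split; first exact: measurable_funS mg.
by exists M => x /D'D; exact: gM.
Qed.

Lemma bm_cst D (a : R) : bounded_mfun D (cst a).
Proof. by split => //; exists `|a|. Qed.

Lemma bmD D g h : bounded_mfun D g -> bounded_mfun D h ->
  bounded_mfun D (fun x => g x + h x).
Proof.
move=> [mg [M gM]] [mh [N hN]]; split; first exact: measurable_funD.
exists (M + N) => x Dx; apply: le_trans (ler_normD _ _) _.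
by rewrite lerD ?gM ?hN.
Qed.

Lemma bmM D g h : bounded_mfun D g -> bounded_mfun D h ->
  bounded_mfun D (fun x => g x * h x).
Proof.
move=> [mg [M gM]] [mh [N hN]]; split; first exact: measurable_funM.
exists (M * N) => x Dx; rewrite normrM.
by apply: ler_pM => //; [exact: gM|exact: hN].
Qed.

Lemma bmN D g : bounded_mfun D g -> bounded_mfun D (fun x => - g x).
Proof.
move=> [mg [M gM]]; split; first exact: measurable_funN.
by exists M => x Dx; rewrite normrN; exact: gM.
Qed.

Lemma bmB D g h : bounded_mfun D g -> bounded_mfun D h ->
  bounded_mfun D (fun x => g x - h x).
Proof. by move=> bg bh; apply: bmD => //; exact: bmN. Qed.

Lemma bm_norm D g : bounded_mfun D g -> bounded_mfun D (fun x => `|g x|).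
Proof.
move=> [mg [M gM]]; split; first exact: measurableT_comp.
by exists M => x Dx; rewrite normr_id; exact: gM.
Qed.

Lemma eq_bm D g h : (forall x, D x -> g x = h x) -> bounded_mfun D g ->
  bounded_mfun D h.
Proof.
move=> gh [mg [M gM]]; split.
  by apply: eq_measurable_fun mg => x; rewrite inE; exact: gh.
by exists M => x Dx; rewrite -gh//; exact: gM.
Qed.

Lemma bm_integrable (mu : {measure set X -> \bar R}) D g : measurable D ->
  (mu D < +oo)%E -> bounded_mfun D g -> mu.-integrable D (EFin \o g).
Proof.
move=> mD fD [mg [M gM]]; apply: measurable_bounded_integrable => //.
exists M; split; first exact: num_real.
by move=> N MN x /gM h; apply: le_trans h (ltW MN).
Qed.

End bm_theory.

Lemma bm_comp d d' (X : measurableType d) (Y : measurableType d')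
    (D : set X) (E : set Y) (h : X -> Y) (g : Y -> R) :
  measurable E -> (forall x, D x -> E (h x)) -> measurable_fun D h ->
  bounded_mfun E g -> bounded_mfun D (fun x => g (h x)).
Proof.
move=> mE DE mh [mg [M gM]]; split; last by exists M => x /DE; exact: gM.
by apply: (measurable_comp mE _ mg mh) => _ [x Dx <-]; exact: DE.
Qed.

Lemma within_bm (a b : R) (g : R -> R) : {within `[a, b], continuous g} ->
  bounded_mfun `[a, b] g.
Proof.
move=> cg; split; first exact: subspace_continuous_measurable_fun.
have : compact (g @` `[a, b]).
  by apply: continuous_compact => //; exact: segment_compact.
move=> /compact_bounded[M [_ hM]].
by exists (M + 1) => x xab; apply: (hM (M + 1)); [rewrite ltrDl|exists x].
Qed.

Lemma bm_itv_integrable (a b : R) (g : R -> R) : bounded_mfun `[a, b] g ->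
  leb.-integrable `[a, b] (EFin \o g).
Proof.
move=> bg; apply: (@bm_integrable _ _ leb `[a, b] g) => //=.
rewrite lebesgue_measure_itv/=.
by case: ifP => _; rewrite ?ltry// -EFinB ltry.
Qed.

Lemma sub_itvcc (a b c d : R) : a <= c -> d <= b -> `[c, d] `<=` `[a, b].
Proof.
move=> ac db x /=; rewrite !in_itv/= => /andP[cx xd].
by rewrite (le_trans ac cx) (le_trans xd db).
Qed.

Lemma in0T (T s t : R) : 0 <= t <= T -> 0 <= s <= t -> 0 <= s <= T.
Proof. by move=> /andP[_ tT] /andP[-> st]; exact: le_trans st tT. Qed.

Lemma bm_sub_itv (a b c d : R) (g : R -> R) : a <= c -> d <= b ->
  bounded_mfun `[a, b] g -> bounded_mfun `[c, d] g.
Proof. by move=> ac db; apply: bmS => //; exact: sub_itvcc. Qed.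

Lemma int_eq (a b : R) (g h : R -> R) : (forall x, a <= x <= b -> g x = h x) ->
  \int[leb]_(x in `[a, b]) g x = \int[leb]_(x in `[a, b]) h x.
Proof.
by move=> gh; apply: eq_Rintegral => x; rewrite inE/= in_itv/=; exact: gh.
Qed.

Lemma int_cst (a b c : R) : a <= b -> \int[leb]_(x in `[a, b]) c = c * (b - a).
Proof.
move=> ab; rewrite Rintegral_cst//= lebesgue_measure_itv/= lte_fin.
move: ab; rewrite le_eqVlt => /predU1P[->|->] //; by rewrite ltxx subrr mulr0.
Qed.

Lemma int_add (a b : R) (g h : R -> R) : bounded_mfun `[a, b] g ->
  bounded_mfun `[a, b] h ->
  \int[leb]_(x in `[a, b]) (g x + h x) =
  \int[leb]_(x in `[a, b]) g x + \int[leb]_(x in `[a, b]) h x.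
Proof. by move=> bg bh; rewrite RintegralD//; exact: bm_itv_integrable. Qed.

Lemma int_sub (a b : R) (g h : R -> R) : bounded_mfun `[a, b] g ->
  bounded_mfun `[a, b] h ->
  \int[leb]_(x in `[a, b]) (g x - h x) =
  \int[leb]_(x in `[a, b]) g x - \int[leb]_(x in `[a, b]) h x.
Proof. by move=> bg bh; rewrite RintegralB//; exact: bm_itv_integrable. Qed.

Lemma int_mul (a b c : R) (g : R -> R) : bounded_mfun `[a, b] g ->
  \int[leb]_(x in `[a, b]) (c * g x) = c * \int[leb]_(x in `[a, b]) g x.
Proof. by move=> bg; rewrite RintegralZl//; exact: bm_itv_integrable. Qed.

Lemma int_le (a b : R) (g h : R -> R) : bounded_mfun `[a, b] g ->
  bounded_mfun `[a, b] h ->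
  (forall x, a <= x <= b -> g x <= h x) ->
  \int[leb]_(x in `[a, b]) g x <= \int[leb]_(x in `[a, b]) h x.
Proof.
move=> bg bh gh; apply: le_Rintegral; [by []|exact: bm_itv_integrable..|].
by move=> x /=; rewrite in_itv/=; exact: gh.
Qed.

Lemma int_norm_le (a b : R) (g h : R -> R) : bounded_mfun `[a, b] g ->
  bounded_mfun `[a, b] h ->
  (forall x, a <= x <= b -> `|g x| <= h x) ->
  `|\int[leb]_(x in `[a, b]) g x| <= \int[leb]_(x in `[a, b]) h x.
Proof.
move=> bg bh gh; apply: le_trans (le_normr_Rintegral _ _) _; [by []| |].
  exact: bm_itv_integrable.
by apply: int_le => //; exact: bm_norm.
Qed.

Lemma int_norm_cst (a b c : R) (g : R -> R) : a <= b -> bounded_mfun `[a, b] g ->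
  (forall x, a <= x <= b -> `|g x| <= c) ->
  `|\int[leb]_(x in `[a, b]) g x| <= c * (b - a).
Proof.
move=> ab bg gc; rewrite -int_cst//; apply: int_norm_le => //; exact: bm_cst.
Qed.

Lemma int_ge0 (a b : R) (g : R -> R) :
  (forall x, a <= x <= b -> 0 <= g x) -> 0 <= \int[leb]_(x in `[a, b]) g x.
Proof.
by move=> g0; apply: Rintegral_ge0 => x /=; rewrite in_itv/=; exact: g0.
Qed.

Lemma int_split (a b c : R) (g : R -> R) : a <= c <= b -> bounded_mfun `[a, b] g ->
  \int[leb]_(x in `[a, b]) g x =
  \int[leb]_(x in `[a, c]) g x + \int[leb]_(x in `[c, b]) g x.
Proof.
move=> /andP[ac cb] bg; have ig := bm_itv_integrable bg.
have := @Rintegral_itvB _ g (BLeft a) (BRight b) c ig.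
rewrite !bnd_simp => /(_ ac cb) /eqP; rewrite subr_eq addrC => /eqP ->.
congr (_ + _); rewrite Rintegral_itv_obnd_cbnd//.
apply: integrableS ig => //; apply: subset_itv; rewrite bnd_simp//.
Qed.

(** Both iterated integrals are those of K restricted to the triangle r <= s <= t
of the plane. The inner integral J is only known to be measurable through
Fubini's theorem, which is why it is returned with its boundedness. *)
Lemma triangle_fubini (T : R) (K : R -> R -> R) :
  bounded_mfun (`[0, T] `*` `[0, T]) (fun p : R * R => K p.1 p.2) ->
  exists2 J, bounded_mfun `[0, T] J &
    (forall s, 0 <= s <= T -> J s = \int[leb]_(r in `[0, s]) K r s) /\
    forall t, 0 <= t <= T -> \int[leb]_(s in `[0, t]) J s =
      \int[leb]_(r in `[0, t]) \int[leb]_(s in `[r, t]) K r s.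
Proof.
move=> bK.
pose D t : set (R * R) := [set p | (0 <= p.1) && (p.1 <= p.2) && (p.2 <= t)].
have mD t : measurable (D t).
  rewrite /D; have -> : [set p : R * R | (0 <= p.1) && (p.1 <= p.2) && (p.2 <= t)]
    = (fun p : R * R => ((cst 0 : R * R -> R) p <= p.1) && (p.1 <= p.2) &&
      (p.2 <= (cst t : R * R -> R) p)) @^-1` [set true] by [].
  rewrite -[X in measurable X]setTI.
  apply: (_ : measurable_fun setT _) => //.
  by do !apply: measurable_and; apply: measurable_fun_ler.
pose f t (p : R * R) := ((fun p => K p.1 p.2) \_ (D t)) p.
have D2 t : t <= T -> D t `<=` `[0, T] `*` `[0, T].
  move=> tT [x y]; rewrite /D /= !in_itv/= => /andP[/andP[x0 xy] yt].
  by rewrite x0 (le_trans x0 xy) (le_trans yt tT) (le_trans xy (le_trans yt tT)).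
have bD t : t <= T -> bounded_mfun (D t) (fun p : R * R => K p.1 p.2).
  move=> tT; apply: bmS bK; last exact: D2.
  exact: measurableX.
have fin t : t <= T -> ((leb \x leb)%E (D t) < +oo)%E.
  move=> tT; apply: (@le_lt_trans _ _ ((leb \x leb)%E (`[0, T] `*` `[0, T]))).
    by apply: le_measure; rewrite ?inE; [exact: mD|exact: measurableX|exact: D2].
  rewrite product_measure1E//= !lebesgue_measure_itv/=.
  by case: ifP => _; rewrite ?mule0 ?ltry// -EFinB -EFinM ltry.
have if_ t : t <= T -> (leb \x leb)%E.-integrable setT (EFin \o f t).
  move=> tT.
  have h := @bm_integrable _ _ (leb \x leb)%E (D t) _ (mD t) (fin t tT) (bD t tT).
  by have := (@integrable_mkcond _ _ _ (leb \x leb)%E (D t) _ (mD t)).1 h;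
    rewrite restrict_EFin.
have Gin t y : 0 <= y <= t ->
    (fun x : R => f t (x, y)) = (fun x => K x y) \_ `[0, y].
  move=> /andP[y0 yt]; apply/funext => x; rewrite /f !patchE /D.
  congr (if _ then _ else _); apply/idP/idP; rewrite !inE/= in_itv/=.
    by move=> /andP[].
  by move=> ->; rewrite yt.
have Gout t y : ~~ (0 <= y <= t) -> (fun x : R => f t (x, y)) = cst 0.
  move=> yt; apply/funext => x; rewrite /f patchE memNset//.
  rewrite /D/= => /andP[/andP[x0 xy] y_t]; move: yt.
  by rewrite y_t (le_trans x0 xy).
have Fin t x : 0 <= x <= t ->
    (fun y : R => f t (x, y)) = (fun y => K x y) \_ `[x, t].
  move=> /andP[x0 xt]; apply/funext => y; rewrite /f !patchE /D.
  by congr (if _ then _ else _); apply/idP/idP; rewrite !inE/= in_itv/= x0.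
have Fout t x : ~~ (0 <= x <= t) -> (fun y : R => f t (x, y)) = cst 0.
  move=> xt; apply/funext => y; rewrite /f patchE memNset//.
  rewrite /D/= => /andP[/andP[x0 xy] yt]; move: xt.
  by rewrite x0 (le_trans xy yt).
pose J y := \int[leb]_(x in `[0, y]) K x y.
have JE y t : 0 <= y <= t -> J y = fine (\int[leb]_x (f t (x, y))%:E)%E.
  by move=> yt; rewrite /J Rintegral_mkcond -(Gin t).
have bKy y : 0 <= y <= T -> bounded_mfun `[0, y] (K ^~ y).
  move=> /andP[y0 yT].
  apply: (bm_comp (h := fun x => (x, y)) (g := fun p => K p.1 p.2) _ _ _ bK).
  - exact: measurableX.
  - move=> x /=; rewrite !in_itv/= y0 yT => /andP[-> xy].
    by rewrite (le_trans xy yT).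
  - by apply: measurable_funTS; exact: pair2_measurable.
have bKx x : 0 <= x <= T -> bounded_mfun `[x, T] (K x).
  move=> /andP[x0 xT].
  apply: (bm_comp (h := fun y => (x, y)) (g := fun p => K p.1 p.2) _ _ _ bK).
  - exact: measurableX.
  - move=> y /=; rewrite !in_itv/= x0 xT => /andP[xy ->].
    by rewrite (le_trans x0 xy).
  - by apply: measurable_funTS; exact: pair1_measurable.
(* J is measurable as an inner integral of the restriction to the largest triangle;
   the identity uses the triangle of size t. *)
exists J; last split => // t /andP[t0 tT].
- split.
    apply: (@eq_measurable_fun _ _ _ _ _ (fun y => fine (\int[leb]_x (f T (x,
      y))%:E)%E)).
      by move=> y; rewrite inE/= in_itv/= => yT; rewrite (JE _ T).
    apply: measurable_funTS; apply: measurableT_comp => //.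
    have mG := measurable_fubini_G (if_ T (lexx T)). exact: mG.
  have [mK [M KM]] := bK.
  exists (M * T) => y /=; rewrite in_itv/= => /andP[y0 yT].
  have bKy' := bKy _ (introT andP (conj y0 yT)).
  have M0 : 0 <= M.
    apply: le_trans (normr_ge0 (K 0 0)) (KM (0, 0) _).
    by rewrite /= in_itv/= lexx (le_trans y0 yT).
  apply: (@le_trans _ _ (M * (y - 0))).
    apply: int_norm_cst => // x /andP[x0 xy].
    by apply: (KM (x, y)); rewrite /= !in_itv/= x0 y0 yT (le_trans xy yT).
  by rewrite subr0 ler_wpM2l.
- have FF := Fubini (if_ t tT).
  have LE : (integral leb `[0%R, t] (fun s => (J s)%:E) =
             \int[leb]_y \int[leb]_x (f t (x, y))%:E)%E.
    rewrite integral_mkcond; apply: eq_integral => y _; rewrite patchE.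
    case: ifPn; rewrite ?notin_setE ?inE/= in_itv/= => yt.
      rewrite (JE _ t)// fineK//.
      have -> : (fun x => (f t (x, y))%:E) =
          (EFin \o K^~ y) \_ `[0, y].
        by rewrite restrict_EFin -(Gin t).
      rewrite -integral_mkcond.
      apply: integrable_fin_num => //; apply: bm_itv_integrable.
      apply: bKy; move/andP: yt => [-> yt]; exact: le_trans yt tT.
    move/negP : yt => yt.
    have -> : (fun x => (f t (x, y))%:E) = EFin \o (fun x => f t (x, y)) by [].
    by rewrite Gout//= integral0_eq.
  have RE : (integral leb `[0%R, t] (fun r => (Rintegral leb `[r, t] (K r))%:E) =
             \int[leb]_x \int[leb]_y (f t (x, y))%:E)%E.
    rewrite integral_mkcond; apply: eq_integral => x _; rewrite patchE.
    case: ifPn; rewrite ?notin_setE ?inE/= in_itv/= => xt.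
      have -> : (fun y => (f t (x, y))%:E) =
          (EFin \o K x) \_ `[x, t].
        by rewrite restrict_EFin -(Fin t).
      rewrite -integral_mkcond /Rintegral fineK//.
      apply: integrable_fin_num => //; apply: bm_itv_integrable.
      move/andP: xt => [x0 xt]; apply: (bm_sub_itv (lexx x) tT); apply: bKx.
      by rewrite x0 (le_trans xt tT).
    move/negP : xt => xt.
    have -> : (fun y => (f t (x, y))%:E) = EFin \o (fun y => f t (x, y)) by [].
    by rewrite Fout//= integral0_eq.
  by rewrite /Rintegral LE RE -FF.
Qed.

End BoundedMeasurable.

(** * Primitives of bounded functions *)

(** The ring tactic compares atoms up to conversion, which is slow on integrals;
they are turned into variables first. *)
Ltac ring_int := repeat match goal with |- context [@Rintegral ?d ?X ?R ?m ?D ?f] =>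
  let x := fresh "x" in move: (@Rintegral d X R m D f) => x end; ring.

Section Primitives.
Context (R : realType).
Local Notation leb := (@lebesgue_measure R).

(** The product sigma-algebra is generated by boxes, and an open set of the plane is
the countable union of the rational boxes that it contains. *)
Lemma continuous_measurable2 (F : R * R -> R) : continuous F ->
  measurable_fun setT F.
Proof.
move=> cF; apply: (measurability _ (RGenOpens.measurableE R)) => //.
move=> _ [_ [a [b ->]] <-]; rewrite setTI; set O := `]a, b[%classic.
have oO : open O by exact: interval_open.
have oF : open (F @^-1` O) by apply: open_comp => // p _; exact: cF.
pose box (q : (rat * rat) * (rat * rat)) : set (R * R) :=
  `]ratr q.1.1, ratr q.1.2[ `*` `]ratr q.2.1, ratr q.2.2[.
have -> : F @^-1` O = \bigcup_(q in [set q | box q `<=` F @^-1` O]) box q.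
  apply/seteqP; split; last by move=> p [q /= h]; exact: h.
  move=> [x y] Oxy.
  have : nbhs (x, y) (F @^-1` O) by exact: open_nbhs_nbhs.
  move=> [[A B] /= [/nbhs_ballP[e1 /= e10 A1] /nbhs_ballP[e2 /= e20 B1]] AB].
  have near (z e : R) : 0 < e -> exists ab : rat * rat,
      (ratr ab.1 < z < ratr ab.2) /\
      (forall w, ratr ab.1 < w < ratr ab.2 -> ball z e w).
    move=> e0.
    have [p] := @rat_in_itvoo R (z - e) z ltac:(by rewrite ltrBlDr ltrDl).
    have [q] := @rat_in_itvoo R z (z + e) ltac:(by rewrite ltrDl).
    rewrite !in_itv/= => /andP[zq qe] /andP[ep pz].
    exists (p, q) => /=; split; first by rewrite pz zq.
    move=> w /andP[pw wq].
    by rewrite /ball /= ltr_norml; apply/andP; split; lra.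
  have [ab1 [xab1 s1]] := near x e1 e10.
  have [ab2 [yab2 s2]] := near y e2 e20.
  exists (ab1, ab2); last by split; rewrite /= in_itv/=.
  move=> [x' y']; rewrite /box /= !in_itv/= => -[x1 y1]; apply: (AB (x', y'));
    split => /=.
    by apply: A1; exact: s1.
  by apply: B1; exact: s2.
rewrite bigcup_mkcond; apply: countable_bigcupT_measurable => [|q].
  exact: countableP.
case: ifP => // _; apply: measurableX; exact: measurable_itv.
Qed.

Lemma bm_pullback2 d (X : measurableType d) (D : set X) (F : R -> R -> R)
    (a b : X -> R) :
  measurable D -> continuous (fun p : R * R => F p.1 p.2) ->
  measurable_fun D a -> measurable_fun D b ->
  (exists M, forall p, D p -> `|F (a p) (b p)| <= M) ->
  bounded_mfun D (fun p => F (a p) (b p)).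
Proof.
move=> mD cF ma mb hM; split => //.
have mF := continuous_measurable2 cF.
have mab : measurable_fun setT (fun p => ((a \_ D) p, (b \_ D) p)).
  by apply: measurable_fun_pair; apply/(measurable_restrictT _ mD).
have := measurableT_comp mF mab => /(@measurable_funTS _ _ _ _ D).
apply: eq_measurable_fun => p pD /=.
by rewrite !patchE pD.
Qed.

(** W^{1,oo}(0, T) in the form suited to calculus: Lipschitz functions together with
a bounded representative of their derivative. Written prim in lemma names. *)
Definition primitive (T : R) (u g : R -> R) : Prop := bounded_mfun `[0, T] g /\
  forall t, 0 <= t <= T -> u t = u 0 + \int[leb]_(s in `[0, t]) g s.

Lemma int00 (a : R) (g : R -> R) : \int[leb]_(s in `[a, a]) g s = 0.
Proof. by rewrite set_itv1 Rintegral_set1. Qed.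

Lemma prim_int (T : R) (g : R -> R) : bounded_mfun `[0, T] g ->
  primitive T (fun t => \int[leb]_(s in `[0, t]) g s) g.
Proof. by move=> bg; split=> // t tT; rewrite int00 add0r. Qed.

Lemma prim_incr T u g a b : primitive T u g -> 0 <= a -> a <= b -> b <= T ->
  u b - u a = \int[leb]_(s in `[a, b]) g s.
Proof.
move=> [bg ug] a0 ab bT.
rewrite ug ?(le_trans a0 ab)//= [u a]ug ?a0 ?(le_trans ab bT)//.
rewrite (@int_split R 0 b a) ?a0//; first by ring_int.
exact: bm_sub_itv bg.
Qed.

Lemma prim_lip T u g : primitive T u g -> exists M, 0 <= M /\
  forall a b, 0 <= a <= T -> 0 <= b <= T -> `|u b - u a| <= M * `|b - a|.
Proof.
move=> ug; have [bg _] := ug; have [_ [M gM]] := bg.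
exists (Num.max 0 M); split; first by rewrite le_max lexx.
have H a b : 0 <= a -> a <= b -> b <= T -> `|u b - u a| <= Num.max 0 M * `|b - a|.
  move=> a0 ab bT; rewrite (prim_incr ug)// (@ger0_norm _ (b - a)) ?subr_ge0//.
  apply: int_norm_cst => //; first exact: bm_sub_itv bg.
  move=> x /andP[ax xb]; rewrite le_max gM ?orbT//= in_itv/=.
  by rewrite (le_trans a0 ax) (le_trans xb bT).
move=> a b /andP[a0 aT] /andP[b0 bT].
have [ab|/ltW ba] := leP a b; first exact: H.
by rewrite distrC [`|b - a|]distrC; exact: H.
Qed.

Lemma lip_within (D : set R) (M : R) (u : R -> R) :
  (forall a b, D a -> D b -> `|u b - u a| <= M * `|b - a|) ->
  {within D, continuous u}.
Proof.
move=> uM; apply/subspace_continuousP => x Dx.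
apply/cvgrPdist_le => e e0.
have M1 : 0 < `|M| + 1 by rewrite ltr_wpDl.
have /cvgrPdist_le h : id y @[y --> x] --> x by exact: cvg_id.
have {h} := h _ (divr_gt0 e0 M1); apply: filterS => y xy Dy; rewrite distrC.
apply: le_trans (uM _ _ Dx Dy) _; rewrite distrC.
apply: (@le_trans _ _ ((`|M| + 1) * `|x - y|)).
  by rewrite ler_wpM2r// (le_trans (ler_norm _))// lerDl.
by rewrite mulrC -ler_pdivlMr.
Qed.

Lemma prim_continuous T u g : primitive T u g -> {within `[0, T], continuous u}.
Proof.
move=> /prim_lip[M [_ uM]]; apply: (@lip_within _ M) => a b /=.
by rewrite !in_itv/=; exact: uM.
Qed.

Lemma prim_bm T u g : primitive T u g -> bounded_mfun `[0, T] u.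
Proof. by move=> /prim_continuous; exact: within_bm. Qed.

Lemma eq_prim T u u' g g' : (forall t, 0 <= t <= T -> u' t = u t) ->
  (forall t, 0 <= t <= T -> g' t = g t) -> primitive T u g -> primitive T u' g'.
Proof.
move=> uu gg [bg ug]; split.
  by apply: eq_bm bg => x /=; rewrite in_itv/= => /gg.
move=> t /andP[t0 tT]; rewrite !uu ?lexx ?t0 ?tT// ?(le_trans t0 tT)//.
rewrite ug ?t0//; congr (_ + _); apply: int_eq => s /andP[s0 st].
by rewrite gg// s0 (le_trans st tT).
Qed.

Lemma primD T u w g h : primitive T u g -> primitive T w h ->
  primitive T (fun t => u t + w t) (fun t => g t + h t).
Proof.
move=> [bg ug] [bh wh]; split; first exact: bmD.
move=> t /andP[t0 tT]; rewrite (@int_add R 0 t g h); [|exact: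
  bm_sub_itv bg|exact: bm_sub_itv bh].
rewrite (ug t) ?t0// (wh t) ?t0//; ring_int.
Qed.

Lemma primZ T c u g : primitive T u g -> primitive T (fun t => c * u t)
  (fun t => c * g t).
Proof.
move=> [bg ug]; split; first by apply: bmM => //; exact: bm_cst.
move=> t /andP[t0 tT]; rewrite ug ?t0// int_mul ?mulrDr//.
exact: bm_sub_itv bg.
Qed.

Lemma primB T u w g h : primitive T u g -> primitive T w h ->
  primitive T (fun t => u t - w t) (fun t => g t - h t).
Proof.
move=> ug /(@primZ _ (-1)) wh; have := primD ug wh.
by apply: eq_prim => t _; rewrite mulN1r.
Qed.

(** The derivatives are only defined almost everywhere, so the product rule is not
pointwise calculus: it is Fubini on the triangle for the kernel g(r) h(s), whose
inner integrals are the increments of u and w. *)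
Lemma primM T u w g h : primitive T u g -> primitive T w h ->
  primitive T (fun t => u t * w t) (fun t => g t * w t + u t * h t).
Proof.
move=> pu pw; have [bg ug] := pu; have [bh wh] := pw.
have bu := prim_bm pu; have bw := prim_bm pw.
have bgw := bmM bg bw; have buh := bmM bu bh.
split; first exact: bmD.
move=> t /andP[t0 tT].
have bK : bounded_mfun (`[0, T] `*` `[0, T]) (fun p : R * R => g p.1 * h p.2).
  apply: bmM.
    apply: (bm_comp (h := fst) (g := g) _ _ _ bg) => //; first by move=> p [].
    by apply: measurable_funTS; exact: measurable_fst.
  apply: (bm_comp (h := snd) (g := h) _ _ _ bh) => //; first by move=> p [].
    by apply: measurable_funTS; exact: measurable_snd.
have [J bJ [JE JF]] := @triangle_fubini R T (fun r s => g r * h s) bK.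
have sub (f : R -> R) : bounded_mfun `[0, T] f -> bounded_mfun `[0, t] f.
  by move=> bf; exact: bm_sub_itv bf.
have E1 : \int[leb]_(s in `[0, t]) J s =
  \int[leb]_(s in `[0, t]) ((u s * h s) - u 0 * h s).
  apply: int_eq => s /andP[s0 st]; rewrite JE; last by rewrite s0 (le_trans st tT).
  have bgs : bounded_mfun `[0, s] g by apply: bm_sub_itv bg; rewrite ?(le_trans st).
  rewrite (ug s) ?s0 ?(le_trans st tT)//.
  under eq_Rintegral do rewrite mulrC.
  by rewrite int_mul//; ring_int.
have E2 : \int[leb]_(r in `[0, t]) \int[leb]_(s in `[r, t]) (g r * h s) =
  \int[leb]_(r in `[0, t]) (w t * g r - g r * w r).
  apply: int_eq => r /andP[r0 rt]; rewrite int_mul; last exact: bm_sub_itv bh.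
  by rewrite -(prim_incr pw r0 rt tT); ring_int.
have := JF t; rewrite t0 tT E1 E2 => /(_ isT).
rewrite int_sub; [|exact: sub|apply: bmM; [exact: bm_cst|exact: sub]].
rewrite int_sub; [|apply: bmM; [exact: bm_cst|exact: sub]|exact: sub].
rewrite int_mul; last exact: sub.
rewrite int_mul; last exact: sub.
rewrite int_add; [|exact: sub|exact: sub].
move=> E; have := ug t; have := wh t; rewrite t0 tT => /(_ isT) wt /(_ isT) ut.
have -> : \int[leb]_(s in `[0, t]) (u s * h s) = w t *
   \int[leb]_(s in `[0, t]) g s - \int[leb]_(s in `[0, t]) (g s * w s) +
   u 0 * \int[leb]_(s in `[0, t]) h s by rewrite -E subrK.
rewrite ut wt; ring_int.
Qed.

End Primitives.

(** * Differentiating an integral along a flow *)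

Section Leibniz.
Context (R : realType).
Local Notation leb := (@lebesgue_measure R).

Lemma C1_prim (T : R) (u g : R -> R) : {within `[0, T], continuous g} ->
  (forall t, 0 <= t <= T -> has_deriv `[0, T] u t (g t)) -> primitive T u g.
Proof.
move=> cg ug; split; first exact: within_bm.
move=> t /andP[t0 tT]; rewrite -(@FTC_in _ 0 t u g) ?subrKC//.
  by apply: continuous_subspaceW cg; exact: sub_itvcc.
move=> x /andP[x0 xt]; apply: (@has_derivS _ `[0, T]); first exact: sub_itvcc.
by apply: ug; rewrite x0 (le_trans xt tT).
Qed.

(** The fundamental theorem of calculus including the end points, by averaging
v(s) - v(r) over the interval between s and y. *)
Lemma int_has_deriv (T : R) (v : R -> R) s : {within `[0, T], continuous v} ->
  0 <= s <= T ->
  has_deriv `[0, T] (fun t => \int[leb]_(r in `[0, t]) v r) s (v s).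
Proof.
move=> cv /andP[s0 sT].
have bv := within_bm cv.
have pv := prim_int bv.
apply/cvgrPdist_le => e e0.
have sI : `[0, T]%classic s by rewrite /= in_itv/= s0 sT.
have /cvgrPdist_le/(_ e e0) cs := (subspace_continuousP _ _).1 cv s sI.
have {cs} : \forall y \near s, `[0, T]%classic y -> `|v s - v y| <= e by exact: cs.
move=> /nbhs_ballP[d /= d0 dP].
have key a b : 0 <= a -> a < b -> b <= T ->
  (forall y, a <= y <= b -> `|v s - v y| <= e) ->
  `|v s - (\int[leb]_(r in `[0, b]) v r - \int[leb]_(r in `[0, a]) v r) / (b -
    a)| <= e.
  move=> a0 ab bT H.
  have ba0 : 0 < b - a by rewrite subr_gt0.
  rewrite (prim_incr pv a0 (ltW ab) bT).
  have -> : v s - \int[leb]_(r in `[a, b]) v r / (b - a) =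
     (\int[leb]_(r in `[a, b]) (v s - v r)) / (b - a).
    rewrite int_sub; [|exact: bm_cst|exact: bm_sub_itv bv].
    rewrite int_cst ?(ltW ab)// mulrBl mulfK// gt_eqF//.
  rewrite normrM normfV (gtr0_norm ba0) ler_pdivrMr//.
  apply: int_norm_cst; [exact: ltW| |exact: H].
  by apply: bmB; [exact: bm_cst|exact: bm_sub_itv bv].
suff : \forall y \near s, y != s -> `[0, T]%classic y ->
   `|v s - (\int[leb]_(r in `[0, y]) v r - \int[leb]_(r in `[0, s]) v r) / (y -
     s)| <= e.
  by [].
apply/nbhs_ballP; exists d => // y /= yd ys; rewrite in_itv/= => /andP[y0 yT].
move: yd; rewrite /ball/= => yd.
have [ys'|sy|E] := ltgtP y s; last by rewrite E eqxx in ys.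
- rewrite -[X in `|_ - X|]mulrNN -invrN !opprB.
  apply: key => // x /andP[yx xs]; apply: dP => /=.
    rewrite /ball/= ger0_norm ?subr_ge0//; apply: le_lt_trans yd.
    by rewrite ger0_norm ?subr_ge0 ?(ltW ys')// lerB.
  by rewrite in_itv/= (le_trans y0 yx) (le_trans xs sT).
- apply: key => // x /andP[sx xy]; apply: dP => /=.
    rewrite /ball/= distrC ger0_norm ?subr_ge0//.
    apply: le_lt_trans yd.
    by rewrite distrC ger0_norm ?subr_ge0 ?(ltW sy)// lerB.
  by rewrite in_itv/= (le_trans s0 sx) (le_trans xy yT).
Qed.

Variables (T : R) (v : R -> R).
Hypothesis cv : {within `[0, T], continuous v}.
Hypothesis v0 : forall t, 0 <= t <= T -> 0 <= v t.
Let P t := \int[leb]_(r in `[0, t]) v r.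

Lemma int_incr_ge0 r t : 0 <= r -> r <= t -> t <= T -> 0 <= P t - P r.
Proof.
move=> r0 rt tT; rewrite (prim_incr (prim_int (within_bm cv)) r0 rt tT).
apply: int_ge0 => x /andP[rx xt]; apply: v0.
by rewrite (le_trans r0 rx) (le_trans xt tT).
Qed.

Lemma bm_along d (X : measurableType d) (D : set X) (F : R -> R -> R)
    (a b : X -> R) :
  measurable D -> continuous (fun p : R * R => F p.1 p.2) ->
  (exists M : R, forall t x, `|F t x| <= M) ->
  measurable_fun D a -> measurable_fun D b ->
  (forall x, D x -> 0 <= a x <= T /\ 0 <= b x <= T) ->
  bounded_mfun D (fun x => F (a x) (P (b x) - P (a x))).
Proof.
move=> mD cF [M FM] ma mb ab.
have [mP _] := prim_bm (prim_int (within_bm cv)).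
have mPc (c : X -> R) : measurable_fun D c -> (forall x, D x -> 0 <= c x <= T) ->
    measurable_fun D (fun x => P (c x)).
  move=> mc cT; apply: (measurable_comp _ _ mP mc) => //.
  by move=> _ [x Dx <-] /=; rewrite in_itv/= cT.
apply: (bm_pullback2 mD cF) => //; last by exists M.
apply: measurable_funB; apply: mPc => // x /ab[] //.
Qed.

Variables (h : R -> R) (H Hx : R -> R -> R).
Hypothesis bh : bounded_mfun `[0, T] h.
Hypothesis mx : forall r, 0 <= r <= T -> mean_value (H r) (Hx r).
Hypothesis cH : continuous (fun p : R * R => H p.1 p.2).
Hypothesis cHx : continuous (fun p : R * R => Hx p.1 p.2).
Hypothesis bH : exists M : R, forall t x, `|H t x| <= M.
Hypothesis bHx : exists M : R, forall t x, `|Hx t x| <= M.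

Lemma bm_along_l (F : R -> R -> R) (t : R) : continuous (fun p :
  R * R => F p.1 p.2) ->
  (exists M : R, forall t x, `|F t x| <= M) -> 0 <= t <= T ->
  bounded_mfun `[0, t] (fun r => F r (P t - P r)).
Proof.
move=> cF bF /andP[t0 tT].
apply: (@bm_along _ _ `[0, t] F id (cst t)) => // x /=.
rewrite in_itv/= => /andP[x0 xt].
by rewrite x0 t0 tT (le_trans xt tT).
Qed.

(** The flow is C^1 in s, so the increment is the integral of the chain rule; this
introduces the second time variable that leibniz integrates out. *)
Lemma FTC_along r t : 0 <= r -> r <= t -> t <= T ->
  H r (P t - P r) - H r 0 = \int[leb]_(s in `[r, t]) (v s * Hx r (P s - P r)).
Proof.
move=> r0 rt tT.
pose F := fun _ x : R => H r x; pose Fx := fun _ x : R => Hx r x.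
have cFx : continuous (fun p : R * R => Fx p.1 p.2).
  move=> p; apply: (cvg_comp2 (a := fun _ => r) (b := snd) cHx).
    exact: cvg_cst.
  by case: p => p1 p2; exact: cvg_snd.
have rT : 0 <= r <= T by rewrite r0 (le_trans rt tT).
have C1 : C1_on setT `[0, +oo[ F (fun _ _ => 0) Fx.
  split => //.
  - by move=> t1 t2 x _ _ _; exists t1; rewrite ?subrr ?normr0 ?mul0r.
  - move=> t0 x1 x2 _ /=; rewrite !in_itv/= !andbT => x10 x20.
    exact: mx.
  - by move=> p; exact: cvg_cst.
have cP := prim_continuous (prim_int (within_bm cv)).
have sub : `[r, t] `<=` `[0, T] by exact: sub_itvcc.
have := @FTC_in R r t (fun s => H r (P s - P r)) (fun s => v s * Hx r (P s -
  P r)) rt.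
rewrite subrr => -> //.
- apply/subspace_continuousP => s rs; apply: cvgM.
    by have /subspace_continuousP := continuous_subspaceW sub cv; exact.
  apply: (cvg_comp2 (a := fun _ => r) cHx); first exact: cvg_cst.
  apply: cvgB; last exact: cvg_cst.
  by have /subspace_continuousP := continuous_subspaceW sub cP; exact.
- move=> s rs.
  have sI : `[r, t]%classic s by rewrite /= in_itv.
  have dz : has_deriv `[r, t] (fun y => P y - P r) s (v s).
    rewrite -[v s]subr0; apply: has_derivB; last exact: has_deriv_cst.
    apply: (has_derivS sub); apply: int_has_deriv => //.
    by have := sub _ sI; rewrite /= in_itv.
  have := has_deriv_chain2 (sg := id) C1 sI _ _ (has_deriv_id _ _) dz.
  rewrite mul0r add0r mulrC; apply => // y /=.
  rewrite !in_itv/= andbT => /andP[ry yt].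
  by apply: int_incr_ge0 => //; exact: le_trans yt tT.
Qed.

(** By FTC_along, H(r, P(t) - P(r)) is H(r, 0) plus the integral over s in [r, t]
of v(s) Hx(r, P(s) - P(r)). Multiplying by h(r), integrating in r and exchanging
the order of integration leaves a primitive in t, with h only bounded and
measurable. *)
Lemma leibniz :
  primitive T (fun t => \int[leb]_(r in `[0, t]) (h r * H r (P t - P r)))
    (fun s => h s * H s 0 +
              v s * \int[leb]_(r in `[0, s]) (h r * Hx r (P s - P r))).
Proof.
have bv := within_bm cv.
have bK : bounded_mfun (`[0, T] `*` `[0, T])
    (fun p : R * R => h p.1 * (v p.2 * Hx p.1 (P p.2 - P p.1))).
  apply: bmM.
    apply: (bm_comp (h := fst) (g := h) _ _ _ bh) => [//|p []//|].
    by apply: measurable_funTS; exact: measurable_fst.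
  apply: bmM.
    apply: (bm_comp (h := snd) (g := v) _ _ _ bv) => [//|p []//|].
    by apply: measurable_funTS; exact: measurable_snd.
  apply: (bm_along (a := fst) (b := snd)) => [||//|||].
  - exact: measurableX.
  - exact: cHx.
  - by apply: measurable_funTS; exact: measurable_fst.
  - by apply: measurable_funTS; exact: measurable_snd.
  - by move=> p [] /=; rewrite !in_itv/=.
have [J bJ [JE JF]] :=
  @triangle_fubini R T (fun r s => h r * (v s * Hx r (P s - P r))) bK.
have bhH0 : bounded_mfun `[0, T] (fun r => h r * H r 0).
  apply: bmM => //; apply: (bm_pullback2 (a := id) (b := cst 0)) => //.
  by have [M HM] := bH; exists M.
have bhHx s : 0 <= s <= T -> bounded_mfun `[0, s] (fun r => h r * Hx r (P s - P r)).
  move=> sT; apply: bmM; last exact: bm_along_l.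
  by apply: bm_sub_itv bh => //; case/andP: sT.
have JE' s : 0 <= s <= T ->
    J s = v s * \int[leb]_(r in `[0, s]) (h r * Hx r (P s - P r)).
  move=> sT; rewrite JE// -int_mul; last exact: bhHx.
  by apply: int_eq => r _; ring.
suff : primitive T (fun t => \int[leb]_(r in `[0, t]) (h r * H r (P t - P r)))
    (fun s => h s * H s 0 + J s).
  by apply: eq_prim => // t tT; rewrite JE'.
split; first exact: bmD.
move=> t /andP[t0 tT]; rewrite int00 add0r.
rewrite int_add; [|exact: bm_sub_itv bhH0|exact: bm_sub_itv bJ].
rewrite JF ?t0// -int_add; first last.
- apply: (@bmS _ _ _ `[0, t] `[0, t]) => //.
  have bb : bounded_mfun `[0, t] (fun r => h r * (H r (P t - P r) - H r 0)).
    apply: bmM; first exact: bm_sub_itv bh.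
    apply: bmB; first by apply: bm_along_l; rewrite ?t0.
    apply: (bm_pullback2 (a := id) (b := cst 0)) => //.
    by have [M HM] := bH; exists M.
  apply: eq_bm bb => r /=; rewrite in_itv/= => /andP[r0 rt].
  rewrite FTC_along// -int_mul//.
  apply: bmM; first exact: bm_sub_itv bv.
  apply: (@bm_along _ _ `[r, t] Hx (cst r) id) => // x /=.
  rewrite in_itv/= => /andP[rx xt].
  by rewrite r0 (le_trans rt tT) (le_trans r0 rx) (le_trans xt tT).
- exact: bm_sub_itv bhH0.
apply: int_eq => r /andP[r0 rt].
rewrite int_mul; last first.
  apply: bmM; first exact: bm_sub_itv bv.
  apply: (@bm_along _ _ `[r, t] Hx (cst r) id) => // x /=.
  rewrite in_itv/= => /andP[rx xt].
  by rewrite r0 (le_trans rt tT) (le_trans r0 rx) (le_trans xt tT).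
by rewrite -FTC_along//; ring_int.
Qed.

End Leibniz.

(** * Essential bounds *)

Section EssentialBounds.
Context d (X : measurableType d) (R : realType).
Variable mu : {measure set X -> \bar R}.
Hypothesis mu_gt0 : (0 < mu setT)%E.
Implicit Types (D B : set X) (u : X -> R).

Lemma ae_imply (P Q : X -> Prop) : (forall x, P x -> Q x) ->
  {ae mu, forall x, P x} -> {ae mu, forall x, Q x}.
Proof. by move=> PQ; apply: filterS. Qed.

Lemma ae_imply2 (P P' Q : X -> Prop) : (forall x, P x -> P' x -> Q x) ->
  {ae mu, forall x, P x} -> {ae mu, forall x, P' x} -> {ae mu, forall x, Q x}.
Proof. by move=> PQ; apply: filterS2. Qed.

Lemma Linf_ae_le D u : Linf mu D u ->
  {ae mu, forall x, D x -> `|u x| <= Linf_norm mu D u}.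
Proof.
move=> [mu_ fin]; rewrite /Linf_norm.
have N0 := Lnorm_ge0 mu (+oo)%E (EFin \o (u \_ D)).
move: fin N0; rewrite unlock mu_gt0 => fin N0.
have := ess_sup_ge mu (abse \o (EFin \o u \_ D)).
apply: filterS => x /= h Dx.
rewrite -lee_fin fineK; last by rewrite ge0_fin_numE.
by move: h; rewrite patchE mem_set.
Qed.

Lemma Linf_norm_le D u (c : R) : 0 <= c ->
  {ae mu, forall x, D x -> `|u x| <= c} -> Linf_norm mu D u <= c.
Proof.
move=> c0 uc; rewrite /Linf_norm.
have N0 := Lnorm_ge0 mu (+oo)%E (EFin \o (u \_ D)).
have : ('N[mu]_+oo[EFin \o u \_ D] <= c%:E)%E.
  rewrite unlock mu_gt0; apply/ess_supP; move: uc; apply: filterS => x /= h.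
  rewrite patchE; case: ifPn => [|_]; last by rewrite normr0 lee_fin.
  by rewrite inE => /h; rewrite lee_fin.
move=> h; rewrite -lee_fin fineK// ge0_fin_numE//.
exact: le_lt_trans h (ltry _).
Qed.

Lemma Linf_bounded D u (c : R) : measurable_fun D u ->
  {ae mu, forall x, D x -> `|u x| <= c} -> Linf mu D u.
Proof.
move=> mu_ uc; split => //.
apply: (@le_lt_trans _ _ (Num.max 0 c)%:E); last exact: ltry.
rewrite unlock mu_gt0; apply/ess_supP; move: uc; apply: filterS => x /= h.
rewrite patchE; case: ifPn => [|_].
  by rewrite inE => /h; rewrite lee_fin le_max orbC => ->.
by rewrite normr0 lee_fin le_max lexx.
Qed.

Lemma Linf_norm_ge0 D u : 0 <= Linf_norm mu D u.
Proof. by rewrite /Linf_norm fine_ge0// Lnorm_ge0. Qed.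

Lemma ae_exists B (P : X -> Prop) : measurable B -> (0 < mu B)%E ->
  {ae mu, forall x, P x} -> exists2 x, B x & P x.
Proof.
move=> mB B0 [N [mN N0 PN]].
apply: contrapT => H.
have BN : B `<=` N.
  move=> x Bx; apply: PN => /= Px; apply: H; by exists x.
have : (mu B <= mu N)%E by apply: le_measure; rewrite ?inE.
by rewrite N0 leNgt B0.
Qed.

(** Truncating u at its essential bound changes it on a null set only and gives a
representative that obeys the bound everywhere. *)
Lemma Linf_bm D u : measurable D -> Linf mu D u ->
  exists u', [/\ bounded_mfun D u', forall x, D x -> `|u' x| <= Linf_norm mu D u &
    {ae mu, forall x, D x -> u x = u' x}].
Proof.
move=> mD Lu; have [mu_ _] := Lu.
set c := Linf_norm mu D u.
have c0 : 0 <= c by exact: Linf_norm_ge0.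
pose u' x := Num.max (- c) (Num.min c (u x)).
exists u'; split.
- split; last first.
    exists c => x _; rewrite ler_norml le_max lexx/= ge_max ge_min lexx/= andbT.
    by rewrite (le_trans _ c0)// oppr_le0.
  apply: measurable_maxr; first exact: measurable_cst.
  by apply: measurable_minr => //; exact: measurable_cst.
- move=> x _; rewrite ler_norml le_max lexx/= ge_max ge_min lexx/= andbT.
  by rewrite (le_trans _ c0)// oppr_le0.
- have := Linf_ae_le Lu; apply: filterS => x h /h.
  by rewrite -/c /u' ler_norml => /andP[h1 h2]; rewrite (min_idPr h2) (max_idPr h1).
Qed.

End EssentialBounds.

Section LebesgueR.
Context (R : realType).
Local Notation leb := (@lebesgue_measure R).

Lemma leb_gt0 : (0 < leb setT)%E.
Proof.
apply: (@lt_le_trans _ _ (leb `[0, 1])).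
  by rewrite lebesgue_measure_itv/= lte_fin ltr01 sube0 lte_fin.
by apply: le_measure; rewrite ?inE.
Qed.

Lemma leb_itv_gt0 (a b : R) : a < b -> (0 < leb `[a, b])%E.
Proof.
by move=> ab; rewrite lebesgue_measure_itv/= lte_fin ab -EFinB lte_fin subr_gt0.
Qed.

Lemma leb2_box (a b c d : R) : a < b -> c < d ->
  (0 < (leb \x leb)%E (`[a, b] `*` `[c, d]))%E.
Proof.
move=> ab cd; rewrite product_measure1E//= !lebesgue_measure_itv/= !lte_fin ab cd.
by rewrite -!EFinB -EFinM lte_fin mulr_gt0// subr_gt0.
Qed.

Lemma leb2_gt0 : (0 < (leb \x leb)%E setT)%E.
Proof.
apply: (lt_le_trans (leb2_box ltr01 ltr01)).
apply: le_measure; rewrite ?inE//; exact: measurableX.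
Qed.

Lemma sub_segment (a b x d : R) : a < b -> a <= x <= b -> 0 < d ->
  exists c e, [/\ a <= c, c < e, e <= b & forall y, c <= y <= e -> `|x - y| < d].
Proof.
move=> ab /andP[ax xb] d0.
exists (Num.max a (x - d / 2)), (Num.min b (x + d / 2)).
split.
- by rewrite le_max lexx.
- by rewrite gt_max !lt_min; apply/and3P; split => //; first (apply/andP; split);
  lra.
- by rewrite ge_min lexx.
- move=> y; rewrite ge_max le_min => /andP[/andP[_ h1] /andP[_ h2]].
  by rewrite ltr_norml; apply/andP; split; lra.
Qed.


(** If g exceeded c at a point it would do so on a nondegenerate interval, which is
not a null set. *)
Lemma ae_le_continuous (a b c : R) (g : R -> R) : a < b ->
  {within `[a, b], continuous g} ->
  {ae leb, forall x, a <= x <= b -> g x <= c} ->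
  forall x, a <= x <= b -> g x <= c.
Proof.
move=> ab cg gc x xab; rewrite leNgt; apply/negP => cgx.
have xI : `[a, b]%classic x by rewrite /= in_itv.
have /cvgrPdist_lt := (subspace_continuousP _ _).1 cg x xI.
move=> /(_ (g x - c)); rewrite subr_gt0 => /(_ cgx) cs.
have {cs} : \forall y \near x, `[a, b]%classic y -> `|g x - g y| < g x -
  c by exact: cs.
move=> /nbhs_ballP[d /= d0 dP].
have [p [q [ap pq qb xy]]] := sub_segment ab xab d0.
have [||y + gy] := @ae_exists _ _ _ leb `[p, q]
    (fun x => a <= x <= b -> g x <= c) _ _ gc.
- exact: measurable_itv.
- exact: leb_itv_gt0.
rewrite /= in_itv/= => /andP[py yq].
have yI : a <= y <= b by rewrite (le_trans ap py) (le_trans yq qb).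
have := dP y; rewrite /= in_itv/= => /(_ _ yI).
have := xy y; rewrite py yq => /(_ isT) xyd /(_ xyd).
have := gy yI; rewrite ltr_norml => gyc /andP[_]; lra.
Qed.

Lemma Linf_continuous_le (a b : R) (D : set R) (g : R -> R) :
  measurable D -> a < b ->
  `[a, b] `<=` D -> {within `[a, b], continuous g} -> Linf leb D g ->
  forall x, a <= x <= b -> `|g x| <= Linf_norm leb D g.
Proof.
move=> mD ab abD cg Lg; apply: (ae_le_continuous ab).
  move=> x; apply: continuous_comp; first exact: cg.
  exact: norm_continuous.
have := Linf_ae_le leb_gt0 Lg; apply: filterS => x h xab; apply: h.
by apply: abD; rewrite /= in_itv.
Qed.

Lemma within_Linf (a b : R) (g : R -> R) : {within `[a, b], continuous g} ->
  Linf leb `[a, b] g.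
Proof.
move=> /within_bm[mg [M gM]]; apply: (Linf_bounded leb_gt0 (c := M)) => //.
exact: nearW.
Qed.

Lemma bm_Linf (a b : R) (g : R -> R) : bounded_mfun `[a, b] g -> Linf leb `[a, b] g.
Proof.
move=> [mg [M gM]]; apply: (Linf_bounded leb_gt0 (c := M)) => //.
exact: nearW.
Qed.

(** As in one variable: the bound would be exceeded on a product of two
nondegenerate intervals, which has positive measure. *)
Lemma Linf2_continuous_le (T : R) (g : R -> R -> R) : 0 < T ->
  continuous (fun p : R * R => g p.1 p.2) ->
  Linf2 `[0, T] `[0, +oo[ g ->
  forall t x, 0 <= t <= T -> 0 <= x ->
    `|g t x| <= Linf2_norm `[0, T] `[0, +oo[ g.
Proof.
move=> T0 cg Lg t x tT x0; rewrite leNgt; apply/negP => cgx.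
have ae := Linf_ae_le leb2_gt0 Lg.
set c := Linf2_norm _ _ _ in cgx.
have /cvgrPdist_lt := cg (t, x) => /(_ (`|g t x| - c)).
rewrite subr_gt0 => /(_ cgx) cs.
have : nbhs (t, x) [set p : R * R | `|g t x - g p.1 p.2| < `|g t x| -
  c] by exact: cs.
move=> [[A B] /= [/nbhs_ballP[d1 /= d10 dA] /nbhs_ballP[d2 /= d20 dB]] AB].
have [p [q [p0 pq qT tp]]] := sub_segment T0 tT d10.
have xx : 0 <= x <= x + 1 by rewrite x0 lerDl ler01.
have x1 : 0 < x + 1 by rewrite ltr_wpDl.
have [r [s [r0 rs sx xr]]] := sub_segment x1 xx d20.
have [||[y z] [/=]] := @ae_exists _ _ _ (leb \x leb)%E (`[p, q] `*` `[r, s])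
  _ _ _ ae.
- exact: measurableX.
- exact: leb2_box.
rewrite !in_itv/= => pyq rzs gyz.
have {gyz}gyz : `|g y z| <= c.
  apply: gyz; split => /=; rewrite ?in_itv/= ?andbT.
    by case/andP: pyq => py yq; rewrite (le_trans p0 py) (le_trans yq qT).
  by case/andP: rzs => rz zs; rewrite (le_trans r0 rz).
have := AB (y, z); rewrite /= => /(_ _)/wrap[].
  by split; [apply: dA; exact: tp|apply: dB; exact: xr].
have := lerB_dist (g t x) (g y z); lra.
Qed.

End LebesgueR.

(** * Weak derivatives and the lemma of du Bois-Reymond *)

Section WeakDerivatives.
Context (R : realType).
Local Notation leb := (@lebesgue_measure R).

(** For p a retraction onto D, this turns continuity relative to D into continuity
on the whole space. *)
Lemma within_comp_continuous (U V W : topologicalType) (D : set V) (w : V -> W)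
    (p : U -> V) :
  {within D, continuous w} -> continuous p -> (forall t, D (p t)) ->
  continuous (fun t => w (p t)).
Proof.
move=> /subspace_continuousP cw cp Dp t A nA.
have H := cw _ (Dp t) A nA.
have {}H : nbhs (p t) [set y | D y -> A (w y)] by exact: H.
by apply: (@filterS _ (nbhs t) _ _ _ _ (cp t _ H)) => y /=; apply; exact: Dp.
Qed.

Definition clamp (a b t : R) : R := Num.max a (Num.min b t).

Lemma clamp_continuous a b : continuous (clamp a b).
Proof.
move=> t; apply: (@continuous_max _ _ (cst a) (Num.min b)).
  exact: cst_continuous.
by apply: (@continuous_min _ _ (cst b) id); [exact: cst_continuous|exact: cvg_id].
Qed.

Lemma clamp_itv a b t : a <= b -> a <= clamp a b t <= b.
Proof. by move=> ab; rewrite /clamp le_max lexx/= ge_max ab/= ge_min lexx. Qed.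

Lemma clamp_id a b t : a <= t <= b -> clamp a b t = t.
Proof. by move=> /andP[a_t tb]; rewrite /clamp (min_idPr tb) (max_idPr a_t). Qed.

(** Lebesgue differentiation of the vanishing primitive. *)
Lemma int0_ae (a b : R) (h : R -> R) : bounded_mfun `[a, b] h ->
  (forall t, a <= t <= b -> \int[leb]_(s in `[a, t]) h s = 0) ->
  {ae leb, forall t, a <= t <= b -> h t = 0}.
Proof.
move=> bh h0.
have ih := bm_itv_integrable bh.
pose f := h \_ `[a, b].
have lf : locally_integrable setT f by exact: integrable_locally.
have if_ y : leb.-integrable `]-oo, y] (EFin \o f).
  have : leb.-integrable setT (EFin \o f).
    by have := (@integrable_mkcond _ _ _ leb `[a, b] _ (measurable_itv _)).1 ih;
      rewrite restrict_EFin.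
  by apply: integrableS.
have F0 : (fun x => \int[leb]_(t in [set` `]-oo, x]]) f t) = cst 0.
  apply/funext => x; rewrite /f -Rintegral_mkcondr.
  have -> : [set` `]-oo, x]] `&` `[a, b] =
      [set` `[a, Num.min x b]].
    apply/seteqP; split => y /=; rewrite !in_itv/= le_min.
      by move=> [-> /andP[-> ->]].
    by move=> /and3P[-> -> ->].
  have [xa|ax] := ltP (Num.min x b) a.
    by rewrite set_itv_ge ?Rintegral_set0// bnd_simp -ltNge.
  by apply: h0; rewrite ax ge_min lexx orbT.
have := FTC1Ny if_ lf; rewrite F0; apply: filterS.
  exact: (ae_filter_ringOfSetsType leb).
move=> t [_ h1] /andP[a_t tb].
by move: h1; rewrite derive1_cst /f patchE mem_set//= in_itv/= a_t tb.
Qed.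

Lemma continuous_int0 (a b : R) (q : R -> R) : a < b ->
  {within `[a, b], continuous q} -> (forall t, a <= t <= b -> 0 <= q t) ->
  \int[leb]_(s in `[a, b]) q s = 0 -> forall t, a <= t <= b -> q t = 0.
Proof.
move=> ab cq q0 Iq; have bq := within_bm cq.
have H : {ae leb, forall t, a <= t <= b -> q t <= 0}.
  apply: (@ae_imply _ _ _ leb (fun t => a <= t <= b -> q t = 0)).
    by move=> t h /h ->.
  apply: int0_ae => // t /andP[a_t tb]; apply/eqP; rewrite eq_le.
    rewrite int_ge0 ?andbT; last first.
      by move=> x /andP[ax xt]; apply: q0; rewrite ax (le_trans xt tb).
    rewrite -Iq (@int_split R a b t) ?a_t// lerDl int_ge0//.
    by move=> x /andP[tx xb]; apply: q0; rewrite (le_trans a_t tx).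
move=> t tab; apply/eqP; rewrite eq_le q0// andbT.
exact: (ae_le_continuous ab cq H).
Qed.

Lemma Rint_oo (a b : R) (g : R -> R) : bounded_mfun `[a, b] g ->
  \int[leb]_(s in `]a, b[) g s = \int[leb]_(s in `[a, b]) g s.
Proof.
move=> bg; have ig := bm_itv_integrable bg.
rewrite Rintegral_itv_obnd_cbnd; last first.
  by apply: integrableS ig => //; apply: subset_itv; rewrite bnd_simp.
rewrite Rintegral_itv_bndo_bndc//.
by apply: integrableS ig => //; apply: subset_itv; rewrite bnd_simp.
Qed.

Lemma test_prim (T : R) (psi : R -> R) : test_function T psi ->
  primitive T psi (derive1 psi).
Proof.
move=> [dpsi cpsi _]; apply: C1_prim; first exact: continuous_subspaceT.
move=> t _; apply: is_derive_has_deriv; apply: DeriveDef => //.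
by rewrite derive1E.
Qed.

(** The product rule on [0, T]: the boundary terms vanish with the test function. *)
Lemma prim_weak_deriv (T : R) (u g : R -> R) : 0 < T -> primitive T u g ->
  weak_deriv T u g.
Proof.
move=> T0 pu psi tpsi; have pp := test_prim tpsi.
have [_ _ [a [b [a0 bT psi0]]]] := tpsi.
have := (primM pu pp).2 T; rewrite lexx (ltW T0) => /(_ isT).
rewrite (psi0 T); last by rewrite in_itv/= negb_and -!ltNge bT orbT.
rewrite (psi0 0); last by rewrite in_itv/= negb_and -!ltNge a0.
have bu := prim_bm pu; have bp := prim_bm pp.
have [bg _] := pu; have [bdp _] := pp.
rewrite !mulr0 add0r int_add; [|exact: bmM|exact: bmM].
move/esym/eqP; rewrite addrC addr_eq0 => /eqP E.
by rewrite !Rint_oo//; exact: bmM.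
Qed.

Lemma weak_deriv_ae (T : R) (u g g' : R -> R) : measurable_fun `[0, T] g ->
  measurable_fun `[0, T] g' ->
  {ae leb, forall t, 0 <= t <= T -> g t = g' t} ->
  weak_deriv T u g -> weak_deriv T u g'.
Proof.
move=> mg mg' gg' wg psi tpsi; rewrite wg//; congr (- _).
have [_ [mp _]] := (prim_bm (test_prim tpsi), prim_bm (test_prim tpsi)).
have sub : `]0, T[ `<=` `[0, T] by apply: subset_itv; rewrite bnd_simp.
congr fine; apply: ae_eq_integral => //.
- by apply: measurable_funS sub _ => //; apply/measurable_EFinP; exact:
  measurable_funM.
- by apply: measurable_funS sub _ => //; apply/measurable_EFinP; exact:
  measurable_funM.
apply: (ae_imply _ gg') => t h; rewrite /= in_itv/= => /andP[t0 tT].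
by rewrite h// (ltW t0) (ltW tT).
Qed.

(** The primitive of eta vanishes to the left of a because eta does, and to the right
of b because the integral of eta does. *)
Lemma bump_test (T a b : R) (eta : R -> R) : 0 < a -> a < b -> b < T ->
  continuous eta -> (forall t, ~~ (a < t < b) -> eta t = 0) ->
  \int[leb]_(s in `[a, b]) eta s = 0 ->
  exists psi, test_function T psi /\ derive1 psi = eta.
Proof.
move=> a0 ab bT ceta eta0 Ieta.
have beta (c d : R) : bounded_mfun `[c, d] eta by apply: within_bm; exact:
  continuous_subspaceT.
(* Starting to the left of a makes a an interior point, where FTC applies. *)
pose psi t := \int[leb]_(s in `[a - 1, t]) eta s.
have psil t : t <= a -> psi t = 0.
  move=> ta; rewrite /psi (@int_eq _ _ _ _ (cst 0)).
    by rewrite Rintegral_cst//= mul0r.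
  move=> x /andP[_ xt]; apply: eta0; apply/negP => /andP[ax _].
  by move: (lt_le_trans ax (le_trans xt ta)); rewrite ltxx.
have psir t : b <= t -> psi t = 0.
  move=> bt; have at_ : a <= t by exact: le_trans (ltW ab) bt.
  have a1 : a - 1 <= a by rewrite gerBl ler01.
  rewrite /psi (@int_split R (a - 1) t a eta) ?a1//.
  rewrite (@int_split R a t b eta) ?(ltW ab)//.
  rewrite -/(psi a) psil// Ieta !add0r.
  rewrite (@int_eq _ _ _ _ (cst 0)); first by rewrite Rintegral_cst//= mul0r.
  move=> x /andP[bx _]; apply: eta0; apply/negP => /andP[_ xb].
  by move: (le_lt_trans bx xb); rewrite ltxx.
have dpsi t : derivable psi t 1 /\ derive1 psi t = eta t.
  have [ta|a_t] := ltP t a; last first.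
    apply: (@continuous_FTC1_closed _ eta (a - 1) t (t + 1)).
    - by rewrite ltrDl.
    - exact: bm_itv_integrable.
    - by rewrite ltrBlDr ltr_pwDr.
    - exact: ceta.
  have near0 : {near t, cst 0 =1 psi}.
    have := lt_nbhsl ta; apply: filterS => x xa; by rewrite psil// ltW.
  split; first by apply: near_eq_derivable near0 _; exact: derivable_cst.
  rewrite derive1E -(@near_eq_derive _ _ _ (cst 0)) ?derive_cst// eta0//.
  by apply/negP => /andP[]; rewrite ltNge (ltW ta).
have E : derive1 psi = eta by apply/funext => t; exact: (dpsi t).2.
exists psi; split => //; split; [by move=> t; exact: (dpsi t).1|by rewrite E|].
exists a, b; split => // t; rewrite in_itv/= => /negP tab.
have [ta|a_t] := leP t a; first exact: psil.
apply: psir; rewrite leNgt; apply/negP => tb; apply: tab.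
by rewrite !ltW.
Qed.

(** The lemma of du Bois-Reymond. Let chi be the hat (t - a)(b - t) on [a, b] and c
the mean of w for the weight chi. Then chi (w - c) has integral zero, hence is
the derivative of a test function, and testing w with it shows that the
integral of chi (w - c)^2 vanishes. *)
Lemma const_of_weak0 (T : R) (w : R -> R) : 0 < T -> {within `[0, T],
  continuous w} ->
  (forall psi, test_function T psi ->
     \int[leb]_(t in `]0, T[) (w t * derive1 psi t) = 0) ->
  forall x y, 0 <= x <= T -> 0 <= y <= T -> w x = w y.
Proof.
move=> T0 cw w0.
have key a b : 0 < a -> a < b -> b < T -> exists c, forall x, a < x < b -> w x = c.
  move=> a0 ab bT.
  pose chi t : R := Num.max 0 ((t - a) * (b - t)).
  have cchi : continuous chi.
    move=> t; apply: (@continuous_max _ _ (cst 0) (fun t => (t - a) * (b - t))).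
      exact: cst_continuous.
    apply: cvgM; apply: cvgB; by [exact: cvg_id|exact: cvg_cst].
  have chi0 t : 0 <= chi t by rewrite /chi le_max lexx.
  have chiout t : ~~ (a < t < b) -> chi t = 0.
    move=> tab; rewrite /chi; apply/max_idPl.
    have [ta|a_t] := leP t a.
      rewrite mulr_le0_ge0 ?subr_le0 ?subr_ge0//.
      exact: le_trans ta (ltW ab).
    move: tab; rewrite a_t/= -leNgt => bt.
    by rewrite mulr_ge0_le0 ?subr_le0 ?subr_ge0// ltW.
  have chiin t : a < t < b -> 0 < chi t.
    move=> /andP[a_t tb]; rewrite /chi lt_max; apply/orP; right.
    by rewrite mulr_gt0// subr_gt0.
  have sub : `[a, b] `<=` `[0, T] by apply: sub_itvcc; exact: ltW.
  (* Agrees with w on [a, b], where chi lives, and is continuous everywhere. *)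
  pose w' t := w (clamp a b t).
  have cw' : continuous w'.
    apply: (within_comp_continuous (continuous_subspaceW sub cw)).
      exact: clamp_continuous.
    by move=> t; rewrite /= in_itv/=; apply: clamp_itv; exact: ltW.
  have bcont (g : R -> R) (c d : R) : continuous g -> bounded_mfun `[c, d] g.
    by move=> cg; apply: within_bm; exact: continuous_subspaceT.
  have cchiw : continuous (fun t => chi t * w' t).
    by move=> t; apply: cvgM; [exact: cchi|exact: cw'].
  pose I1 := \int[leb]_(t in `[a, b]) chi t.
  have I1_neq0 : I1 != 0.
    apply/eqP => I10.
    have := @continuous_int0 a b chi ab (continuous_subspaceT cchi)
      (fun t _ => chi0 t) I10 ((a + b) / 2).
    have h : a < (a + b) / 2 < b by apply/andP; split; lra.
    have := chiin _ h; case/andP: h => h1 h2.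
    by rewrite !ltW// => /[swap] /(_ isT) ->; rewrite ltxx.
  pose c := (\int[leb]_(t in `[a, b]) (chi t * w' t)) / I1.
  exists c.
  pose eta t := chi t * w' t - c * chi t.
  have ceta : continuous eta.
    move=> t; apply: cvgB; first exact: cchiw.
    by apply: cvgM; [exact: cvg_cst|exact: cchi].
  have Ieta : \int[leb]_(t in `[a, b]) eta t = 0.
    rewrite int_sub; [|exact: bcont|].
      by rewrite int_mul; [rewrite -/I1 /c divfK// subrr|exact: bcont].
    by apply: bmM; [exact: bm_cst|exact: bcont].
  have [psi [tpsi dpsi]] : exists psi, test_function T psi /\ derive1 psi = eta.
    apply: (bump_test a0 ab bT ceta _ Ieta) => t /chiout E.
    by rewrite /eta E !mul0r mulr0 subrr.
  have := w0 _ tpsi; rewrite dpsi.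
  have bwe : bounded_mfun `[0, T] (fun t => w t * eta t).
    by apply: bmM; [exact: within_bm|exact: bcont].
  rewrite Rint_oo// (@int_split R 0 T a); [|by rewrite !ltW ?(lt_trans ab)|by []].
  rewrite (@int_split R a T b) ?(ltW ab) ?(ltW bT)//; last first.
    by apply: bm_sub_itv bwe => //; exact: ltW.
  rewrite (@int_eq R 0 a _ (cst 0)); last first.
    move=> x /andP[_ xa]; rewrite /eta chiout ?mul0r ?mulr0 ?subrr ?mulr0//.
    by rewrite negb_and -leNgt xa.
  rewrite (@int_eq R b T _ (cst 0)); last first.
    move=> x /andP[bx _]; rewrite /eta chiout ?mul0r ?mulr0 ?subrr ?mulr0//.
    by rewrite negb_and -!leNgt bx orbT.
  rewrite !Rintegral_cst//= !mul0r add0r addr0 => E.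
  have cq : continuous (fun t => chi t * (w' t - c) ^+ 2).
    move=> t; apply: cvgM; first exact: cchi.
    have h : w' y - c @[y --> t] --> w' t - c.
      by apply: cvgB; [exact: cw'|exact: cvg_cst].
    by rewrite expr2; under eq_fun do rewrite expr2; apply: cvgM.
  have Iq : \int[leb]_(t in `[a, b]) (chi t * (w' t - c) ^+ 2) = 0.
    rewrite (@int_eq R a b _ (fun t => w t * eta t - c * eta t)).
      rewrite int_sub ?E; [|exact: bm_sub_itv (ltW a0) (ltW bT) bwe|].
        by rewrite int_mul ?Ieta ?mulr0 ?subrr//; exact: bcont.
      by apply: bmM; [exact: bm_cst|exact: bcont].
    by move=> t tab; rewrite /eta /w' clamp_id//; ring.
  move=> x xab.
  have := @continuous_int0 a b _ ab (continuous_subspaceT cq) _ Iq x.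
  case/andP: (xab) => h1 h2; rewrite !ltW// => /(_ _ isT)/eqP.
  rewrite mulf_eq0 gt_eqF ?chiin//= sqrf_eq0 subr_eq0 /w' clamp_id ?(ltW h1)
    ?(ltW h2)//.
  move=> H; apply/eqP; apply: H => t _; apply: mulr_ge0 => //; exact: sqr_ge0.
have inner x y : 0 < x < T -> 0 < y < T -> w x = w y.
  move=> /andP[x0 xT] /andP[y0 yT].
  have [|||c cP] := key (Num.min x y / 2) ((Num.max x y + T) / 2).
  - by rewrite divr_gt0// lt_min x0 y0.
  - have : Num.min x y <= Num.max x y by rewrite ge_min le_max lexx.
    have : 0 < Num.min x y by rewrite lt_min x0 y0. 
    lra.
  - have : Num.max x y < T by rewrite gt_max xT yT.
    lra.
  have m0 : 0 < Num.min x y by rewrite lt_min x0 y0.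
  have MT : Num.max x y < T by rewrite gt_max xT yT.
  have mx : Num.min x y <= x by rewrite ge_min lexx.
  have my : Num.min x y <= y by rewrite ge_min lexx orbT.
  have xM : x <= Num.max x y by rewrite le_max lexx.
  have yM : y <= Num.max x y by rewrite le_max lexx orbT.
  by rewrite !cP//; apply/andP; split; lra.
(* The end points of [0, T] are reached by continuity. *)
have outer x : 0 <= x <= T -> w x = w (T / 2).
  move=> xT; apply/eqP; rewrite -subr_eq0 -normr_le0; apply/ler_addgt0Pr => e e0.
  rewrite add0r.
  have xI : `[0, T]%classic x by rewrite /= in_itv.
  have /cvgrPdist_le/(_ e e0) cs := (subspace_continuousP _ _).1 cw x xI.
  have {cs} : \forall y \near x, `[0, T]%classic y -> `|w x - w y| <= e by exact:
    cs.
  move=> /nbhs_ballP[d /= d0 dP].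
  have [p [q [p0 pq qT xy]]] := sub_segment T0 xT d0.
  rewrite -(inner ((p + q) / 2) (T / 2)); [|by apply/andP; split; lra..].
  apply: dP; first by apply: xy; apply/andP; split; lra.
  by rewrite /= in_itv/=; apply/andP; split; lra.
by move=> x y xT yT; rewrite outer// [RHS]outer.
Qed.

(** The difference between u and the integral of g has weak derivative zero. *)
Lemma weak_prim (T : R) (u g : R -> R) : 0 < T -> {within `[0, T], continuous u} ->
  bounded_mfun `[0, T] g -> weak_deriv T u g -> primitive T u g.
Proof.
move=> T0 cu bg wg; split => // t tT.
pose G t := \int[leb]_(s in `[0, t]) g s.
have pG : primitive T G g by exact: prim_int.
have cG := prim_continuous pG.
have H : u t - G t = u 0 - G 0.
  apply: (@const_of_weak0 T (fun t => u t - G t)) => //; last 1 first.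
  - by rewrite lexx ltW.
  - apply/subspace_continuousP => x xT; apply: cvgB.
      by have /subspace_continuousP := cu; exact.
    by have /subspace_continuousP := cG; exact.
  move=> psi tpsi.
  have [bdp _] := test_prim tpsi.
  have bu := within_bm cu; have bG := within_bm cG.
  have := wg _ tpsi; rewrite -(prim_weak_deriv T0 pG tpsi).
  have b1 := bmM bu bdp; have b2 := bmM bG bdp.
  rewrite !Rint_oo//; last first.
    by have := bmB b1 b2; apply: eq_bm => x _; rewrite mulrBl.
  move=> E; rewrite (@int_eq R 0 T _ (fun t => u t * derive1 psi t -
    G t * derive1 psi t)).
    by rewrite int_sub// E subrr.
  by move=> x _; rewrite mulrBl.
by move: H; rewrite /G int00 subr0 => <-; rewrite subrK.
Qed.

End WeakDerivatives.

(** * Gronwall and geometric convergence *)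

Section Gronwall.
Context (R : realType).
Local Notation leb := (@lebesgue_measure R).

Lemma prim_expR (T b : R) :
  primitive T (fun t => expR (b * t)) (fun t => b * expR (b * t)).
Proof.
have d (t : R) : is_derive t 1 (fun t => expR (b * t)) (b * expR (b * t)).
  have h : is_derive t (1 : R) (b \*: (id : R -> R)) (b *: (1 : R)).
    exact: is_deriveZ.
  have h' : b *: (1 : R) = b by rewrite /GRing.scale /= mulr1.
  rewrite h' in h; rewrite mulrC.
  exact: (@is_derive1_comp R expR (b \*: (id : R -> R)) t (expR (b * t)) b).
apply: C1_prim; last by move=> t _; exact: is_derive_has_deriv.
apply: continuous_subspaceT => t; apply: cvgM; first exact: cvg_cst.
apply: (@cvg_comp _ _ _ (fun t => b * t) expR).
  by apply: cvgM; [exact: cvg_cst|exact: cvg_id].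
exact: continuous_expR.
Qed.

Lemma expRM_le (T b t : R) : 0 <= b -> 0 <= t <= T ->
  expR (b * t) <= expR (b * T).
Proof. by move=> b0 /andP[_ tT]; rewrite ler_expR ler_wpM2l. Qed.

(** In the weight exp(2bt) the operator w |-> b int_0^t w halves the norm; Gronwall's
inequality and the convergence of the Picard iteration both rest on this. *)
Lemma int_exp_le (T b C t : R) : 0 <= C -> 0 <= t <= T ->
  b * \int[leb]_(s in `[0, t]) (C * expR (2 * b * s)) <=
  C / 2 * (expR (2 * b * t) - 1).
Proof.
move=> C0 tT; have [be pe] := prim_expR T (2 * b).
have bexp : bounded_mfun `[0, t] (fun s => expR (2 * b * s)).
  by have /prim_bm := prim_expR t (2 * b).
rewrite (pe t)// mulr0 expR0 addrAC subrr add0r.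
rewrite !int_mul//; set I := \int[leb]_(x in _) _.
by rewrite le_eqVlt; apply/orP; left; apply/eqP; field.
Qed.

(** Let S be the set of constants C with w(t) <= C exp(2bt). One application of the
hypothesis turns C into a + C/2, so the infimum of S is at most 2a. *)
Lemma gronwall (T a b : R) (w : R -> R) : 0 <= a -> 0 <= b ->
  bounded_mfun `[0, T] w ->
  (forall t, 0 <= t <= T -> w t <= a + b * \int[leb]_(s in `[0, t]) w s) ->
  forall t, 0 <= t <= T -> w t <= 2 * a * expR (2 * b * t).
Proof.
move=> a0 b0 bw wI.
pose S := [set C : R | 0 <= C /\ forall t, 0 <= t <= T ->
  w t <= C * expR (2 * b * t)].
have step C : S C -> S (a + C / 2).
  move=> [C0 wC]; split; first by rewrite addr_ge0// divr_ge0.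
  move=> t tT; have /andP[t0 tT'] := tT.
  have e1 : 1 <= expR (2 * b * t) by rewrite -[leLHS]expR0 ler_expR !mulr_ge0.
  have bexp : bounded_mfun `[0, t] (fun s => C * expR (2 * b * s)).
    apply: bmM; first exact: bm_cst.
    by have /prim_bm := prim_expR t (2 * b).
  have h1 : b * \int[leb]_(s in `[0, t]) w s <=
      b * \int[leb]_(s in `[0, t]) (C * expR (2 * b * s)).
    apply: ler_wpM2l => //; apply: int_le => //; first exact: bm_sub_itv bw.
    by move=> x /andP[x0 xt]; apply: wC; rewrite x0 (le_trans xt).
  have h2 := int_exp_le b C0 tT.
  apply: le_trans (wI _ tT) _.
  have h3 : a <= a * expR (2 * b * t) by rewrite ler_peMr.
  have h4 : C / 2 * (expR (2 * b * t) - 1) <= C / 2 * expR (2 * b * t).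
    by rewrite ler_wpM2l ?divr_ge0// gerBl.
  rewrite mulrDl; apply: lerD => //.
  exact: le_trans h1 (le_trans h2 h4).
have S0 : S !=set0.
  have [_ [M wM]] := bw; exists (Num.max 0 M); split; first by rewrite le_max lexx.
  move=> t tT; have e1 : 1 <= expR (2 * b * t).
    by rewrite -[leLHS]expR0 ler_expR !mulr_ge0//; case/andP: tT.
  apply: (@le_trans _ _ (Num.max 0 M)); last by rewrite ler_peMr// le_max lexx.
  rewrite le_max; apply/orP; right; apply: le_trans (ler_norm _) (wM _ _).
  by rewrite /= in_itv.
have lbS : has_lbound S by exists 0 => C [].
have Sinf : inf S <= 2 * a.
  suff : inf S <= a + inf S / 2 by lra.
  rewrite -lerBlDl ler_pdivlMr// .
  apply: lb_le_inf => // C SC.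
  have : inf S <= a + C / 2 by apply: ge_inf => //; exact: step.
  lra.
move=> t tT; apply: (@le_trans _ _ (inf S * expR (2 * b * t))).
  rewrite -ler_pdivrMr ?expR_gt0//; apply: lb_le_inf => // C [C0 wC].
  by rewrite ler_pdivrMr ?expR_gt0//; exact: wC.
by rewrite ler_wpM2r// expR_ge0.
Qed.

(** The intervals of radius K / 2^n around u n are nested; the infimum of their right
ends lies in all of them. This gives a limit and its rate at once. *)
Lemma geometric_limit (u : nat -> R) (K : R) : 
  (forall n, `|u n.+1 - u n| <= K / 2 ^+ n.+1) ->
  exists l, forall n, `|u n - l| <= K / 2 ^+ n.
Proof.
move=> uK.
pose a n := u n + K / 2 ^+ n; pose b n := u n - K / 2 ^+ n.
(* The slack that absorbs one step: the intervals [b n, a n] are nested. *)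
have half n : K / 2 ^+ n = K / 2 ^+ n.+1 + K / 2 ^+ n.+1.
  by rewrite exprS; field; rewrite expf_neq0// pnatr_eq0.
have K0 n : 0 <= K / 2 ^+ n.
  have h : 0 <= K / 2 ^+ n.+1 by exact: le_trans (uK n).
  by rewrite half addr_ge0.
have ad n p : a (p + n)%N <= a n.
  elim: p => // p IH; apply: le_trans IH; rewrite addSn /a (half (p + n)%N).
  have := uK (p + n)%N; rewrite ler_norml => /andP[_]; lra.
have bi n p : b n <= b (p + n)%N.
  elim: p => // p IH; apply: le_trans IH _; rewrite addSn /b (half (p + n)%N).
  have := uK (p + n)%N; rewrite ler_norml => /andP[]; lra.
have ba n p : b n <= a p.
  apply: le_trans (bi n p) _; rewrite addnC.
  apply: (@le_trans _ _ (a (n + p)%N)) => //.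
  by have := K0 (n + p)%N; rewrite /a /b; lra.
exists (inf (range a)) => n.
have h1 : inf (range a) <= a n.
  by apply: ge_inf; [exists (b n) => _ [p _ <-]|exists n].
have h2 : b n <= inf (range a).
  by apply: lb_le_inf; [exists (a n), n|move=> _ [p _ <-]].
by rewrite ler_norml; move: h1 h2; rewrite /a /b => h1 h2; apply/andP; split; lra.
Qed.

End Gronwall.

(** * The Volterra equation *)

Section NormBounds.
Context (R : realType).

Lemma norm_mul_le (a b A B : R) : `|a| <= A -> `|b| <= B -> `|a * b| <= A * B.
Proof. by move=> aA bB; rewrite normrM; exact: ler_pM. Qed.

(** The telescoping asks for no bound on b' itself, only on b - b'. In the application
b' belongs to the second observation, and the resulting constants depend on the
first one alone. *)
Lemma norm_mul3_diff (a a' b b' c c' A B C ea eb ec : R) :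
  `|a| <= A -> `|a'| <= A -> `|b| <= B -> `|c'| <= C ->
  `|a - a'| <= ea -> `|b - b'| <= eb -> `|c - c'| <= ec ->
  `|a * b * c - a' * b' * c'| <= A * B * ec + ea * B * C + A * eb * C.
Proof.
move=> aA a'A bB c'C aa bb cc.
have -> : a * b * c - a' * b' * c' =
  a * b * (c - c') + (a - a') * b * c' + a' * (b - b') * c' by ring.
apply: le_trans (ler_normD _ _) _; apply: lerD.
  apply: le_trans (ler_normD _ _) _; apply: lerD.
    by apply: norm_mul_le => //; exact: norm_mul_le.
  by apply: norm_mul_le => //; exact: norm_mul_le.
by apply: norm_mul_le => //; exact: norm_mul_le.
Qed.

Lemma norm_mul2_diff (b b' c c' B C eb ec : R) :
  `|b| <= B -> `|c'| <= C -> `|b - b'| <= eb -> `|c - c'| <= ec ->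
  `|b * c - b' * c'| <= B * ec + eb * C.
Proof.
move=> bB c'C bb cc.
have -> : b * c - b' * c' = b * (c - c') + (b - b') * c' by ring.
apply: le_trans (ler_normD _ _) _; apply: lerD; exact: norm_mul_le.
Qed.

End NormBounds.

Section Flow.
Context (R : realType).
Local Notation leb := (@lebesgue_measure R).

Record velocity (vel : R -> R) (Lv Vm : R) : Prop := Velocity {
  velocity_lip_ge0 : 0 <= Lv;
  velocity_lip : forall x y, `|vel x - vel y| <= Lv * `|x - y|;
  velocity_bnd : forall x, 0 <= vel x <= Vm }.

Variables (T : R) (vel : R -> R) (Lv Vm : R).
Hypothesis velP : velocity vel Lv Vm.
Let Lv0 := velocity_lip_ge0 velP.
Let vel_lip := velocity_lip velP.
Let vel_bnd := velocity_bnd velP.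

Definition flow (dl : R -> R) (t : R) : R := \int[leb]_(r in `[0, t]) vel (dl r).

Lemma vel_norm x : `|vel x| <= Vm.
Proof. by have /andP[v0 vV] := vel_bnd x; rewrite ger0_norm. Qed.

Lemma vel_within dl : {within `[0, T], continuous dl} ->
  {within `[0, T], continuous (fun t => vel (dl t))}.
Proof.
move=> cd x; apply: continuous_comp; first exact: cd.
have /subspace_continuousP/(_ (dl x) I) : {within setT, continuous vel}.
  by apply: (@lip_within _ _ Lv) => a b _ _; exact: vel_lip.
by rewrite withinET.
Qed.

Lemma flow_prim dl : {within `[0, T], continuous dl} ->
  primitive T (flow dl) (fun t => vel (dl t)).
Proof. by move=> cd; apply: prim_int; apply: within_bm; exact: vel_within. Qed.

Lemma flow_ge0 dl r t : {within `[0, T], continuous dl} ->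
  0 <= r -> r <= t -> t <= T -> 0 <= flow dl t - flow dl r.
Proof.
move=> cd; apply: int_incr_ge0; first exact: vel_within.
by move=> x _; have /andP[] := vel_bnd (dl x).
Qed.

Lemma flow0 dl : flow dl 0 = 0. Proof. exact: int00. Qed.

Lemma flow_nneg dl t : {within `[0, T], continuous dl} -> 0 <= t <= T ->
  0 <= flow dl t.
Proof.
move=> cd /andP[t0 tT].
by have := flow_ge0 cd (lexx 0) t0 tT; rewrite flow0 subr0.
Qed.

Lemma flow_sub_ge0 dl r t : {within `[0, T], continuous dl} -> 0 <= t <= T ->
  0 <= r <= t -> 0 <= flow dl t - flow dl r.
Proof. by move=> cd /andP[t0 tT] /andP[r0 rt]; exact: (flow_ge0 cd r0 rt tT). Qed.

(** Differences of velocities are at most Lv |d1 - d2|; this is where the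
Lipschitz continuity of V turns into an integral term for Gronwall. *)
Lemma flow_diff d1 d2 r t : {within `[0, T], continuous d1} ->
  {within `[0, T], continuous d2} -> 0 <= r -> r <= t -> t <= T ->
  `|(flow d1 t - flow d1 r) - (flow d2 t - flow d2 r)| <=
  Lv * \int[leb]_(s in `[0, t]) `|d1 s - d2 s|.
Proof.
move=> c1 c2 r0 rt tT.
have bv d : {within `[0, T], continuous d} -> bounded_mfun `[r,
  t] (fun s => vel (d s)).
  by move=> cd; apply: bm_sub_itv (within_bm (vel_within cd)).
rewrite (prim_incr (flow_prim c1))// (prim_incr (flow_prim c2))//.
rewrite -int_sub; [|exact: bv|exact: bv].
have bd : bounded_mfun `[0, t] (fun s => `|d1 s - d2 s|).
  apply: bm_norm; apply: (@bm_sub_itv _ 0 T) => //.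
  by apply: bmB; exact: within_bm.
have bdr : bounded_mfun `[r, t] (fun s => `|d1 s - d2 s|) by exact: bm_sub_itv bd.
apply: (@le_trans _ _ (\int[leb]_(s in `[r, t]) (Lv * `|d1 s - d2 s|))).
  apply: int_norm_le; [by apply: bmB; exact: bv| |by move=> x _; exact: vel_lip].
  by apply: bmM => //; exact: bm_cst.
rewrite int_mul// ler_wpM2l// (@int_split _ 0 t r) ?r0// lerDr.
by apply: int_ge0.
Qed.

End Flow.

Section Data.
Context (R : realType).

Record initial_data (B Bx : R -> R) (N : R) : Prop := InitialData {
  initial_bnd : forall x, `|B x| <= N;
  initial_deriv_bnd : forall x, `|Bx x| <= N;
  initial_mean : mean_value B Bx;
  initial_deriv_cont : continuous Bx }.

(** What the estimates use of phi, for an extension F of phi to the plane: continuity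
and bounds everywhere, derivatives in mean value form on the strip. The constant
M bounds everything that enters the stability constants. The mixed derivative Ftx
serves the regularity of solutions only, so some bound suffices for it, and the
Lipschitz constant of Ft is recorded separately. *)
Record kernel_data (T : R) (F Ft Fx Ftx Fxx : R -> R -> R) (M qi : R) : Prop :=
 KernelData {
  kernel_cont : continuous (fun p : R * R => F p.1 p.2);
  kernel_t_cont : continuous (fun p : R * R => Ft p.1 p.2);
  kernel_x_cont : continuous (fun p : R * R => Fx p.1 p.2);
  kernel_tx_cont : continuous (fun p : R * R => Ftx p.1 p.2);
  kernel_xx_cont : continuous (fun p : R * R => Fxx p.1 p.2);
  kernel_bnd : forall t x, `|F t x| <= M;
  kernel_t_bnd : forall t x, `|Ft t x| <= M;
  kernel_x_bnd : forall t x, `|Fx t x| <= M;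
  kernel_tx_bnd : exists K : R, forall t x, `|Ftx t x| <= K;
  kernel_xx_bnd : forall t x, `|Fxx t x| <= M;
  kernel_t_lip : forall t, 0 <= t <= T -> lipschitz_ge0 M (Ft t);
  kernel_gt0 : forall t, 0 <= t <= T -> 0 < F t 0;
  kernel_inv : forall t, 0 <= t <= T -> (F t 0)^-1 <= qi;
  kernel_mean : forall t, 0 <= t <= T -> mean_value (F t) (Fx t);
  kernel_x_mean : forall t, 0 <= t <= T -> mean_value (Fx t) (Fxx t);
  kernel_t_mean : forall t, 0 <= t <= T -> mean_value (Ft t) (Ftx t);
  kernel_mean_t : forall t1 t2 x, 0 <= t1 <= T -> 0 <= t2 <= T -> 0 <= x ->
    exists2 xi, `|xi - t1| <= `|t2 - t1| &
      F t2 x - F t1 x = Ft xi x * (t2 - t1);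
  kernel_deriv0 : forall t, 0 <= t <= T ->
    has_deriv `[0, T] (F^~ 0) t (Ft t 0) }.

End Data.

Section Volterra.
Context (R : realType).
Local Notation leb := (@lebesgue_measure R).
Variables (T : R) (vel : R -> R) (Lv Vm : R) (B Bx : R -> R) (N m : R).
Variables (F Ft Fx Ftx Fxx : R -> R -> R) (M qi : R).
Hypothesis T0 : 0 < T.
Hypothesis velP : velocity vel Lv Vm.
Hypothesis iniP : initial_data B Bx N.
Hypothesis kerP : kernel_data T F Ft Fx Ftx Fxx M qi.

Let Lv0 := velocity_lip_ge0 velP.
Let vel_bnd := velocity_bnd velP.
Let B_bnd := initial_bnd iniP.
Let B_lip := mean_value_lip (initial_mean iniP) (initial_deriv_bnd iniP).
Let cF := kernel_cont kerP.
Let cFt := kernel_t_cont kerP.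
Let cFx := kernel_x_cont kerP.
Let bF := kernel_bnd kerP.
Let bFt := kernel_t_bnd kerP.
Let bFx := kernel_x_bnd kerP.
Let F_lip t (tT : 0 <= t <= T) : lipschitz_ge0 M (F t) :=
  mean_value_lip (kernel_mean kerP tT) (bFx t).
Let Ft_lip := kernel_t_lip kerP.
Let Fx_lip t (tT : 0 <= t <= T) : lipschitz_ge0 M (Fx t) :=
  mean_value_lip (kernel_x_mean kerP tT) (kernel_xx_bnd kerP t).
Let q_gt0 := kernel_gt0 kerP.
Let q_qi := kernel_inv kerP.

Local Notation flow := (flow vel).
Local Notation cont u := {within `[0, T], continuous u}.

Definition volterra_ker (k dl : R -> R) (t r : R) : R :=
  vel (dl r) * k r * F r (flow dl t - flow dl r) +
  vel (dl r) * dl r * Fx r (flow dl t - flow dl r) -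
  dl r * Ft r (flow dl t - flow dl r).

(** The right side of the equation, with its two integrals merged and with the
travelled distances written as differences of the flow. *)
Definition volterra_op (k dl : R -> R) (t : R) : R :=
  (F t 0)^-1 * (k t - B (flow dl t) + m * F 0 (flow dl t) -
    \int[leb]_(r in `[0, t]) volterra_ker k dl t r).

Let M0 : 0 <= M. Proof. exact: le_trans (bF 0 0). Qed.
Let Vm0 : 0 <= Vm. Proof. by have /andP[] := vel_bnd 0; exact: le_trans. Qed.
Let N0 : 0 <= N. Proof. exact: le_trans (B_bnd 0). Qed.
Let qi0 : 0 <= qi.
Proof.
have h : 0 <= (0 : R) <= T by rewrite lexx ltW.
by apply: le_trans (q_qi h); rewrite invr_ge0 ltW// q_gt0.
Qed.

Let bm_cont (u : R -> R) (t : R) : cont u -> 0 <= t <= T -> bounded_mfun `[0, t] u.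
Proof. by move=> cu /andP[t0 tT]; apply: bm_sub_itv (within_bm cu). Qed.

Lemma bm_volterra_ker (k dl : R -> R) (t : R) : cont k -> cont dl -> 0 <= t <= T ->
  bounded_mfun `[0, t] (volterra_ker k dl t).
Proof.
move=> ck cd tT.
have cv := vel_within velP cd.
have bG (G : R -> R -> R) : continuous (fun p : R * R => G p.1 p.2) ->
    (forall t x, `|G t x| <= M) -> bounded_mfun `[0,
      t] (fun r => G r (flow dl t - flow dl r)).
  by move=> cG GM; apply: (bm_along_l cv cG _ tT); exists M.
have bv := bm_cont cv tT; have bk := bm_cont ck tT; have bd := bm_cont cd tT.
have b1 := bG _ cF bF; have b2 := bG _ cFt bFt; have b3 := bG _ cFx bFx.
apply: bmB; last exact: bmM.
by apply: bmD; apply: bmM => //; exact: bmM.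
Qed.

(** Constant and slope of the growth bound of the operator; ka bounds |k|. *)
Definition volt_a (ka : R) := qi * (ka + N + `|m| * M + Vm * ka * M * T).
Definition volt_b := qi * (Vm * M + M).

(** Only the factors delta(r) of the integrand are unbounded a priori, and they occur
linearly; this is what makes an a priori bound on solutions possible. *)
Lemma volterra_op_bound (k dl : R -> R) (ka : R) : cont k -> cont dl ->
  (forall t, 0 <= t <= T -> `|k t| <= ka) ->
  forall t, 0 <= t <= T ->
    `|volterra_op k dl t| <=
    volt_a ka + volt_b * \int[leb]_(s in `[0, t]) `|dl s|.
Proof.
move=> ck cd kka t tT; have /andP[t0 tT'] := tT.
have bd := bm_norm (bm_cont cd tT).
have ka0 : 0 <= ka by apply: le_trans (kka _ tT).
have I0 : 0 <= \int[leb]_(s in `[0, t]) `|dl s| by exact: int_ge0.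
have kb r : 0 <= r <= t ->
   `|volterra_ker k dl t r| <= Vm * ka * M + (Vm * M + M) * `|dl r|.
  move=> rt; have rT := in0T tT rt; rewrite /volterra_ker.
  apply: le_trans (ler_normB _ _) _.
  have h1 : `|vel (dl r) * k r * F r (flow dl t - flow dl r)| <= Vm * ka * M.
    by do 2 apply: norm_mul_le => //; [exact: (vel_norm velP)|exact: kka].
  have h2 : `|vel (dl r) * dl r * Fx r (flow dl t - flow dl r)| <= Vm * `|dl r| * M.
    by do 2 apply: norm_mul_le => //; exact: (vel_norm velP).
  have h3 : `|dl r * Ft r (flow dl t - flow dl r)| <= `|dl r| * M.
    exact: norm_mul_le.
  have -> : Vm * ka * M + (Vm * M + M) * `|dl r| =
    (Vm * ka * M + Vm * `|dl r| * M) + `|dl r| * M by ring.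
  apply: lerD => //; apply: le_trans (ler_normD _ _) _; exact: lerD.
have Ib : `|\int[leb]_(r in `[0, t]) volterra_ker k dl t r| <=
    Vm * ka * M * T + (Vm * M + M) * \int[leb]_(s in `[0, t]) `|dl s|.
  apply: (@le_trans _ _
    (\int[leb]_(r in `[0, t]) (Vm * ka * M + (Vm * M + M) * `|dl r|))).
    apply: int_norm_le => //; first exact: bm_volterra_ker.
    by apply: bmD; [exact: bm_cst|apply: bmM => //; exact: bm_cst].
  rewrite int_add; [|exact: bm_cst|by apply: bmM => //; exact: bm_cst].
  rewrite int_cst// int_mul// subr0 lerD2r ler_wpM2l//.
  by rewrite !mulr_ge0.
rewrite /volterra_op /volt_a /volt_b -!mulrA -mulrDr.
apply: norm_mul_le.
  by rewrite ger0_norm ?q_qi// invr_ge0 ltW// q_gt0.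
apply: le_trans (ler_normB _ _) _.
have h1 : `|k t - B (flow dl t) + m * F 0 (flow dl t)| <= ka + N + `|m| * M.
  apply: le_trans (ler_normD _ _) _; apply: lerD; last exact: norm_mul_le.
  apply: le_trans (ler_normB _ _) _; apply: lerD; first exact: kka.
  exact: B_bnd.
by have := lerD h1 Ib; rewrite !mulrA addrA.
Qed.

(** Coefficients of the difference bound below. In volt_w, ka and D bound the
observation and the solution that are kept in the expanded products. *)
Definition volt_e := qi * (1 + Vm * M * T).
Definition volt_w (ka D : R) := qi * (N * Lv + `|m| * (M * Lv) +
  (Lv * ka * M + Lv * D * M + Vm * M + M) +
  (Vm * ka + Vm * D + D) * (M * Lv) * T).

Lemma volt_w_ge0 ka D : 0 <= ka -> 0 <= D -> 0 <= volt_w ka D.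
Proof. by move=> ka0 D0; rewrite /volt_w !(mulr_ge0, addr_ge0)// ltW. Qed.

(** The integrand is compared term by term. Replacing delta by d2 in the arguments of
F costs M Lv int |d1 - d2| for each r, hence a factor T after integration, while
replacing it in the other factors costs |d1(r) - d2(r)|. *)
Lemma volterra_op_diff (k k' d1 d2 : R -> R) (ka D e : R) : cont k -> cont k' ->
  cont d1 ->
  cont d2 ->
  (forall t, 0 <= t <= T -> `|k t| <= ka) ->
  (forall t, 0 <= t <= T -> `|d1 t| <= D) ->
  (forall t, 0 <= t <= T -> `|k t - k' t| <= e) ->
  forall t, 0 <= t <= T ->
    `|volterra_op k d1 t - volterra_op k' d2 t| <=
    volt_e * e + volt_w ka D * \int[leb]_(s in `[0, t]) `|d1 s - d2 s|.
Proof.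
move=> ck ck' c1 c2 kka dD kke t tT; have /andP[t0 tT'] := tT.
pose d s := `|d1 s - d2 s|.
have bd : bounded_mfun `[0, t] d.
  by apply: bm_norm; apply: bmB; exact: bm_cont.
have ka0 : 0 <= ka by apply: le_trans (kka _ tT).
have D0 : 0 <= D by apply: le_trans (dD _ tT).
have e0 : 0 <= e by apply: le_trans (kke _ tT).
set W := \int[leb]_(s in `[0, t]) `|d1 s - d2 s|.
have W0 : 0 <= W by exact: int_ge0.
have zz r : 0 <= r <= t ->
    `|(flow d1 t - flow d1 r) - (flow d2 t - flow d2 r)| <= Lv * W.
  by move=> /andP[r0 rt]; exact: (flow_diff velP c1 c2 r0 rt tT').
have PP : `|flow d1 t - flow d2 t| <= Lv * W.
  by have := zz 0; rewrite !flow0 !subr0; apply; rewrite lexx.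
have GG (G : R -> R -> R) :
    (forall t, 0 <= t <= T -> lipschitz_ge0 M (G t)) -> forall r, 0 <= r <= t ->
   `|G r (flow d1 t - flow d1 r) - G r (flow d2 t - flow d2 r)| <= M * (Lv * W).
  move=> GL r rt; apply: le_trans (GL _ (in0T tT rt) _ _ _ _) _; try exact:
    (flow_sub_ge0 velP).
  by rewrite ler_wpM2l// zz.
pose c1' := Lv * ka * M + Lv * D * M + Vm * M + M.
pose c2' := (Vm * ka + Vm * D + D) * (M * Lv).
have kb r : 0 <= r <= t ->
   `|volterra_ker k d1 t r - volterra_ker k' d2 t r| <=
   Vm * e * M + c2' * W + c1' * d r.
  move=> rt; have rT := in0T tT rt; rewrite /volterra_ker.
  set z1 := flow d1 t - _; set z2 := flow d2 t - _.
  have h1 : `|vel (d1 r) * k r * F r z1 - vel (d2 r) * k' r * F r z2| <=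
      Vm * ka * (M * (Lv * W)) + Lv * d r * ka * M + Vm * e * M.
    apply: norm_mul3_diff; try exact: (vel_norm velP).
    - exact: kka.
    - exact: bF.
    - exact: velocity_lip velP _ _.
    - exact: kke.
    - exact: GG F_lip _ rt.
  have h2 : `|vel (d1 r) * d1 r * Fx r z1 - vel (d2 r) * d2 r * Fx r z2| <=
      Vm * D * (M * (Lv * W)) + Lv * d r * D * M + Vm * d r * M.
    apply: norm_mul3_diff; try exact: (vel_norm velP).
    - exact: dD.
    - exact: bFx.
    - exact: velocity_lip velP _ _.
    - by [].
    - exact: GG Fx_lip _ rt.
  have h3 : `|d1 r * Ft r z1 - d2 r * Ft r z2| <= D * (M * (Lv * W)) + d r * M.
    apply: norm_mul2_diff; [exact: dD|exact: bFt|by []|].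
    exact: GG Ft_lip _ rt.
  rewrite (_ : _ - _ = (vel (d1 r) * k r * F r z1 - vel (d2 r) * k' r * F r z2) +
     (vel (d1 r) * d1 r * Fx r z1 - vel (d2 r) * d2 r * Fx r z2) -
     (d1 r * Ft r z1 - d2 r * Ft r z2)); last by ring.
  apply: le_trans (ler_normB _ _) _.
  apply: (@le_trans _ _ (Vm * ka * (M * (Lv * W)) + Lv * d r * ka * M + Vm * e * M +
    (Vm * D * (M * (Lv * W)) + Lv * d r * D * M + Vm * d r * M) +
    (D * (M * (Lv * W)) + d r * M))).
    apply: lerD => //; apply: le_trans (ler_normD _ _) _; exact: lerD.
  by rewrite le_eqVlt; apply/orP; left; apply/eqP; rewrite /c1' /c2'; ring.
have bk1 := bm_volterra_ker ck c1 tT; have bk2 := bm_volterra_ker ck' c2 tT.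
have Ib : `|\int[leb]_(r in `[0, t]) volterra_ker k d1 t r -
            \int[leb]_(r in `[0, t]) volterra_ker k' d2 t r| <=
    Vm * e * M * T + (c1' + c2' * T) * W.
  rewrite -int_sub//.
  apply: (@le_trans _ _
    (\int[leb]_(r in `[0, t]) (Vm * e * M + c2' * W + c1' * d r))).
    apply: int_norm_le => //; first exact: bmB.
    by apply: bmD; [exact: bm_cst|apply: bmM => //; exact: bm_cst].
  rewrite int_add; [|exact: bm_cst|by apply: bmM => //; exact: bm_cst].
  rewrite int_cst// int_mul// subr0 -/W.
  have h : (Vm * e * M + c2' * W) * t <= (Vm * e * M + c2' * W) * T.
    by rewrite ler_wpM2l// /c2' !(mulr_ge0, addr_ge0).
  have := lerD h (lexx (c1' * W)); move=> {}h; apply: le_trans h _.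
  by rewrite le_eqVlt; apply/orP; left; apply/eqP; ring.
rewrite /volterra_op -mulrBr /volt_e /volt_w -!mulrA -mulrDr.
apply: norm_mul_le.
  by rewrite ger0_norm ?q_qi// invr_ge0 ltW// q_gt0.
have hB : `|B (flow d1 t) - B (flow d2 t)| <= N * (Lv * W).
  by apply: le_trans (B_lip _ _) _; try exact: (flow_nneg velP); rewrite ler_wpM2l.
have hF : `|m * F 0 (flow d1 t) - m * F 0 (flow d2 t)| <= `|m| * (M * (Lv * W)).
  rewrite -mulrBr normrM ler_wpM2l//.
  apply: le_trans (F_lip _ _ _) _; try exact: (flow_nneg velP).
    by rewrite lexx ltW.
  by rewrite ler_wpM2l.
have hk := kke _ tT.
have := lerD (lerD (lerD hk hB) hF) Ib => H.
set I1 := Rintegral _ _ _; set I2 := Rintegral _ _ _.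
rewrite (_ : _ - _ = (k t - k' t) - (B (flow d1 t) - B (flow d2 t)) +
  (m * F 0 (flow d1 t) - m * F 0 (flow d2 t)) - (I1 - I2)); last by ring.
have t1 := ler_normB (k t - k' t) (B (flow d1 t) - B (flow d2 t)).
have t2 := ler_normD ((k t - k' t) - (B (flow d1 t) - B (flow d2 t)))
  (m * F 0 (flow d1 t) - m * F 0 (flow d2 t)).
have t3 := ler_normB ((k t - k' t) - (B (flow d1 t) - B (flow d2 t)) +
  (m * F 0 (flow d1 t) - m * F 0 (flow d2 t))) (I1 - I2).
have {}H := le_trans (le_trans t3 (lerD (le_trans t2 (lerD t1 (lexx _)))
  (lexx _))) H.
apply: le_trans H _.
by rewrite le_eqVlt; apply/orP; left; apply/eqP; rewrite /c1' /c2'; ring.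
Qed.

Lemma comp_flow_prim (G Gx dl : R -> R) : mean_value G Gx ->
  continuous Gx -> cont dl ->
  primitive T (fun t => G (flow dl t)) (fun t => Gx (flow dl t) * vel (dl t)).
Proof.
move=> Gm cGx cd.
have cv := vel_within velP cd.
have cP := prim_continuous (flow_prim velP cd).
have C1 : C1_on setT `[0, +oo[ (fun _ => G) (fun _ _ => 0) (fun _ => Gx).
  split.
  - by move=> t1 t2 x _ _ _; exists t1; rewrite ?subrr ?normr0 ?mul0r.
  - move=> t0 x1 x2 _ /=; rewrite !in_itv/= !andbT; exact: Gm.
  - by move=> p; exact: cvg_cst.
  - move=> [p1 p2]; apply: (cvg_comp (@snd R R) Gx); first exact: cvg_snd.
    exact: cGx.
apply: C1_prim.
  move=> t; apply: cvgM; last exact: cv.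
  by apply: continuous_comp; [exact: cP|exact: cGx].
move=> t tT.
have tI : `[0, T]%classic t by rewrite /= in_itv.
have := has_deriv_chain2 (sg := id) C1 tI _ _ (has_deriv_id _ _)
  (int_has_deriv cv tT).
rewrite mul0r add0r; apply => // y /=; rewrite !in_itv/= andbT.
exact: (flow_nneg velP).
Qed.

Lemma q_inv_prim : primitive T (fun t => (F t 0)^-1) (fun t => - Ft t 0 / (F t 0)
  ^+ 2).
Proof.
have cont0 (G : R -> R -> R) : continuous (fun p : R * R => G p.1 p.2) ->
    cont (fun t => G t 0).
  move=> cG; apply: continuous_subspaceT => t.
  exact: (cvg_comp2 cG cvg_id (cvg_cst _)).
have cq := cont0 _ cF; have cqt := cont0 _ cFt.
apply: C1_prim.
  apply/subspace_continuousP => t tT.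
  have q0 : F t 0 != 0 by rewrite gt_eqF// q_gt0//; move: tT; rewrite /= in_itv.
  have /subspace_continuousP/(_ t tT) c1 := cq.
  have /subspace_continuousP/(_ t tT) c2 := cqt.
  apply: cvgM; first exact: cvgN.
  by apply: cvgV; [rewrite expf_neq0|rewrite expr2; apply: cvgM].
move=> t tT.
have tI : `[0, T]%classic t by rewrite /= in_itv.
have q0 y : `[0, T]%classic y -> F y 0 != 0.
  by rewrite /= in_itv/= => yT; rewrite gt_eqF// q_gt0.
have dq := kernel_deriv0 kerP tT.
have cqt' := has_deriv_continuous dq.
have h : - ((F y 0 - F t 0) / (y - t)) / (F t 0 * F y 0)
    @[y --> within `[0, T] t^'] --> - Ft t 0 / (F t 0) ^+ 2.
  apply: cvgM; first by apply: cvgN; exact: dq.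
  rewrite expr2; apply: cvgV; first by rewrite mulf_neq0// q0.
  by apply: cvgM => //; exact: cvg_cst.
apply: cvg_trans h; apply: near_eq_cvg; apply: near_within_dnbhs => y yI yt.
have := q0 _ yI; have := q0 _ tI => a0 b0; field.
by rewrite a0 b0 subr_eq0 yt.
Qed.

(** Each of the three integrals is covered by leibniz, with H one of F, Fx, Ft; the
outer terms are compositions with the flow, and the factor 1/F(t,0) is C^1. *)
Lemma volterra_op_prim (k g dl : R -> R) : primitive T k g -> cont dl ->
  exists G, primitive T (volterra_op k dl) G.
Proof.
move=> pk cd.
have ck := prim_continuous pk.
have cv := vel_within velP cd.
have v0 t : 0 <= t <= T -> 0 <= vel (dl t) by have /andP[] := vel_bnd (dl t).
have bv := within_bm cv; have bk := within_bm ck; have bd := within_bm cd.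
have bF' : exists K : R, forall t x, `|F t x| <= K by exists M.
have bFt' : exists K : R, forall t x, `|Ft t x| <= K by exists M.
have bFx' : exists K : R, forall t x, `|Fx t x| <= K by exists M.
have bFxx' : exists K : R, forall t x, `|Fxx t x| <= K.
  by exists M; exact: kernel_xx_bnd kerP.
have p1 := leibniz cv v0 (bmM bv bk) (kernel_mean kerP) cF cFx bF' bFx'.
have p2 := leibniz cv v0 (bmM bv bd) (kernel_x_mean kerP) cFx
  (kernel_xx_cont kerP) bFx' bFxx'.
have p3 := leibniz cv v0 bd (kernel_t_mean kerP) cFt
  (kernel_tx_cont kerP) bFt' (kernel_tx_bnd kerP).
have pB := comp_flow_prim (initial_mean iniP) (initial_deriv_cont iniP) cd.
have h0 : 0 <= (0 : R) <= T by rewrite lexx ltW.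
have cFx0 : continuous (Fx 0).
  by move=> x; exact: (cvg_comp2 cFx (cvg_cst _) cvg_id).
have pF := comp_flow_prim (kernel_mean kerP h0) cFx0 cd.
have pall := primM q_inv_prim (primB (primD (primB pk pB) (primZ m pF))
  (primB (primD p1 p2) p3)).
(* Only the existence of a bounded derivative matters: it is the one computed by
   the rules above. *)
eexists; apply: eq_prim pall; last by move=> t _; reflexivity.
move=> t tT; rewrite /volterra_op; congr (_ * (_ - _)).
have bG (G : R -> R -> R) : continuous (fun p : R * R => G p.1 p.2) ->
    (exists K : R, forall t x, `|G t x| <= K) ->
    bounded_mfun `[0, t] (fun r => G r (flow dl t - flow dl r)).
  by move=> cG GM; apply: (bm_along_l cv cG _ tT).
have bt (u : R -> R) : bounded_mfun `[0, T] u -> bounded_mfun `[0, t] u.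
  by move=> bu; apply: bm_sub_itv bu => //; case/andP: tT.
have b1 := bmM (bt _ (bmM bv bk)) (bG _ cF bF').
have b2 := bmM (bt _ (bmM bv bd)) (bG _ cFx bFx').
have b3 := bmM (bt _ bd) (bG _ cFt bFt').
by rewrite -int_add// -int_sub//; exact: bmD.
Qed.

Definition volterra_sol (k dl : R -> R) : Prop :=
  cont dl /\ forall t, 0 <= t <= T -> dl t = volterra_op k dl t.

(** The bound that Gronwall's inequality gives on solutions; the Picard iterates
obey it as well. *)
Definition volt_D (ka : R) := 2 * volt_a ka * expR (2 * volt_b * T).

Lemma volt_b_ge0 : 0 <= volt_b.
Proof. by rewrite /volt_b !(mulr_ge0, addr_ge0). Qed.

Lemma volt_a_ge0 ka : 0 <= ka -> 0 <= volt_a ka.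
Proof. by move=> ka0; rewrite /volt_a !(mulr_ge0, addr_ge0)// ltW. Qed.

Lemma volt_D_ge0 ka : 0 <= ka -> 0 <= volt_D ka.
Proof.
move=> /volt_a_ge0 h; rewrite /volt_D.
by apply: mulr_ge0; [exact: mulr_ge0|exact: expR_ge0].
Qed.

Let exp_ge1 (b t : R) : 0 <= b -> 0 <= t <= T -> 1 <= expR (b * t).
Proof. by move=> b0 /andP[t0 _]; rewrite -[leLHS]expR0 ler_expR mulr_ge0. Qed.

Let ka_ge0 (k : R -> R) ka : (forall t, 0 <= t <= T -> `|k t| <= ka) -> 0 <= ka.
Proof.
move=> h; have h0 : 0 <= (0 : R) <= T by rewrite lexx ltW.
exact: le_trans (normr_ge0 _) (h 0 h0).
Qed.

Lemma volterra_sol_bound (k dl : R -> R) ka : cont k ->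
  (forall t, 0 <= t <= T -> `|k t| <= ka) -> volterra_sol k dl ->
  forall t, 0 <= t <= T -> `|dl t| <= volt_D ka.
Proof.
move=> ck kka [cd dE] t tT; have ka0 := ka_ge0 kka.
have b0 : 0 <= 2 * volt_b by rewrite mulr_ge0// volt_b_ge0.
apply: (@le_trans _ _ (2 * volt_a ka * expR (2 * volt_b * t))); last first.
  by apply: ler_wpM2l; [apply: mulr_ge0 => //; exact: volt_a_ge0|exact: expRM_le].
apply: (@gronwall _ T (volt_a ka) volt_b (fun t => `|dl t|)) => //.
- exact: volt_a_ge0.
- exact: volt_b_ge0.
- by apply: bm_norm; exact: within_bm.
- by move=> s sT; rewrite dE//; exact: volterra_op_bound.
Qed.

Lemma volterra_sol_diff (k k' d1 d2 : R -> R) (ka e : R) : cont k -> cont k' ->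
  (forall t, 0 <= t <= T -> `|k t| <= ka) ->
  (forall t, 0 <= t <= T -> `|k t - k' t| <= e) ->
  volterra_sol k d1 -> volterra_sol k' d2 ->
  forall t, 0 <= t <= T ->
    `|d1 t - d2 t| <= 2 * volt_e * expR (2 * volt_w ka (volt_D ka) * T) * e.
Proof.
move=> ck ck' kka kke s1 s2 t tT; have ka0 := ka_ge0 kka.
have e0 : 0 <= e by apply: (@ka_ge0 (fun t => k t - k' t)).
have [c1 E1] := s1; have [c2 E2] := s2.
have dD := volterra_sol_bound ck kka s1.
have w0 := volt_w_ge0 ka0 (volt_D_ge0 ka0).
have ve0 : 0 <= volt_e by rewrite /volt_e !(mulr_ge0, addr_ge0)// ltW.
have -> : 2 * volt_e * expR (2 * volt_w ka (volt_D ka) * T) * e =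
  2 * (volt_e * e) * expR (2 * volt_w ka (volt_D ka) * T) by ring.
apply: (@le_trans _ _ (2 * (volt_e * e) * expR (2 * volt_w ka (volt_D ka) * t)));
  last first.
  apply: ler_wpM2l; first by apply: mulr_ge0 => //; exact: mulr_ge0.
  by apply: expRM_le => //; exact: mulr_ge0.
apply: (@gronwall _ T (volt_e * e) (volt_w ka (volt_D ka)) (fun t => `|d1 t -
  d2 t|)) => //.
- exact: mulr_ge0.
- by apply: bm_norm; apply: bmB; exact: within_bm.
- by move=> s sT; rewrite E1// E2//; exact: volterra_op_diff.
Qed.

(** Picard iteration from 0. All iterates obey the a priori bound D, so one constant
c works in volterra_op_diff for all of them, and consecutive differences halve in
the weight exp(2ct). *)
Lemma volterra_sol_exists (k g : R -> R) : primitive T k g ->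
  exists dl, volterra_sol k dl.
Proof.
move=> pk; have ck := prim_continuous pk.
have [_ [ka kka']] := within_bm ck.
have kka t : 0 <= t <= T -> `|k t| <= ka.
  by move=> tT; apply: kka'; rewrite /= in_itv.
have ka0 := ka_ge0 kka.
pose D := volt_D ka; have D0 : 0 <= D by exact: volt_D_ge0.
pose c := volt_w ka D; have c0 : 0 <= c by exact: volt_w_ge0.
pose d n := iter n (volterra_op k) (cst 0).
have dS n : d n.+1 = volterra_op k (d n) by [].
have cd n : cont (d n).
  elim: n => [|n IH]; first by apply: continuous_subspaceT; exact: cst_continuous.
  by rewrite dS; have [G /prim_continuous] := volterra_op_prim pk IH.
have b0 : 0 <= volt_b := volt_b_ge0.
have a0 : 0 <= volt_a ka := volt_a_ge0 ka0.
have dbt n t : 0 <= t <= T -> `|d n t| <= 2 * volt_a ka * expR (2 * volt_b * t).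
  elim: n t => [|n IH] t tT.
    have -> : d 0 t = 0 by [].
    by rewrite normr0; apply: mulr_ge0; [exact: mulr_ge0|exact: expR_ge0].
  rewrite dS; apply: le_trans (volterra_op_bound ck (cd n) kka tT) _.
  have h1 : \int[leb]_(s in `[0, t]) `|d n s| <=
      \int[leb]_(s in `[0, t]) (2 * volt_a ka * expR (2 * volt_b * s)).
    apply: int_le; first by apply: bm_norm; exact: bm_cont.
      apply: bmM; first exact: bm_cst.
      by have /prim_bm := prim_expR t (2 * volt_b).
    by move=> s st; apply: IH; exact: in0T st.
  have h2 := @int_exp_le R T volt_b (2 * volt_a ka) t (mulr_ge0 (ler0n _ 2) a0) tT.
  have h3 := ler_wpM2l b0 h1.
  have e1 : 1 <= expR (2 * volt_b * t) by apply: exp_ge1 => //; exact: mulr_ge0.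
  apply: (@le_trans _ _ (volt_a ka + 2 * volt_a ka / 2 * (expR (2 * volt_b * t)
    - 1))).
    by rewrite lerD2l; exact: le_trans h3 h2.
  have := mulr_ge0 a0 (le_trans ler01 e1); lra.
have db n t : 0 <= t <= T -> `|d n t| <= D.
  move=> tT; apply: le_trans (dbt n t tT) _.
  apply: ler_wpM2l; first exact: mulr_ge0.
  by apply: expRM_le => //; exact: mulr_ge0.
have k0 t : 0 <= t <= T -> `|k t - k t| <= 0 by rewrite subrr normr0.
have ddt n t : 0 <= t <= T ->
    `|d n.+1 t - d n t| <= D / 2 ^+ n * expR (2 * c * t).
  elim: n t => [|n IH] t tT.
    rewrite /= subr0 expr0 divr1.
    apply: le_trans (db 1 t tT) _.
    by apply: ler_peMr => //; apply: exp_ge1 => //; exact: mulr_ge0.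
  rewrite dS [d n.+1]dS.
  apply: le_trans (volterra_op_diff ck ck (cd _) (cd _) kka (db n.+1) k0 tT) _.
  rewrite mulr0 add0r -/c.
  have h1 : \int[leb]_(s in `[0, t]) `|d n.+1 s - d n s| <=
      \int[leb]_(s in `[0, t]) (D / 2 ^+ n * expR (2 * c * s)).
    apply: int_le; first by apply: bm_norm; apply: bmB; exact: bm_cont.
      apply: bmM; first exact: bm_cst.
      by have /prim_bm := prim_expR t (2 * c).
    by move=> s st; apply: IH; exact: in0T st.
  have Dn0 : 0 <= D / 2 ^+ n by rewrite divr_ge0// exprn_ge0.
  have h2 := @int_exp_le R T c _ t Dn0 tT.
  apply: le_trans (ler_wpM2l c0 h1) _; apply: le_trans h2 _.
  have -> : D / 2 ^+ n.+1 = D / 2 ^+ n / 2.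
    by rewrite exprS; field; rewrite expf_neq0// pnatr_eq0.
  by rewrite ler_wpM2l ?divr_ge0// gerBl.
(* The factor 2 is the sum of the geometric series of the differences. *)
pose K := 2 * D * expR (2 * c * T).
have K0 : 0 <= K by apply: mulr_ge0; [exact: mulr_ge0|exact: expR_ge0].
have /choice[l lP] : forall t, exists l, 0 <= t <= T ->
    forall n, `|d n t - l| <= K / 2 ^+ n.
  move=> t; have [tT|tT] := boolP (0 <= t <= T); last by exists 0.
  have [n|l lP] := @geometric_limit R (fun n => d n t) K.
    apply: le_trans (ddt n t tT) _.
    have -> : K / 2 ^+ n.+1 = D / 2 ^+ n * expR (2 * c * T).
      by rewrite /K exprS; field; rewrite expf_neq0// pnatr_eq0.
    apply: ler_wpM2l; first by rewrite divr_ge0// exprn_ge0.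
    by apply: expRM_le => //; exact: mulr_ge0.
  by exists l.
(* 2^n exceeds n, and n can be chosen beyond C / e. *)
have small (C e : R) : 0 < e -> 0 <= C -> exists n, C / 2 ^+ n <= e.
  move=> e0 C0; exists (Num.truncn (C / e)).+1.
  rewrite ler_pdivrMr ?exprn_gt0// mulrC -ler_pdivrMr//.
  apply: (@le_trans _ _ (Num.truncn (C / e)).+1%:R).
    by apply: ltW; apply: truncnS_gt.
  by rewrite -natrX ler_nat ltnW// ltn_expl.
have cl : cont l.
  apply/subspace_continuousP => t tI; apply/cvgrPdist_le => e e0.
  have e3 : 0 < e / 3 by rewrite divr_gt0.
  have [n nK] := small K _ e3 K0.
  have tT : 0 <= t <= T by move: tI; rewrite /= in_itv.
  have /cvgrPdist_le/(_ _ e3) cs := (subspace_continuousP _ _).1 (cd n) t tI.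
  have {cs} : \forall y \near t, `[0, T]%classic y -> `|d n t -
    d n y| <= e / 3 by exact: cs.
  apply: (@filterS _ (nbhs t)) => y h yI.
  have yT : 0 <= y <= T by move: yI; rewrite /= in_itv.
  have h1 := le_trans (lP t tT n) nK; have h2 := le_trans (lP y yT n) nK.
  have h3 := h yI.
  (* A uniform limit of continuous functions is continuous. *)
  have -> : l t - l y = (d n t - d n y) - (d n t - l t) + (d n y - l y) by ring.
  have -> : e = e / 3 + e / 3 + e / 3 by field.
  apply: le_trans (ler_normD _ _) _; apply: lerD h2.
  apply: le_trans (ler_normB _ _) _; exact: lerD h3 h1.
exists l; split => // t tT; apply/eqP; rewrite -subr_eq0 -normr_le0.
apply/ler_addgt0Pr => e e0; rewrite add0r.
(* C / 2^n bounds the defect of l in the fixed point equation, for every n. *)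
pose C := K + c * (K * T).
have C0 : 0 <= C by rewrite /C !(mulr_ge0, addr_ge0)// ltW.
have [n nC] := small C _ e0 C0.
have h1 := lP t tT n.+1.
have h2 := volterra_op_diff ck ck (cd n) cl kka (db n) k0 tT.
rewrite mulr0 add0r -/c -dS in h2.
have h3 : \int[leb]_(s in `[0, t]) `|d n s - l s| <= K / 2 ^+ n * T.
  apply: (@le_trans _ _ (\int[leb]_(s in `[0, t]) (K / 2 ^+ n))).
    apply: int_le; [|exact: bm_cst|by move=> s st; apply: lP; exact: in0T st].
    by apply: bm_norm; apply: bmB; exact: bm_cont.
  have /andP[t0 tT'] := tT.
  by rewrite int_cst// subr0 ler_wpM2l// divr_ge0// exprn_ge0.
have h4 := le_trans h2 (ler_wpM2l c0 h3).
have h5 : K / 2 ^+ n.+1 <= K / 2 ^+ n.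
  by rewrite ler_wpM2l// lef_pV2 ?posrE ?exprn_gt0// ler_weXn2l// ler1n.
have h6 : `|l t - volterra_op k l t| <=
   `|d n.+1 t - l t| + `|d n.+1 t - volterra_op k l t|.
  have -> : l t - volterra_op k l t =
    (d n.+1 t - volterra_op k l t) - (d n.+1 t - l t) by ring.
  by rewrite [leRHS]addrC; exact: ler_normB.
apply: le_trans h6 _; apply: le_trans (lerD (le_trans h1 h5) h4) _.
apply: le_trans nC; rewrite /C le_eqVlt; apply/orP; left; apply/eqP; ring.
Qed.

End Volterra.

(** * The equation for the inflow rate *)

Lemma int_ae_eq (R : realType) (a b : R) (g h : R -> R) :
  bounded_mfun `[a, b] g -> bounded_mfun `[a, b] h ->
  {ae (@lebesgue_measure R), forall t, a <= t <= b -> g t = h t} ->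
  \int[@lebesgue_measure R]_(t in `[a, b]) g t =
  \int[@lebesgue_measure R]_(t in `[a, b]) h t.
Proof.
move=> [mg _] [mh _] gh; congr fine; apply: ae_eq_integral => //.
- exact/measurable_EFinP.
- exact/measurable_EFinP.
by apply: (ae_imply _ gh) => t E; rewrite /= in_itv/= => /E ->.
Qed.

Section Inflow.
Context (R : realType).
Local Notation leb := (@lebesgue_measure R).
Variables (T : R) (vel : R -> R) (Lv Vm : R) (B Bx : R -> R) (N m : R).
Variables (F Ft Fx Ftx Fxx : R -> R -> R) (M qi : R).
Hypothesis T0 : 0 < T.
Hypothesis velP : velocity vel Lv Vm.
Hypothesis iniP : initial_data B Bx N.
Hypothesis kerP : kernel_data T F Ft Fx Ftx Fxx M qi.

Let cF := kernel_cont kerP.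
Let cFt := kernel_t_cont kerP.
Let cFx := kernel_x_cont kerP.
Let bF := kernel_bnd kerP.
Let bFt := kernel_t_bnd kerP.
Let bFx := kernel_x_bnd kerP.

Local Notation flow := (flow vel).
Local Notation cont u := {within `[0, T], continuous u}.
Local Notation sol := (volterra_sol T vel B m F Ft Fx).

Let bm_along_flow (G : R -> R -> R) (dl : R -> R) (t : R) : cont dl ->
  continuous (fun p : R * R => G p.1 p.2) -> (forall t x, `|G t x| <= M) ->
  0 <= t <= T -> bounded_mfun `[0, t] (fun r => G r (flow dl t - flow dl r)).
Proof.
move=> cd cG GM tT; have cv := vel_within velP cd.
by apply: (bm_along_l cv cG _ tT); exists M.
Qed.

(** This is the kernel read along the characteristic that reaches the origin at time
t, so its derivative is the transport operator applied to F. *)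
Lemma kernel_along_prim (dl : R -> R) (t : R) : cont dl -> 0 <= t <= T ->
  primitive t (fun r => F r (flow dl t - flow dl r))
    (fun r => Ft r (flow dl t - flow dl r) -
              vel (dl r) * Fx r (flow dl t - flow dl r)).
Proof.
move=> cd tT; have /andP[t0 tT'] := tT.
have cv := vel_within velP cd.
have cP := prim_continuous (flow_prim velP cd).
have sub : `[0, t] `<=` `[0, T] by exact: sub_itvcc.
have C1 : C1_on `[0, T] `[0, +oo[ F Ft Fx.
  split => //.
  - move=> t1 t2 x /=; rewrite !in_itv/= andbT; exact: (kernel_mean_t kerP).
  - move=> s x y /=; rewrite !in_itv/= !andbT => sT; exact: (kernel_mean kerP sT).
have cz : {within `[0, t], continuous (fun r => flow dl t - flow dl r)}.
  apply/subspace_continuousP => s sI; apply: cvgB; first exact: cvg_cst.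
  by have /subspace_continuousP := continuous_subspaceW sub cP; exact.
have cGz (G : R -> R -> R) : continuous (fun p : R * R => G p.1 p.2) ->
    {within `[0, t], continuous (fun r => G r (flow dl t - flow dl r))}.
  move=> cG; apply/subspace_continuousP => s sI.
  apply: (cvg_comp2 cG); first exact: cvg_within.
  by have /subspace_continuousP := cz; exact.
apply: C1_prim.
  apply/subspace_continuousP => s sI; apply: cvgB.
    by have /subspace_continuousP := cGz _ cFt; exact.
  apply: cvgM; last by have /subspace_continuousP := cGz _ cFx; exact.
  by have /subspace_continuousP := continuous_subspaceW sub cv; exact.
move=> s st; have sI : `[0, t]%classic s by rewrite /= in_itv.
have dz : has_deriv `[0, t] (fun r => flow dl t - flow dl r) s (0 - vel (dl s)).
  apply: has_derivB; first exact: has_deriv_cst.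
  apply: (has_derivS sub); apply: (int_has_deriv cv).
  exact: in0T st.
have := has_deriv_chain2 (sg := id) C1 sI _ _ (has_deriv_id _ _) dz.
rewrite mulr1 sub0r mulrN mulrC; apply => y /=.
  by rewrite !in_itv/=; exact: in0T.
by rewrite !in_itv/= andbT; exact: (flow_sub_ge0 velP).
Qed.

(** Integrating dl(r) F(r, P(t) - P(r)) by parts: its derivative along the
characteristic produces exactly the terms of volterra_ker with the factor dl(r).
The value dl(0) differs from m when the observation and the initial datum are
not compatible at the origin at time 0, whence the second term. *)
Lemma first_kind (k dl g : R -> R) : cont k -> primitive T dl g -> sol k dl ->
  forall t, 0 <= t <= T ->
  k t = B (flow dl t) + (dl 0 - m) * F 0 (flow dl t) +
    \int[leb]_(r in `[0, t])
      ((g r + vel (dl r) * k r) * F r (flow dl t - flow dl r)).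
Proof.
move=> ck pd [cd dE] t tT; have /andP[t0 tT'] := tT.
have pt : primitive t dl g.
  split; first by have [bg _] := pd; exact: bm_sub_itv bg.
  by move=> s st; apply: pd.2; exact: in0T st.
have := (primM pt (kernel_along_prim cd tT)).2 t.
rewrite t0 lexx subrr flow0 subr0 => /(_ isT) E1.
have bt (u : R -> R) : bounded_mfun `[0, T] u -> bounded_mfun `[0, t] u.
  by move=> bu; apply: bm_sub_itv bu.
have bg := bt _ pd.1; have bd := bt _ (within_bm cd).
have bv := bt _ (within_bm (vel_within velP cd)).
have bk := bt _ (within_bm ck).
have b1 := bm_along_flow cd cF bF tT.
have b2 := bm_along_flow cd cFt bFt tT.
have b3 := bm_along_flow cd cFx bFx tT.
have bgF := bmM bg b1.
have bdF : bounded_mfun `[0, t] (fun r => dl r * (Ft r (flow dl t - flow dl r) -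
              vel (dl r) * Fx r (flow dl t - flow dl r))).
  by apply: bmM => //; apply: bmB => //; exact: bmM.
have bK := bm_volterra_ker velP kerP ck cd tT.
have := dE t tT; rewrite /volterra_op => E2.
have q0 : F t 0 != 0 by rewrite gt_eqF// (kernel_gt0 kerP).
have {}E2 : dl t * F t 0 = k t - B (flow dl t) + m * F 0 (flow dl t) -
    \int[leb]_(r in `[0, t]) volterra_ker vel F Ft Fx k dl t r.
  by rewrite {1}E2 mulrC mulrA mulfV// mul1r.
have E3 : \int[leb]_(r in `[0, t])
      ((g r + vel (dl r) * k r) * F r (flow dl t - flow dl r)) =
   \int[leb]_(r in `[0, t]) (g r * F r (flow dl t - flow dl r) + dl r *
     (Ft r (flow dl t - flow dl r) - vel (dl r) * Fx r (flow dl t - flow dl r))) +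
   \int[leb]_(r in `[0, t]) volterra_ker vel F Ft Fx k dl t r.
  rewrite -int_add//; last exact: bmD.
  by apply: int_eq => r _; rewrite /volterra_ker; ring.
rewrite E3; move: E1 E2.
set I1 := Rintegral _ _ _; set I2 := Rintegral _ _ _; clearbody I1 I2.
by move=> -> E2; apply/eqP; rewrite -subr_eq0; apply/eqP; move: E2; set x := k t;
  set y := B _; set z := F 0 _; clearbody x y z; move=> E2; lra.
Qed.

(** The equation of first_kind differentiated in t and solved for f(t); as an equation
for f it is a linear Volterra equation of the second kind. *)
Definition inflow_formula (k1 dl f : R -> R) (t : R) : R :=
  (F t 0)^-1 * (k1 t - (Bx (flow dl t) + (dl 0 - m) * Fx 0 (flow dl t) +
    \int[leb]_(r in `[0, t]) (f r * Fx r (flow dl t - flow dl r))) *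
    vel (dl t)).

(** Differentiating first_kind determines the rate almost everywhere. Substituting
that rate into the formula yields a representative f for which the formula holds
at every t, since its integral does not see null sets; Gronwall's inequality can
then be applied pointwise. *)
Lemma inflow_rep (k k1 dl g : R -> R) : primitive T k k1 -> primitive T dl g ->
  sol k dl ->
  exists f, [/\ bounded_mfun `[0, T] f,
    forall t, 0 <= t <= T -> f t = inflow_formula k1 dl f t &
    {ae leb, forall t, 0 <= t <= T -> g t + vel (dl t) * k t = f t}].
Proof.
move=> pk pd sd; have ck := prim_continuous pk; have [cd _] := sd.
have cv := vel_within velP cd.
have v0 t : 0 <= t <= T -> 0 <= vel (dl t).
  by have /andP[] := velocity_bnd velP (dl t).
have [bg _] := pd; have [bk1 _] := pk.
pose h t := g t + vel (dl t) * k t.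
have bh : bounded_mfun `[0, T] h.
  by apply: bmD => //; apply: bmM; [exact: within_bm|exact: within_bm].
have h0 : 0 <= (0 : R) <= T by rewrite lexx ltW.
have pB := comp_flow_prim velP (initial_mean iniP) (initial_deriv_cont iniP) cd.
have cFx0 : continuous (Fx 0).
  by move=> x; exact: (cvg_comp2 cFx (cvg_cst _) cvg_id).
have pF := comp_flow_prim velP (kernel_mean kerP h0) cFx0 cd.
have pL := leibniz cv v0 bh (kernel_mean kerP) cF cFx (ex_intro _ M bF)
  (ex_intro _ M bFx).
have pR := primD (primD pB (primZ (dl 0 - m) pF)) pL.
have := primB pk pR.
(* D is the derivative of the difference of the two sides of first_kind, which is
   zero: solving D = 0 for h gives the formula almost everywhere. *)
set D := (X in primitive _ _ X) => pD.
have bD : bounded_mfun `[0, T] D by have [] := pD.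
have D0 : {ae leb, forall t, 0 <= t <= T -> D t = 0}.
  apply: int0_ae => // t tT; have := pD.2 t tT.
  rewrite -!(first_kind ck pd sd)// !subrr add0r => <-//.
have bI : bounded_mfun `[0, T] (fun t =>
    \int[leb]_(r in `[0, t]) (h r * Fx r (flow dl t - flow dl r)) * vel (dl t)).
  have [bL _] := pL.
  have bhF : bounded_mfun `[0, T] (fun t => h t * F t 0).
    apply: bmM => //; apply: (bm_pullback2 (a := id) (b := cst 0)) => //.
    by exists M.
  by have := bmB bL bhF; apply: eq_bm => t _; rewrite /flow /h; ring_int.
pose f := inflow_formula k1 dl h.
have hf : {ae leb, forall t, 0 <= t <= T -> h t = f t}.
  apply: (ae_imply _ D0) => t Dt tT; have := Dt tT; rewrite /D /f /inflow_formula.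
  have q0 : F t 0 != 0 by rewrite gt_eqF// (kernel_gt0 kerP).
  rewrite -/(flow dl t); set I := Rintegral _ _ _.
  move=> E; apply: (mulfI q0); rewrite mulrA mulfV// mul1r.
  clearbody I; apply/eqP; rewrite -subr_eq0 -oppr_eq0 -[X in _ == X]E.
  by apply/eqP; ring.
have bf : bounded_mfun `[0, T] f.
  have cP := prim_continuous (flow_prim velP cd).
  have bG (G : R -> R) : continuous G -> bounded_mfun `[0,
    T] (fun t => G (flow dl t)).
    move=> cG; apply: within_bm => t; apply: continuous_comp; first exact: cP.
    exact: cG.
  have bq := prim_bm (q_inv_prim kerP).
  have bB := bG _ (initial_deriv_cont iniP).
  have bF0 := bmM (bm_cst `[0, T] (dl 0 - m)) (bG _ cFx0).
  have := bmM bq (bmB bk1 (bmD (bmM (bmD bB bF0) (within_bm cv)) bI)).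
  apply: eq_bm => t _; rewrite /f /inflow_formula.
  by congr (_ * (_ - _)); rewrite [RHS]mulrDl.
exists f; split => // t tT; rewrite {1}/f /inflow_formula.
congr (_ * (_ - (_ + _) * _)).
have bFx' := bm_along_flow cd cFx bFx tT.
have bt (u : R -> R) : bounded_mfun `[0, T] u -> bounded_mfun `[0, t] u.
  by move=> bu; apply: bm_sub_itv bu => //; case/andP: tT.
apply: int_ae_eq; [exact: bmM (bt _ bh) bFx'|exact: bmM (bt _ bf) bFx'|].
apply: (ae_imply _ hf) => r E rt; congr (_ * _); apply: E.
exact: in0T rt.
Qed.

Variable N2 : R.
Hypothesis Bx_lip : lipschitz_ge0 N2 Bx.

Let M0 : 0 <= M. Proof. exact: le_trans (bF 0 0). Qed.
Let Vm0 : 0 <= Vm.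
Proof. by have /andP[] := velocity_bnd velP 0; exact: le_trans. Qed.
Let qi0 : 0 <= qi.
Proof.
have h : 0 <= (0 : R) <= T by rewrite lexx ltW.
by apply: le_trans (kernel_inv kerP h); rewrite invr_ge0 ltW// (kernel_gt0 kerP).
Qed.
Let Lv0 := velocity_lip_ge0 velP.

Let qn t : 0 <= t <= T -> `|(F t 0)^-1| <= qi.
Proof.
move=> tT; rewrite ger0_norm; first exact: (kernel_inv kerP).
by rewrite invr_ge0 ltW// (kernel_gt0 kerP).
Qed.

(** The slope in Gronwall's inequality for the linear equation satisfied by f. *)
Definition infl_rate := qi * (M * Vm).
Definition infl_bound (K1 C : R) :=
  2 * (qi * (K1 + (N + C * M) * Vm)) * expR (2 * infl_rate * T).

Let rate0 : 0 <= infl_rate. Proof. by rewrite /infl_rate !mulr_ge0. Qed.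

Let bt (u : R -> R) (t : R) : bounded_mfun `[0, T] u -> 0 <= t <= T ->
  bounded_mfun `[0, t] u.
Proof. by move=> bu /andP[_ tT]; apply: bm_sub_itv bu. Qed.

Lemma inflow_formula_bound (k1 dl f : R -> R) (K1 C : R) : cont dl ->
  bounded_mfun `[0, T] f ->
  (forall t, 0 <= t <= T -> f t = inflow_formula k1 dl f t) ->
  (forall t, 0 <= t <= T -> `|k1 t| <= K1) -> `|dl 0 - m| <= C ->
  forall t, 0 <= t <= T -> `|f t| <= infl_bound K1 C.
Proof.
move=> cd bf fE k1K dC t tT.
have C0 : 0 <= C by exact: le_trans dC.
have K0 : 0 <= K1 by exact: le_trans (k1K t tT).
have N0 : 0 <= N by exact: le_trans (initial_bnd iniP 0).
have A0 : 0 <= qi * (K1 + (N + C * M) * Vm) by rewrite !(mulr_ge0, addr_ge0).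
apply: (@le_trans _ _ (2 * (qi * (K1 + (N + C * M) * Vm)) *
   expR (2 * infl_rate * t))); last first.
  by apply: ler_wpM2l; [exact: mulr_ge0|apply: expRM_le => //; exact: mulr_ge0].
apply: (@gronwall _ T _ infl_rate (fun t => `|f t|)) => //; first exact: bm_norm.
move=> s sT; have /andP[s0 sT'] := sT.
rewrite fE// /inflow_formula.
have bfs := bt bf sT.
have bfF := bmM bfs (bm_along_flow cd cFx bFx sT).
have nI : `|\int[leb]_(r in `[0, s]) (f r * Fx r (flow dl s - flow dl r))| <=
    M * \int[leb]_(r in `[0, s]) `|f r|.
  rewrite -int_mul; last exact: bm_norm.
  apply: int_norm_le => //; first by apply: bmM; [exact: bm_cst|exact: bm_norm].
  by move=> r _; rewrite normrM mulrC ler_wpM2r.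
have nX : `|Bx (flow dl s) + (dl 0 - m) * Fx 0 (flow dl s) +
    \int[leb]_(r in `[0, s]) (f r * Fx r (flow dl s - flow dl r))| <=
    N + C * M + M * \int[leb]_(r in `[0, s]) `|f r|.
  apply: le_trans (ler_normD _ _) _; apply: lerD => //.
  apply: le_trans (ler_normD _ _) _; apply: lerD.
    exact: initial_deriv_bnd iniP _.
  exact: norm_mul_le.
rewrite /infl_rate -!mulrA -mulrDr; apply: norm_mul_le; first exact: qn.
apply: le_trans (ler_normB _ _) _.
apply: le_trans (lerD (k1K s sT) (norm_mul_le nX (vel_norm velP _))) _.
by rewrite le_eqVlt; apply/orP; left; apply/eqP; ring_int.
Qed.

(** How much the right side of inflow_formula changes with the solution dl, when f is
bounded by infl_bound: through the last factor vel(dl) in the first line, and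
through the flow and dl(0) in the others. *)
Definition infl_stab (K1 C : R) := (N + C * M + M * infl_bound K1 C * T) * Lv +
  (N2 * (Lv * T) + (C * (M * (Lv * T)) + M) +
    infl_bound K1 C * (M * (Lv * T)) * T) * Vm.

(** The second rate f2 enters through f1 - f2 only, so that the constant involves
bounds for the first observation. *)
Lemma inflow_formula_diff (k1 k2 d1 d2 f1 f2 : R -> R) (K1 C eta e : R) :
  cont d1 -> cont d2 -> bounded_mfun `[0, T] f1 -> bounded_mfun `[0, T] f2 ->
  (forall t, 0 <= t <= T -> f1 t = inflow_formula k1 d1 f1 t) ->
  (forall t, 0 <= t <= T -> f2 t = inflow_formula k2 d2 f2 t) ->
  (forall t, 0 <= t <= T -> `|k1 t| <= K1) -> `|d1 0 - m| <= C ->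
  (forall t, 0 <= t <= T -> `|d1 t - d2 t| <= eta) ->
  (forall t, 0 <= t <= T -> `|k1 t - k2 t| <= e) ->
  forall t, 0 <= t <= T ->
  `|f1 t - f2 t| <=
    2 * (qi * (e + infl_stab K1 C * eta)) * expR (2 * infl_rate * T).
Proof.
move=> c1 c2 b1 b2 f1E f2E k1K dC dd kk t tT.
have fb := inflow_formula_bound c1 b1 f1E k1K dC.
set Fb := infl_bound K1 C in fb.
have h0 : 0 <= (0 : R) <= T by rewrite lexx ltW.
have C0 : 0 <= C by exact: le_trans dC.
have e0 : 0 <= e by exact: le_trans (kk t tT).
have eta0 : 0 <= eta by exact: le_trans (dd t tT).
have Fb0 : 0 <= Fb by exact: le_trans (fb t tT).
have N0 : 0 <= N by exact: le_trans (initial_bnd iniP 0).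
have N20 : 0 <= N2.
  have := @Bx_lip 1 0; rewrite ler01 lexx subr0 normr1 mulr1 => /(_ isT isT).
  exact: le_trans.
have S0 : 0 <= infl_stab K1 C.
  rewrite /infl_stab -/Fb; move: (Fb) Fb0 => x x0.
  by rewrite !(mulr_ge0, addr_ge0)// ltW.
have A0 : 0 <= qi * (e + infl_stab K1 C * eta).
  by apply: mulr_ge0 => //; apply: addr_ge0 => //; exact: mulr_ge0.
apply: (@le_trans _ _ (2 * (qi * (e + infl_stab K1 C * eta)) *
   expR (2 * infl_rate * t))); last first.
  by apply: ler_wpM2l; [exact: mulr_ge0|apply: expRM_le => //; exact: mulr_ge0].
apply: (@gronwall _ T _ infl_rate (fun t => `|f1 t - f2 t|)) => //.
  by apply: bm_norm; exact: bmB.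
move=> s sT; have /andP[s0 sT'] := sT.
set J := \int[leb]_(r in `[0, s]) `|f1 r - f2 r|.
have J0 : 0 <= J by exact: int_ge0.
have bd : bounded_mfun `[0, s] (fun r => `|d1 r - d2 r|).
  by apply: bm_norm; apply: bmB; apply: bt => //; exact: within_bm.
have W : \int[leb]_(r in `[0, s]) `|d1 r - d2 r| <= eta * T.
  apply: (@le_trans _ _ (\int[leb]_(r in `[0, s]) eta)).
    apply: int_le => //; first exact: bm_cst.
    by move=> r rs; apply: dd; exact: in0T rs.
  by rewrite int_cst// subr0 ler_wpM2l.
have zz r : 0 <= r <= s ->
    `|(flow d1 s - flow d1 r) - (flow d2 s - flow d2 r)| <= Lv * T * eta.
  move=> /andP[r0 rs]; apply: le_trans (flow_diff velP c1 c2 r0 rs sT') _.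
  by rewrite -mulrA [T * eta]mulrC ler_wpM2l.
have PP : `|flow d1 s - flow d2 s| <= Lv * T * eta.
  by have := zz 0; rewrite !flow0 !subr0; apply; rewrite lexx.
have Fx_lip r : 0 <= r <= T -> lipschitz_ge0 M (Fx r).
  move=> rT; exact: mean_value_lip (kernel_x_mean kerP rT) (kernel_xx_bnd kerP r).
set Y1 := \int[leb]_(r in `[0, s]) (f1 r * Fx r (flow d1 s - flow d1 r)).
set Y2 := \int[leb]_(r in `[0, s]) (f2 r * Fx r (flow d2 s - flow d2 r)).
have bY1 := bmM (bt b1 sT) (bm_along_flow c1 cFx bFx sT).
have bY2 := bmM (bt b2 sT) (bm_along_flow c2 cFx bFx sT).
have bJ : bounded_mfun `[0, s] (fun r => `|f1 r - f2 r|).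
  by apply: bm_norm; apply: bmB; exact: bt.
have nY1 : `|Y1| <= M * Fb * T.
  apply: (@le_trans _ _ (M * Fb * (s - 0))).
    apply: int_norm_cst => // r rs; rewrite mulrC; apply: norm_mul_le => //.
    by apply: fb; exact: in0T rs.
  by rewrite subr0 ler_wpM2l// mulr_ge0.
have dY : `|Y1 - Y2| <= Fb * (M * (Lv * T)) * T * eta + M * J.
  rewrite /Y1 /Y2 -int_sub//.
  apply: (@le_trans _ _ (\int[leb]_(r in `[0, s])
      (Fb * (M * (Lv * T * eta)) + M * `|f1 r - f2 r|))).
    apply: int_norm_le; first exact: bmB.
      by apply: bmD; [exact: bm_cst|apply: bmM => //; exact: bm_cst].
    move=> r rs; rewrite [M * `|_|]mulrC; apply: norm_mul2_diff => //.
      by apply: fb; exact: in0T rs.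
    apply: le_trans (Fx_lip _ (in0T sT rs) _ _ _ _) _; try exact:
      (flow_sub_ge0 velP).
    by rewrite ler_wpM2l// zz.
  rewrite int_add; [|exact: bm_cst|by apply: bmM => //; exact: bm_cst].
  rewrite int_cst// int_mul// subr0 -/J lerD2r.
  have -> : Fb * (M * (Lv * T)) * T * eta = Fb * (M * (Lv * T * eta)) * T by ring.
  rewrite ler_wpM2l//; apply: mulr_ge0 => //; apply: mulr_ge0 => //.
  by rewrite !mulr_ge0// ltW.
pose X1 := Bx (flow d1 s) + (d1 0 - m) * Fx 0 (flow d1 s) + Y1.
pose X2 := Bx (flow d2 s) + (d2 0 - m) * Fx 0 (flow d2 s) + Y2.
have nX1 : `|X1| <= N + C * M + M * Fb * T.
  apply: le_trans (ler_normD _ _) _; apply: lerD => //.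
  apply: le_trans (ler_normD _ _) _; apply: lerD.
    exact: initial_deriv_bnd iniP _.
  exact: norm_mul_le.
have dX : `|X1 - X2| <= (N2 * (Lv * T) + (C * (M * (Lv * T)) + M) +
    Fb * (M * (Lv * T)) * T) * eta + M * J.
  have -> : X1 - X2 = (Bx (flow d1 s) - Bx (flow d2 s)) +
     ((d1 0 - m) * Fx 0 (flow d1 s) - (d2 0 - m) * Fx 0 (flow d2 s)) +
     (Y1 - Y2) by rewrite /X1 /X2; clearbody Y1 Y2; ring.
  apply: (@le_trans _ _ (N2 * (Lv * T * eta) +
     (C * (M * (Lv * T * eta)) + eta * M) + (Fb * (M * (Lv * T)) * T * eta +
       M * J))).
    apply: le_trans (ler_normD _ _) _; apply: lerD => //.
    apply: le_trans (ler_normD _ _) _; apply: lerD.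
      apply: le_trans (Bx_lip _ _) _; try exact: (flow_nneg velP).
      by rewrite ler_wpM2l.
    apply: norm_mul2_diff => //.
      by rewrite opprB addrA subrK; exact: dd.
    apply: le_trans (Fx_lip _ h0 _ _ _ _) _; try exact: (flow_nneg velP).
    by rewrite ler_wpM2l.
  by rewrite le_eqVlt; apply/orP; left; apply/eqP; clearbody J; ring.
have vv : `|vel (d1 s) - vel (d2 s)| <= Lv * eta.
  by apply: le_trans (velocity_lip velP _ _) _; rewrite ler_wpM2l// dd.
have := norm_mul2_diff nX1 (vel_norm velP (d2 s)) dX vv.
rewrite -/X1 -/X2 => dXv.
rewrite f1E// f2E// /inflow_formula -mulrBr -/Y1 -/Y2 -/X1 -/X2.
rewrite /infl_rate -!mulrA -mulrDr; apply: norm_mul_le; first exact: qn.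
have -> : k1 s - X1 * vel (d1 s) - (k2 s - X2 * vel (d2 s)) =
  (k1 s - k2 s) - (X1 * vel (d1 s) - X2 * vel (d2 s)) by ring.
apply: le_trans (ler_normB _ _) _.
apply: le_trans (lerD (kk s sT) dXv) _.
rewrite le_eqVlt; apply/orP; left; apply/eqP; rewrite /infl_stab -/Fb.
by clearbody J; ring.
Qed.

End Inflow.

(** * Data on the half line and on the strip *)

Section OneSided.
Context (R : realType).
Local Notation leb := (@lebesgue_measure R).

Local Notation J := (`[0, +oo[%classic : set R).

Definition pospart (x : R) : R := Num.max 0 x.

Lemma pos_continuous : continuous pospart.
Proof.
move=> t; apply: (@continuous_max _ _ (cst 0) id); first exact: cst_continuous.
exact: cvg_id.
Qed.

Lemma pos_ge0 x : 0 <= pospart x. Proof. by rewrite /pospart le_max lexx. Qed.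

Lemma pos_id x : 0 <= x -> pospart x = x. Proof. by move/max_idPr. Qed.

(** If the neighbourhood filter were trivial, both ends of a nondegenerate segment
close to x inside [a, b] would be equal to x. *)
Lemma within_proper (D : set R) (a b x : R) : a < b -> a <= x <= b ->
  `[a, b] `<=` D -> ProperFilter (within D x^').
Proof.
move=> ab xab abD; split; last exact: within_filter.
rewrite /within /= => /nbhs_ballP[d /= d0 dP].
have [p [q [ap pq qb xy]]] := sub_segment ab xab d0.
have {}dP y : p <= y <= q -> y = x.
  move=> ypq; apply/eqP; apply: contraT => yx.
  have /andP[py yq] := ypq.
  case: (dP y _ yx); first exact: xy.
  by apply: abD; rewrite /= in_itv/= (le_trans ap py) (le_trans yq qb).
have E1 := dP p; have E2 := dP q.
move: E1 E2; rewrite !lexx (ltW pq) => /(_ isT) <- /(_ isT) E.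
by move: pq; rewrite E ltxx.
Qed.

Lemma derive_in_unique (D : set R) (a b x d : R) (u : R -> R) : a < b ->
  a <= x <= b -> `[a, b] `<=` D -> has_deriv D u x d -> derive_in D u x = d.
Proof.
move=> ab xab abD ud; have PF := within_proper ab xab abD.
exact: (cvg_lim (@Rhausdorff R) ud).
Qed.

(** One bound on the difference quotients at x, whatever side of x they come from. *)
Lemma has_deriv_le (D : set R) (a b x d K : R) (u : R -> R) : a < b ->
  a <= x <= b -> `[a, b] `<=` D -> has_deriv D u x d ->
  (forall y, D y -> `|u y - u x| <= K * `|y - x|) -> `|d| <= K.
Proof.
move=> ab xab abD ud uK; have PF := within_proper ab xab abD.
apply/ler_addgt0Pr => e e0.
move/cvgrPdist_le : ud => /(_ e e0) h1.
have h2 : \forall y \near within D x^', D y /\ y != x by exact: near_within_dnbhs.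
have [y [[Dy yx] h]] := filter_ex (filterI h2 h1).
have yx0 : 0 < `|y - x| by rewrite normr_gt0 subr_eq0.
have h3 : `|(u y - u x) / (y - x)| <= K.
  by rewrite normrM normfV ler_pdivrMr// uK.
have -> : d = (u y - u x) / (y - x) + (d - (u y - u x) / (y - x)) by ring.
by apply: le_trans (ler_normD _ _) _; exact: lerD.
Qed.

Lemma eq_has_deriv (D : set R) (x d : R) (u w : R -> R) : D x ->
  (forall y, D y -> u y = w y) -> has_deriv D u x d -> has_deriv D w x d.
Proof.
move=> Dx uw; apply: cvg_trans; apply: near_eq_cvg.
by apply: near_within_dnbhs => y Dy _; rewrite !uw.
Qed.

(** Lagrange's theorem for increments of either sign. *)
Lemma has_deriv_mean (D : set R) (u g : R -> R) :
  (forall a b, D a -> D b -> `[a, b] `<=` D) ->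
  (forall x, D x -> has_deriv D u x (g x)) ->
  forall x y, D x -> D y -> exists xi,
    [/\ D xi, `|xi - x| <= `|y - x| & u y - u x = g xi * (y - x)].
Proof.
move=> Dconv ug x y Dx Dy.
have [xy|yx|<-] := ltgtP x y; last by exists x; rewrite !subrr normr0 mulr0.
- have sub := Dconv _ _ Dx Dy.
  have [|c /andP[xc cy] E] := @MVT_in R x y u g xy.
    move=> z zxy; apply: (has_derivS sub); apply: ug; apply: sub.
    by rewrite /= in_itv.
  exists c; split => //; first by apply: sub; rewrite /= in_itv/= (ltW xc) (ltW cy).
  rewrite !ger0_norm ?subr_ge0 ?(ltW xc) ?(ltW xy)//.
  by rewrite lerB// ltW.
- have sub := Dconv _ _ Dy Dx.
  have [|c /andP[yc cx] E] := @MVT_in R y x u g yx.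
    move=> z zxy; apply: (has_derivS sub); apply: ug; apply: sub.
    by rewrite /= in_itv.
  exists c; split => //; first by apply: sub; rewrite /= in_itv/= (ltW yc) (ltW cx).
    rewrite !ler0_norm ?subr_le0 ?(ltW cx) ?(ltW yx)//.
    by rewrite lerN2 lerB// ltW.
  by rewrite -[u y - u x]opprB E -mulrN opprB.
Qed.

Lemma J_conv (a b : R) : `[0, +oo[%classic a -> `[0, +oo[%classic b ->
  `[a, b] `<=` `[0, +oo[.
Proof.
rewrite /= !in_itv/= !andbT => a0 _ x /=; rewrite !in_itv/= andbT => /andP[ax _].
exact: le_trans ax.
Qed.

Lemma I_conv (T a b : R) : `[0, T]%classic a -> `[0, T]%classic b ->
  `[a, b] `<=` `[0, T].
Proof. by rewrite /= !in_itv/= => /andP[a0 _] /andP[_ bT]; exact: sub_itvcc. Qed.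

Lemma J_derive_unique (x d : R) (u : R -> R) : 0 <= x ->
  has_deriv J u x d -> derive_in J u x = d.
Proof.
move=> x0; apply: (@derive_in_unique _ 0 (x + 1)).
- by rewrite ltr_wpDl.
- by rewrite x0 lerDl ler01.
- by apply: J_conv; rewrite /= in_itv/= ?lexx ?addr_ge0.
Qed.

Lemma derive_in_supp (L x : R) (u : R -> R) : 0 <= x -> L < x ->
  (forall y, L < y -> u y = 0) -> derive_in J u x = 0.
Proof.
move=> x0 Lx uL; apply: J_derive_unique => //.
have h : (cst 0 : R -> R) y @[y --> within J x^'] --> (0 : R) by exact: cvg_cst.
apply: cvg_trans h; apply: near_eq_cvg.
have H : nbhs x [set y | L < y] by exact: lt_nbhsr.
suff : nbhs x [set y | y != x -> J y -> (cst 0 : R -> R) y = (u y - u x) / (y - x)].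
  by [].
apply: (@filterS _ (nbhs x) _ _ _ _ H) => y /= Ly _ _.
by rewrite !uL// subrr mul0r.
Qed.

(** A continuous function that vanishes beyond L is bounded, and its essential bound
is a bound at every point, the end point 0 included. *)
Lemma halfline_bound (L : R) (u : R -> R) : 0 < L -> {within J, continuous u} ->
  (forall x, L < x -> u x = 0) ->
  Linf leb J u /\ forall x, `|u (pospart x)| <= Linf_norm leb J u.
Proof.
move=> L0 cu uL.
have sub (b : R) : `[0, b] `<=` J by move=> x /=;
  rewrite !in_itv/= andbT => /andP[].
have [_ [K uK]] := within_bm (continuous_subspaceW (sub L) cu).
have Lu : Linf leb J u.
  apply: (Linf_bounded (leb_gt0 R) (c := Num.max 0 K)).
    by apply: subspace_continuous_measurable_fun.
  apply: nearW => x /=; rewrite in_itv/= andbT => x0.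
  have [xL|Lx] := leP x L; last by rewrite uL// normr0 le_max lexx.
  by rewrite le_max uK ?orbT//= in_itv/= x0.
split => // x; have x0 := pos_ge0 x.
apply: (@Linf_continuous_le _ 0 (pospart x + 1) J u) => //.
- by rewrite ltr_wpDl.
- exact: continuous_subspaceW (sub _) cu.
- by rewrite x0 lerDl ler01.
Qed.

Lemma halfline_continuous (u : R -> R) : {within J, continuous u} ->
  continuous (fun x => u (pospart x)).
Proof.
move=> cu; apply: (within_comp_continuous cu); first exact: pos_continuous.
by move=> x; rewrite /= in_itv/= andbT pos_ge0.
Qed.

Lemma halfline_mean (u : R -> R) : (forall x, J x -> derivable_in J u x) ->
  mean_value (fun x => u (pospart x)) (fun x => derive_in J u (pospart x)).
Proof.
move=> du x y x0 y0.
have [|||xi [xi0 h E]] := @has_deriv_mean J u (derive_in J u) J_conv _ x y.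
- by move=> z Jz; apply: has_deriv_in; exact: du.
- by rewrite /= in_itv/= andbT.
- by rewrite /= in_itv/= andbT.
exists xi => //; rewrite !pos_id//.
by move: xi0; rewrite /= in_itv/= andbT.
Qed.

Lemma C1_in_continuous (D : set R) (u : R -> R) : C1_in D u ->
  {within D, continuous u}.
Proof.
move=> [du _]; apply: (@has_deriv_within _ _ _ (derive_in D u)) => x Dx.
by apply: has_deriv_in; exact: du.
Qed.

Lemma initial_dataP (L : R) (kbar : R -> R) (N : R) : 0 < L -> C2_in J kbar ->
  (forall x, L < x -> kbar x = 0) -> C1_W1inf_norm J kbar <= N ->
  initial_data (fun x => kbar (pospart x))
    (fun x => derive_in J kbar (pospart x)) N.
Proof.
move=> L0 [C1 C1'] kL kN.
have ck := C1_in_continuous C1; have [_ ck'] := C1.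
have k'L x : L < x -> derive_in J kbar x = 0.
  by move=> Lx; apply: (derive_in_supp _ Lx kL); rewrite ltW// (lt_trans L0).
have [_ b0] := halfline_bound L0 ck kL.
have [_ b1] := halfline_bound L0 ck' k'L.
have n0 := Linf_norm_ge0 leb J kbar.
have n1 := Linf_norm_ge0 leb J (derive_in J kbar).
split.
- move=> x; apply: le_trans (b0 x) (le_trans _ kN).
  by rewrite /C1_W1inf_norm lerDl.
- move=> x; apply: le_trans (b1 x) (le_trans _ kN).
  by rewrite /C1_W1inf_norm lerDr.
- by apply: halfline_mean; have [] := C1.
- exact: halfline_continuous.
Qed.

Lemma initial_deriv_lip (L : R) (kbar : R -> R) : 0 < L -> C2_in J kbar ->
  (forall x, L < x -> kbar x = 0) ->
  lipschitz_ge0 (C2_W2inf_norm J kbar) (fun x => derive_in J kbar (pospart x)).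
Proof.
move=> L0 [C1 C1'] kL.
have [d'' ck''] := C1'.
have k'L x : L < x -> derive_in J kbar x = 0.
  by move=> Lx; apply: (derive_in_supp _ Lx kL); rewrite ltW// (lt_trans L0).
have k''L x : L < x -> derive_in J (derive_in J kbar) x = 0.
  by move=> Lx; apply: (derive_in_supp _ Lx k'L); rewrite ltW// (lt_trans L0).
have [_ b2] := halfline_bound L0 ck'' k''L.
apply: (mean_value_lip (halfline_mean d'')) => x.
apply: le_trans (b2 x) _; rewrite /C2_W2inf_norm lerDr.
by rewrite addr_ge0//; exact: Linf_norm_ge0.
Qed.

Variables (T L : R).
Hypothesis T0 : 0 < T.
Hypothesis L0 : 0 < L.

(** Freezing the coordinates at the boundary of the strip extends continuous functions
on it to continuous functions on the plane with the same values, hence bounds. *)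
Definition ext2 (g : R -> R -> R) : R -> R -> R :=
  fun t x => g (clamp 0 T t) (pospart x).

Lemma ext2_id g t x : 0 <= t <= T -> 0 <= x -> ext2 g t x = g t x.
Proof. by move=> tT x0; rewrite /ext2 clamp_id// pos_id. Qed.

Let cl t : 0 <= clamp 0 T t <= T.
Proof. by apply: clamp_itv; exact: ltW. Qed.

Lemma clamp_cvg (p : R * R) : clamp 0 T q.1 @[q --> p] --> clamp 0 T p.1.
Proof.
case: p => t x; apply: (cvg_comp (@fst R R) (clamp 0 T)); first exact: cvg_fst.
exact: clamp_continuous.
Qed.

Lemma pos_cvg (p : R * R) : pospart q.2 @[q --> p] --> pospart p.2.
Proof.
case: p => t x; apply: (cvg_comp (@snd R R) pospart); first exact: cvg_snd.
exact: pos_continuous.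
Qed.

Lemma ext2_continuous g :
  {within `[0, T] `*` J, continuous (fun p : R * R => g p.1 p.2)} ->
  continuous (fun p : R * R => ext2 g p.1 p.2).
Proof.
move=> cg; apply: (within_comp_continuous (p := fun p => (clamp 0 T p.1,
  pospart p.2)) cg).
  move=> [t x].
  have h1 := @clamp_cvg (t, x); have h2 := @pos_cvg (t, x).
  exact: cvg_pair h1 h2.
by move=> [t x]; split; rewrite /= in_itv/= ?cl// andbT pos_ge0.
Qed.

(** A first bound K, by compactness of [0, T] x [0, L], shows that g is essentially
bounded; its essential norm is then a pointwise bound by continuity. *)
Lemma ext2_bound g :
  continuous (fun p : R * R => ext2 g p.1 p.2) ->
  (forall t x, 0 <= t <= T -> L < x -> g t x = 0) ->
  forall t x, `|ext2 g t x| <= Linf2_norm `[0, T] J g.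
Proof.
move=> cg gL.
have [K gK] : exists K, forall t x, `|ext2 g t x| <= K.
  have : compact ((fun p : R * R => ext2 g p.1 p.2) @` (`[0, T] `*` `[0, L])).
    apply: continuous_compact; first exact: continuous_subspaceT.
    by apply: compact_setX; exact: segment_compact.
  move=> /compact_bounded[M [_ hM]].
  exists (Num.max 0 (M + 1)) => t x.
  have [xL|Lx] := leP (pospart x) L; last by rewrite /ext2 gL// normr0 le_max lexx.
  rewrite le_max; apply/orP; right.
  apply: (hM (M + 1)); first by rewrite ltrDl.
  exists (clamp 0 T t, pospart x); first by split; rewrite /= in_itv/= ?cl ?pos_ge0.
  by rewrite /= /ext2 clamp_id// pos_id// pos_ge0.
(* The norm only sees the strip, where g and its extension coincide. *)
have E : (fun p : R * R => g p.1 p.2) \_ (`[0, T] `*` J) =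
    (fun p : R * R => ext2 g p.1 p.2) \_ (`[0, T] `*` J).
  apply/funext => -[t x]; rewrite !patchE; case: ifPn => //.
  by rewrite inE /= !in_itv/= andbT => -[tT x0]; rewrite ext2_id.
have En : Linf2_norm `[0, T] J g = Linf2_norm `[0, T] J (ext2 g).
  by rewrite /Linf2_norm /Linf_norm E.
move=> t x; rewrite En.
have -> : ext2 g t x = ext2 g (clamp 0 T t) (pospart x).
  by rewrite [RHS]ext2_id; [|exact: cl|exact: pos_ge0].
apply: Linf2_continuous_le => //; last exact: pos_ge0.
apply: (Linf_bounded (leb2_gt0 R) (c := K)).
  by apply: measurable_funTS; exact: continuous_measurable2.
by apply: nearW => p _; exact: gK.
Qed.

End OneSided.

Section KernelData.
Context (R : realType).
Local Notation leb := (@lebesgue_measure R).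
Local Notation J := (`[0, +oo[%classic : set R).
Variables (T L : R).
Hypothesis T0 : 0 < T.
Hypothesis L0 : 0 < L.
Local Notation I := (`[0, T]%classic : set R).
Local Notation C1 := (C1_in2 `[0, T] `[0, +oo[).
Local Notation dt := (dt_in `[0, T]).
Local Notation dx := (dx_in `[0, +oo[).
Local Notation ext := (ext2 T).
Local Notation supp g := (forall t x, 0 <= t <= T -> L < x -> g t x = 0).

Let II t : 0 <= t <= T -> I t. Proof. by rewrite /= in_itv. Qed.
Let JJ x : 0 <= x -> J x. Proof. by rewrite /= in_itv/= andbT. Qed.

Let IE t : I t -> 0 <= t <= T. Proof. by rewrite /= in_itv. Qed.
Let JE x : J x -> 0 <= x. Proof. by rewrite /= in_itv/= andbT. Qed.

Lemma dt_has_deriv (g : R -> R -> R) t x : C1 g -> 0 <= t <= T -> 0 <= x ->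
  has_deriv I (g^~ x) t (dt g t x).
Proof.
move=> [dg _ _] tT x0; apply: has_deriv_in.
by have [] := dg t x (II tT) (JJ x0).
Qed.

Lemma dx_has_deriv (g : R -> R -> R) t x : C1 g -> 0 <= t <= T -> 0 <= x ->
  has_deriv J (g t) x (dx g t x).
Proof.
move=> [dg _ _] tT x0; apply: has_deriv_in.
by have [] := dg t x (II tT) (JJ x0).
Qed.

Lemma dt_mean (g : R -> R -> R) s t x : C1 g -> 0 <= s <= T -> 0 <= t <= T ->
  0 <= x -> exists xi, [/\ 0 <= xi <= T, `|xi - s| <= `|t - s| &
    g t x - g s x = dt g xi x * (t - s)].
Proof.
move=> C1g sT tT x0.
have [|xi [xiI h E]] := @has_deriv_mean _ I (g^~ x) (fun t => dt g t x)
  (@I_conv _ T) _ s t (II sT) (II tT).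
  by move=> r /IE rT; exact: dt_has_deriv.
by exists xi; split => //; exact: IE.
Qed.

Lemma dx_mean (g : R -> R -> R) t x y : C1 g -> 0 <= t <= T -> 0 <= x -> 0 <= y ->
  exists xi, [/\ 0 <= xi, `|xi - x| <= `|y - x| &
    g t y - g t x = dx g t xi * (y - x)].
Proof.
move=> C1g tT x0 y0.
have [|xi [xiJ h E]] := @has_deriv_mean _ J (g t) (dx g t)
  (@J_conv _) _ x y (JJ x0) (JJ y0).
  by move=> r /JE r0; exact: dx_has_deriv.
by exists xi; split => //; exact: JE.
Qed.

Lemma ext_mean (g : R -> R -> R) t : C1 g -> 0 <= t <= T ->
  mean_value (ext g t) (ext (dx g) t).
Proof.
move=> C1g tT x y x0 y0; have [xi [xi0 h E]] := dx_mean C1g tT x0 y0.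
by exists xi => //; rewrite !ext2_id.
Qed.

Lemma dt_supp (g : R -> R -> R) : supp g -> supp (dt g).
Proof.
move=> gL t x tT Lx; apply: (derive_in_unique T0 tT) => //.
apply: (@eq_has_deriv _ _ _ _ (cst 0)); [exact: II| |exact: has_deriv_cst].
by move=> s /IE sT; rewrite gL.
Qed.

Lemma dx_supp (g : R -> R -> R) : supp g -> supp (dx g).
Proof.
move=> gL t x tT Lx; apply: (derive_in_supp _ Lx).
  by rewrite ltW// (lt_trans L0).
by move=> y Ly; exact: gL.
Qed.

(** Joint continuity from separate differentiability: bounded partial derivatives
make g Lipschitz. *)
Lemma ext_continuous (g : R -> R -> R) (K : R) : C1 g ->
  (forall t x, `|ext (dt g) t x| <= K) -> (forall t x, `|ext (dx g) t x| <= K) ->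
  continuous (fun p : R * R => ext g p.1 p.2).
Proof.
move=> C1g bt bx [t x].
(* The Lipschitz estimate, as a function of q that tends to 0 at (t, x). *)
pose h (q : R * R) := K * `|clamp 0 T q.1 - clamp 0 T t| + K * `|pospart q.2 -
  pospart x|.
have ch : h q @[q --> (t, x)] --> 0.
  have h1 := @clamp_cvg _ T (t, x); have h2 := @pos_cvg R (t, x).
  have -> : (0 : R) = K * `|clamp 0 T t - clamp 0 T t| + K * `|pospart x -
    pospart x|.
    by rewrite !subrr normr0 !mulr0 addr0.
  apply: cvgD; (apply: cvgM; first exact: cvg_cst); apply: cvg_norm.
    by apply: cvgB => //; exact: cvg_cst.
  by apply: cvgB => //; exact: cvg_cst.
apply/cvgrPdist_le => e e0; move/cvgrPdist_le : ch => /(_ e e0).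
apply: filterS => q; rewrite sub0r normrN => hq /=.
apply: le_trans hq; apply: le_trans (ler_norm _).
have cl s : 0 <= clamp 0 T s <= T by apply: clamp_itv; exact: ltW.
have [xi [xiT _ E1]] := dt_mean C1g (cl t) (cl q.1) (pos_ge0 x).
have [et [et0 _ E2]] := dx_mean C1g (cl q.1) (pos_ge0 x) (pos_ge0 q.2).
have b1 : `|dt g xi (pospart x)| <= K.
  by have := bt xi (pospart x); rewrite ext2_id// pos_ge0.
have b2 : `|dx g (clamp 0 T q.1) et| <= K.
  by have := bx (clamp 0 T q.1) et; rewrite ext2_id// cl.
rewrite distrC /ext2 (_ : g _ _ - g _ _ =
  (g (clamp 0 T q.1) (pospart x) - g (clamp 0 T t) (pospart x)) +
  (g (clamp 0 T q.1) (pospart q.2) - g (clamp 0 T q.1) (pospart x))); last by ring.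
apply: le_trans (ler_normD _ _) _; rewrite E1 E2 !normrM.
by apply: lerD; exact: ler_wpM2r.
Qed.

Variable phi : R -> R -> R.
Hypothesis phiC2 : C2_in2 `[0, T] `[0, +oo[ phi.
Hypothesis phiL : supp phi.
Hypothesis phi0 : forall t, 0 <= t <= T -> 0 < phi t 0.

Let M := C2_W2inf_norm2 `[0, T] `[0, +oo[ phi.

Let Cphi : C1 phi. Proof. by have [] := phiC2. Qed.
Let Cdt : C1 (dt phi). Proof. by have [] := phiC2. Qed.
Let Cdx : C1 (dx phi). Proof. by have [] := phiC2. Qed.

Let nge0 (g : R -> R -> R) : 0 <= Linf2_norm `[0, T] `[0, +oo[ g.
Proof. exact: Linf_norm_ge0. Qed.

Lemma W2inf_norm2_ge :
  [/\ Linf2_norm `[0, T] `[0, +oo[ phi <= M,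
      Linf2_norm `[0, T] `[0, +oo[ (dt phi) <= M,
      Linf2_norm `[0, T] `[0, +oo[ (dx phi) <= M,
      Linf2_norm `[0, T] `[0, +oo[ (dt (dx phi)) <= M &
      Linf2_norm `[0, T] `[0, +oo[ (dx (dx phi)) <= M].
Proof.
have sum6 (a b c d e f : R) : 0 <= a -> 0 <= b -> 0 <= c -> 0 <= d -> 0 <= e ->
    0 <= f -> let s := a + b + c + d + e + f in
    [/\ a <= s, b <= s, c <= s, e <= s & f <= s].
  by move=> a0 b0 c0 d0 e0 f0 s; split; rewrite /s; lra.
exact: (sum6 _ _ _ _ _ _ (nge0 _) (nge0 _) (nge0 _) (nge0 _) (nge0 _) (nge0 _)).
Qed.

Let cdt : continuous (fun p : R * R => ext (dt phi) p.1 p.2).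
Proof. by apply: ext2_continuous => //; have [] := Cphi. Qed.
Let cdx : continuous (fun p : R * R => ext (dx phi) p.1 p.2).
Proof. by apply: ext2_continuous => //; have [] := Cphi. Qed.
Let cdxdt : continuous (fun p : R * R => ext (dx (dt phi)) p.1 p.2).
Proof. by apply: ext2_continuous => //; have [] := Cdt. Qed.
Let cdtdx : continuous (fun p : R * R => ext (dt (dx phi)) p.1 p.2).
Proof. by apply: ext2_continuous => //; have [] := Cdx. Qed.
Let cdxdx : continuous (fun p : R * R => ext (dx (dx phi)) p.1 p.2).
Proof. by apply: ext2_continuous => //; have [] := Cdx. Qed.

Let bdt t x : `|ext (dt phi) t x| <= M.
Proof.
have [_ h _ _ _] := W2inf_norm2_ge; apply: le_trans h.
by apply: (ext2_bound T0 cdt); exact: dt_supp.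
Qed.
Let bdx t x : `|ext (dx phi) t x| <= M.
Proof.
have [_ _ h _ _] := W2inf_norm2_ge; apply: le_trans h.
by apply: (ext2_bound T0 cdx); exact: dx_supp.
Qed.
Let bdtdx t x : `|ext (dt (dx phi)) t x| <= M.
Proof.
have [_ _ _ h _] := W2inf_norm2_ge; apply: le_trans h.
by apply: (ext2_bound T0 cdtdx); apply: dt_supp; exact: dx_supp.
Qed.
Let bdxdx t x : `|ext (dx (dx phi)) t x| <= M.
Proof.
have [_ _ _ _ h] := W2inf_norm2_ge; apply: le_trans h.
by apply: (ext2_bound T0 cdxdx); apply: dx_supp; exact: dx_supp.
Qed.
Let cphi : continuous (fun p : R * R => ext phi p.1 p.2).
Proof. exact: (ext_continuous Cphi bdt bdx). Qed.

(** The norm of phi contains the t-derivative of phi_x. It controls the increments of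
phi_t in x through second differences: the increment phi_t(t,x) - phi_t(t,y) is
the derivative at t of s |-> phi(s,x) - phi(s,y), and the increments of the
latter are increments in x of phi(s,.) - phi(t,.), whose derivative is
phi_x(s,.) - phi_x(t,.). *)
Lemma dt_lip t : 0 <= t <= T -> lipschitz_ge0 M (ext (dt phi) t).
Proof.
move=> tT x y x0 y0; rewrite !ext2_id//.
apply: (@has_deriv_le _ I 0 T t _ _ (fun s => phi s x - phi s y)) => //.
  by apply: has_derivB; exact: dt_has_deriv.
move=> s /IE sT.
have [|xi [/JE xi0 _ E]] := @has_deriv_mean _ J (fun z => phi s z - phi t z)
  (fun z => dx phi s z - dx phi t z) (@J_conv _) _ y x (JJ y0) (JJ x0).
  by move=> z /JE z0; apply: has_derivB; exact: dx_has_deriv.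
have [ze [zeT _ E']] := dt_mean Cdx tT sT xi0.
have b : `|dt (dx phi) ze xi| <= M by have := bdtdx ze xi; rewrite ext2_id.
rewrite (_ : _ - _ - _ = (phi s x - phi t x) - (phi s y - phi t y)); last by ring.
rewrite E E' !normrM -mulrA [`|s - t| * _]mulrC mulrA.
by do 2 apply: ler_wpM2r => //.
Qed.

(** The infimum is attained, phi(., 0) being continuous on the compact [0, T]. *)
Lemma phi_min0_gt0 : 0 < phi_min0 T phi /\
  forall t, 0 <= t <= T -> phi_min0 T phi <= phi t 0.
Proof.
have c0 : {within `[0, T], continuous (phi^~ 0)}.
  apply: (@has_deriv_within _ _ _ (fun t => dt phi t 0)) => t /IE tT.
  exact: dt_has_deriv.
have [c cT cmin] := EVT_min (ltW T0) c0.
have lb : lbound [set phi t 0 | t in `[0, T]] (phi c 0).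
  by move=> _ [t tT <-]; apply: cmin; move: tT; rewrite /=.
have c0T : 0 <= c <= T by move: cT; rewrite in_itv.
split.
  apply: lt_le_trans (phi0 c0T) _; apply: lb_le_inf => //.
  by exists (phi c 0), c.
move=> t tT; apply: ge_inf; first by exists (phi c 0).
by exists t => //; exact: II.
Qed.

Lemma kernel_dataP : kernel_data T (ext phi) (ext (dt phi)) (ext (dx phi))
  (ext (dx (dt phi))) (ext (dx (dx phi))) M (phi_min0 T phi)^-1.
Proof.
have [m0 mle] := phi_min0_gt0.
split => //.
- move=> t x; have [h _ _ _ _] := W2inf_norm2_ge; apply: le_trans h.
  exact: (ext2_bound T0 cphi phiL).
- exists (Linf2_norm `[0, T] `[0, +oo[ (dx (dt phi))) => t x.
  by apply: (ext2_bound T0 cdxdt); apply: dx_supp; exact: dt_supp.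
- exact: dt_lip.
- by move=> t tT; rewrite ext2_id// phi0.
- by move=> t tT; rewrite ext2_id// lef_pV2 ?posrE ?phi0// mle.
- by move=> t tT; exact: ext_mean.
- by move=> t tT; exact: ext_mean.
- by move=> t tT; exact: ext_mean.
- move=> t1 t2 x t1T t2T x0; have [xi [xiT h E]] := dt_mean Cphi t1T t2T x0.
  by exists xi => //; rewrite !ext2_id.
- move=> t tT; rewrite ext2_id//.
  apply: (@eq_has_deriv _ _ _ _ (phi^~ 0)); [exact: II| |exact: dt_has_deriv].
  by move=> s /IE sT; rewrite ext2_id.
Qed.

End KernelData.

(** * Velocities, Sobolev functions and the given equation *)

Section Speed.
Context (R : realType).

(** Choosing a bound as a function of V alone makes the stability constants depend
on V and not on the proof that V is bounded. *)
Definition speed_const (V : R -> R) : R := xget 0 [set c | [/\ 0 <= c,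
  forall s, 0 <= s -> `|V s| <= c & lipschitz_ge0 c V]].

Lemma speed_constP (V : R -> R) : [bounded V s | s in `[0, +oo[] ->
  [lipschitz V s | s in `[0, +oo[] ->
  [/\ 0 <= speed_const V, forall s, 0 <= s -> `|V s| <= speed_const V &
      lipschitz_ge0 (speed_const V) V].
Proof.
move=> [M1 [_ H1]] [M2 [_ H2]].
suff : exists c, [set c | [/\ 0 <= c,
  forall s, 0 <= s -> `|V s| <= c & lipschitz_ge0 c V]] c by move/xgetPex; exact.
have h1 : M1 < Num.max 0 (Num.max (M1 + 1) (M2 + 1)).
  by rewrite !lt_max ltrDl ltr01 orbT.
have h2 : M2 < Num.max 0 (Num.max (M1 + 1) (M2 + 1)).
  by rewrite !lt_max [M2 < M2 + 1]ltrDl ltr01 !orbT.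
exists (Num.max 0 (Num.max (M1 + 1) (M2 + 1))); split.
- by rewrite le_max lexx.
- by move=> s s0; apply: (H1 _ h1); rewrite /= in_itv/= s0.
- move=> x y x0 y0; apply: (H2 _ h2 (x, y)).
  by split; rewrite /= in_itv/= andbT.
Qed.

Lemma velocityP (V : R -> R) (L : R) : 0 < L ->
  [bounded V s | s in `[0, +oo[] -> [lipschitz V s | s in `[0, +oo[] ->
  (forall s, 0 <= s -> 0 <= V s) ->
  velocity (fun d => V (Num.max 0 (d / L))) (speed_const V / L) (speed_const V).
Proof.
move=> L0 Vb Vl V0; have [c0 cb cl] := speed_constP Vb Vl.
have m0 (x : R) : 0 <= Num.max 0 x by rewrite le_max lexx.
split.
- by rewrite divr_ge0// ltW.
- move=> x y; apply: le_trans (cl _ _ (m0 _) (m0 _)) _.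
  rewrite -mulrA ler_wpM2l//.
  apply: (@le_trans _ _ (`|x / L - y / L|)).
    have [h1|h1] := leP 0 (x / L); have [h2|h2] := leP 0 (y / L) => //.
    + by rewrite subr0 !ger0_norm//; lra.
    + by rewrite sub0r normrN ger0_norm// ler0_norm; lra.
    + by rewrite subrr normr0.
  by rewrite -mulrBl normrM normfV (gtr0_norm L0) mulrC.
- by move=> x; rewrite V0// (le_trans (ler_norm _))// cb.
Qed.

End Speed.

Section Sobolev1.
Context (R : realType).
Local Notation leb := (@lebesgue_measure R).
Variable T : R.
Hypothesis T0 : 0 < T.

Lemma weak_deriv_prim (u g : R -> R) : {within `[0, T], continuous u} ->
  Linf leb `[0, T] g -> weak_deriv T u g ->
  exists g', [/\ primitive T u g',
    forall t, 0 <= t <= T -> `|g' t| <= Linf_norm leb `[0, T] g &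
    {ae leb, forall t, 0 <= t <= T -> g t = g' t}].
Proof.
move=> cu Lg wg.
have [g' [bg' gn gg']] := Linf_bm (leb_gt0 R) (measurable_itv `[0, T]) Lg.
have ae : {ae leb, forall t, 0 <= t <= T -> g t = g' t}.
  by apply: (ae_imply _ gg') => t E tT; apply: E; rewrite /= in_itv.
exists g'; split.
- apply: weak_prim => //; apply: weak_deriv_ae ae wg.
    by have [] := Lg.
  by have [] := bg'.
- by move=> t tT; apply: gn; rewrite /= in_itv.
- exact: ae.
Qed.

(** The representative of the derivative is truncated at the norm of the weak
derivative, so that it obeys this bound at every point. *)
Lemma W1inf_prim (u : R -> R) : W1inf T u -> exists g, primitive T u g /\
  forall t, 0 <= t <= T -> `|g t| <= Linf_norm leb `[0, T] (weak_derive T u).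
Proof.
move=> [cu _ ex_g].
have [Lg wg] : [set g | Linf leb `[0, T] g /\ weak_deriv T u g] (weak_derive T u).
  by apply: xgetPex; exact: ex_g.
by have [g [pg gn _]] := weak_deriv_prim cu Lg wg; exists g.
Qed.

(** With W1inf_prim, this identifies W^{1,oo} with the primitives. *)
Lemma prim_W1inf (u g : R -> R) : primitive T u g -> W1inf T u.
Proof.
move=> pu; have cu := prim_continuous pu; split => //; first exact: within_Linf.
exists g; split; last exact: prim_weak_deriv.
by have [bg _] := pu; exact: bm_Linf.
Qed.

Lemma prim_unique_ae (u g h : R -> R) : primitive T u g -> primitive T u h ->
  {ae leb, forall t, 0 <= t <= T -> g t = h t}.
Proof.
move=> pg ph; have [bg _] := pg; have [bh _] := ph.
have : {ae leb, forall t, 0 <= t <= T -> g t - h t = 0}.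
  apply: int0_ae; first exact: bmB.
  move=> t tT; have := (primB pg ph).2 t tT.
  by rewrite !subrr add0r => <-.
by apply: ae_imply => t E /E /eqP; rewrite subr_eq0 => /eqP.
Qed.

End Sobolev1.

Section RhsE.
Context (R : realType).
Local Notation leb := (@lebesgue_measure R).
Variables (T L : R) (V kbar : R -> R) (phi : R -> R -> R) (Lv Vm M qi : R).
Hypothesis T0 : 0 < T.
Let vel d := V (Num.max 0 (d / L)).
Hypothesis velP : velocity vel Lv Vm.
Local Notation ext := (ext2 T).
Local Notation dt := (dt_in `[0, T]).
Local Notation dx := (dx_in `[0, +oo[).
Hypothesis kerP : kernel_data T (ext phi) (ext (dt phi)) (ext (dx phi))
  (ext (dx (dt phi))) (ext (dx (dx phi))) M qi.

(** The flow is nondecreasing, so phi and kbar are only evaluated in their domains,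
where they agree with their extensions. *)
Lemma volterra_rhsE (k dl : R -> R) (t : R) : {within `[0, T], continuous k} ->
  {within `[0, T], continuous dl} -> 0 <= t <= T ->
  volterra_rhs T L V kbar phi k dl t =
  volterra_op vel (fun x => kbar (pospart x)) (mass kbar) (ext phi) (ext (dt phi))
    (ext (dx phi)) k dl t.
Proof.
move=> ck cd tT; have /andP[t0 tT'] := tT.
have pP := flow_prim velP cd.
have fl s : 0 <= s <= t -> travel (speed V L dl) s t = flow vel dl t -
  flow vel dl s.
  by move=> /andP[s0 st]; rewrite (prim_incr pP s0 st tT').
have zz s : 0 <= s <= t -> 0 <= flow vel dl t - flow vel dl s.
  by move=> /andP[s0 st]; exact: (flow_ge0 velP cd s0 st tT').
have P0 : 0 <= flow vel dl t by have := zz 0; rewrite flow0 subr0; apply;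
  rewrite lexx.
have h0 : 0 <= (0 : R) <= T by rewrite lexx ltW.
have sT s : 0 <= s <= t -> 0 <= s <= T.
  by move=> /andP[-> st]; exact: le_trans st tT'.
have bK := bm_volterra_ker velP kerP ck cd tT.
have bt (u : R -> R) : {within `[0, T], continuous u} -> bounded_mfun `[0, t] u.
  by move=> cu; apply: bm_sub_itv (within_bm cu).
have cv := vel_within velP cd.
have bG := bm_along_l cv (kernel_t_cont kerP) (ex_intro _ M (kernel_t_bnd kerP)) tT.
have b2 : bounded_mfun `[0, t] (fun r => dl r * ext (dt phi) r (flow vel dl t -
  flow vel dl r)).
  by apply: bmM => //; exact: bt.
have b1 : bounded_mfun `[0, t] (fun r => volterra_ker vel (ext phi) (ext (dt phi))
    (ext (dx phi)) k dl t r +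
    dl r * ext (dt phi) r (flow vel dl t - flow vel dl r)).
  exact: bmD.
rewrite /volterra_rhs /volterra_op fl ?lexx// flow0 subr0.
rewrite !ext2_id// pos_id//.
have -> : \int[leb]_(r in `[0, t]) (speed V L dl r * k r *
     phi r (travel (speed V L dl) r t) + speed V L dl r * dl r *
     dx phi r (travel (speed V L dl) r t)) =
  \int[leb]_(r in `[0, t]) (volterra_ker vel (ext phi) (ext (dt phi))
    (ext (dx phi)) k dl t r +
    dl r * ext (dt phi) r (flow vel dl t - flow vel dl r)).
  apply: int_eq => r rt; rewrite /volterra_ker subrK fl// !ext2_id//; try exact: sT.
  - exact: zz.
  - exact: zz.
have -> : \int[leb]_(r in `[0, t]) (dl r * dt phi r (travel (speed V L dl) r t)) =
  \int[leb]_(r in `[0, t]) (dl r * ext (dt phi) r (flow vel dl t - flow vel dl r)).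
  by apply: int_eq => r rt; rewrite fl// ext2_id//; [exact: sT|exact: zz].
rewrite int_add//.
set I1 := Rintegral _ _ _; set I2 := Rintegral _ _ _; clearbody I1 I2.
set a := (phi t 0)^-1; set b := mass kbar; set c := kbar _; set d := phi 0 _.
by clearbody a b c d; ring.
Qed.

End RhsE.

(** * Existence, uniqueness and stability *)

Section Constants.
Context (R : realType).

(** Here m is the mass of kbar, qi the inverse of the minimum of phi(., 0), ka the
norm of k, and M, N the norms of phi and kbar. *)
Definition delta_const (T L : R) (V : R -> R) (m qi ka M N : R) : R :=
  let Vm := speed_const V in
  2 * volt_e T Vm M qi *
  expR (2 * volt_w T (Vm / L) Vm N m M qi ka (volt_D T Vm N m M qi ka) * T).

(** As K is the W^{1,oo} norm of k, it bounds both k and its derivative; in the same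
way N bounds kbar together with its first two derivatives. *)
Definition f_const (T L : R) (V : R -> R) (m qi K M N : R) : R :=
  let Vm := speed_const V in
  2 * (qi * (1 + infl_stab T (Vm / L) Vm N M qi N K
      (volt_D T Vm N m M qi K + `|m|) * delta_const T L V m qi K M N)) *
  expR (2 * infl_rate Vm M qi * T).

End Constants.

Section Main.
Context (R : realType).
Local Notation leb := (@lebesgue_measure R).
Variables (T L : R) (V kbar : R -> R) (phi : R -> R -> R).
Hypothesis T0 : 0 < T.
Hypothesis L0 : 0 < L.
Hypothesis V_bnd : [bounded V s | s in `[0, +oo[].
Hypothesis V_lip : [lipschitz V s | s in `[0, +oo[].
Hypothesis V_ge0 : forall s, 0 <= s -> 0 <= V s.
Hypothesis kbarC2 : C2_in `[0, +oo[ kbar.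
Hypothesis kbarL : forall x, L < x -> kbar x = 0.
Hypothesis phiC2 : C2_in2 `[0, T] `[0, +oo[ phi.
Hypothesis phiL : forall t x, 0 <= t <= T -> L < x -> phi t x = 0.
Hypothesis phi_gt0 : forall t, 0 <= t <= T -> 0 < phi t 0.

Let vel d := V (Num.max 0 (d / L)).
Local Notation ext := (ext2 T).
Local Notation dt := (dt_in `[0, T]).
Local Notation dx := (dx_in `[0, +oo[).
Local Notation m := (mass kbar).
Local Notation qi := (phi_min0 T phi)^-1.
Local Notation M := (C2_W2inf_norm2 `[0, T] `[0, +oo[ phi).
Local Notation N1 := (C1_W1inf_norm `[0, +oo[ kbar).
Local Notation N2 := (C2_W2inf_norm `[0, +oo[ kbar).
Local Notation Lnorm u := (Linf_norm leb `[0, T] u).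
Local Notation cont u := {within `[0, T], continuous u}.
Local Notation sol := (volterra_sol T vel (fun x => kbar (pospart x)) m
  (ext phi) (ext (dt phi)) (ext (dx phi))).

Let velP := velocityP L0 V_bnd V_lip V_ge0.
Let kerP := kernel_dataP T0 L0 phiC2 phiL phi_gt0.
Let ini1 := initial_dataP L0 kbarC2 kbarL (lexx N1).
Let N12 : N1 <= N2.
Proof. by rewrite /C2_W2inf_norm lerDl; exact: Linf_norm_ge0. Qed.
Let ini2 := initial_dataP L0 kbarC2 kbarL N12.

Let cont_le u : cont u -> forall t, 0 <= t <= T -> `|u t| <= Lnorm u.
Proof.
move=> cu; apply: (@Linf_continuous_le R 0 T `[0, T] u) => //.
exact: within_Linf.
Qed.

Let cont_norm_le (u : R -> R) (c : R) : 0 <= c ->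
  {ae leb, forall t, 0 <= t <= T -> `|u t| <= c} -> Lnorm u <= c.
Proof.
by move=> c0 uc; apply: (Linf_norm_le (leb_gt0 R)) => //.
Qed.

Lemma volterra_solutionP k dl : cont k ->
  volterra_solution T L V kbar phi k dl -> W1inf T dl /\ sol k dl.
Proof.
move=> ck [Wd dE]; split => //; have [cd _ _] := Wd; split => // t tT.
by rewrite dE// (volterra_rhsE kbar T0 velP kerP ck cd tT).
Qed.

Lemma volterra_solution_exists k : W1inf T k -> exists dl,
  volterra_solution T L V kbar phi k dl.
Proof.
move=> Wk; have [k1 [pk _]] := W1inf_prim T0 Wk.
have ck := prim_continuous pk.
have [dl [cd dE]] := volterra_sol_exists (mass kbar) T0 velP ini1 kerP pk.
exists dl; split.
  have [G pG] := volterra_op_prim (mass kbar) T0 velP ini1 kerP pk cd.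
  apply: (prim_W1inf T0 (g := G)).
  by apply: eq_prim pG => // t tT; rewrite dE.
by move=> t tT; rewrite dE// (volterra_rhsE kbar T0 velP kerP ck cd tT).
Qed.

Lemma delta_stability k k' d d' : W1inf T k -> W1inf T k' ->
  volterra_solution T L V kbar phi k d ->
  volterra_solution T L V kbar phi k' d' ->
  forall t, 0 <= t <= T -> `|d t - d' t| <=
    delta_const T L V m qi (Lnorm k) M N1 * Lnorm (k \- k').
Proof.
move=> Wk Wk' sd sd'; have [ck _ _] := Wk; have [ck' _ _] := Wk'.
have [_ s] := volterra_solutionP ck sd.
have [_ s'] := volterra_solutionP ck' sd'.
have ckk : cont (k \- k') by move=> x; apply: cvgB; [exact: ck|exact: ck'].
exact: (volterra_sol_diff T0 velP ini1 kerP ck ck' (cont_le ck) (cont_le ckk) s s').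
Qed.

(** By definition f - v k is a weak derivative of dl, and dl is a primitive of it once
it has been modified on a null set to be bounded. *)
Lemma inflow_rate_rep k dl f : W1inf T k -> cont dl ->
  inflow_rate T L V k dl f -> exists g, primitive T dl g /\
  {ae leb, forall t, 0 <= t <= T -> f t = g t + vel (dl t) * k t}.
Proof.
move=> Wk cd [Lf wf]; have [ck _ _] := Wk.
have bvk : bounded_mfun `[0, T] (fun t => vel (dl t) * k t).
  by apply: bmM; apply: within_bm => //; exact: (vel_within velP cd).
have [f' [bf' _ ff']] := Linf_bm (leb_gt0 R) (measurable_itv `[0, T]) Lf.
have bg := bmB bf' bvk.
have ae : {ae leb, forall t, 0 <= t <= T -> f t = f' t}.
  by apply: (ae_imply _ ff') => t E tT; apply: E; rewrite /= in_itv.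
exists (fun t => f' t - vel (dl t) * k t); split.
  apply: weak_prim => //; apply: weak_deriv_ae wf.
  - by apply: measurable_funB; [have [] := Lf|have [] := bvk].
  - by have [] := bg.
  - by apply: (ae_imply _ ae) => t E tT; rewrite E.
by apply: (ae_imply _ ae) => t E tT; rewrite E// subrK.
Qed.

Lemma inflow_rate_exists k dl : W1inf T k -> W1inf T dl -> exists f,
  inflow_rate T L V k dl f /\
  forall f', inflow_rate T L V k dl f' ->
    {ae leb, forall t, 0 <= t <= T -> f' t = f t}.
Proof.
move=> Wk Wd; have [ck _ _] := Wk; have [cd _ _] := Wd.
have [g [pg _]] := W1inf_prim T0 Wd.
have bvk : bounded_mfun `[0, T] (fun t => vel (dl t) * k t).
  by apply: bmM; apply: within_bm => //; exact: (vel_within velP cd).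
exists (fun t => g t + vel (dl t) * k t); split.
  split; first by apply: bm_Linf; apply: bmD => //; have [] := pg.
  have := prim_weak_deriv T0 pg; congr weak_deriv.
  by apply/funext => t; rewrite /speed /vel addrK.
move=> f' /(inflow_rate_rep Wk cd)[g' [pg' f'E]].
apply: (ae_imply2 _ f'E (prim_unique_ae pg' pg)) => t E E' tT.
by rewrite E// E'.
Qed.

(** Both rates have representatives that solve inflow_formula, and their difference is
bounded through the difference of the derivatives of the observations and,
by the stability of the solutions, through the difference of the observations. *)
Lemma f_stability k k' d d' f f' : W1inf T k -> W1inf T k' ->
  corresponds T L V kbar phi k d f -> corresponds T L V kbar phi k' d' f' ->
  Lnorm (f \- f') <=
    f_const T L V m qi (W1inf_norm T k) M N2 * W1inf_norm T (k \- k').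
Proof.
move=> Wk Wk' [sd rf] [sd' rf']; have [ck _ _] := Wk; have [ck' _ _] := Wk'.
have [[cd _ _] s] := volterra_solutionP ck sd.
have [[cd' _ _] s'] := volterra_solutionP ck' sd'.
have ge0 := Linf_norm_ge0 leb `[0, T].
set K := W1inf_norm T k; set E := W1inf_norm T (k \- k').
have kK : Lnorm k <= K by rewrite /K /W1inf_norm lerDl.
have eE : Lnorm (k \- k') <= E by rewrite /E /W1inf_norm lerDl.
have ckk : cont (k \- k') by move=> x; apply: cvgB; [exact: ck|exact: ck'].
have kn t : 0 <= t <= T -> `|k t| <= K.
  by move=> tT; exact: le_trans (cont_le ck tT) kK.
have kkn t : 0 <= t <= T -> `|k t - k' t| <= E.
  by move=> tT; exact: le_trans (cont_le ckk tT) eE.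
have [k1 [pk k1n]] := W1inf_prim T0 Wk.
have [k0 [pk0 _]] := W1inf_prim T0 Wk'.
have Wkk : W1inf T (k \- k') := prim_W1inf T0 (primB pk pk0).
have [h [ph hn]] := W1inf_prim T0 Wkk.
(* The derivative k2 of k' is defined from that of k and from the bounded
   representative h of the derivative of k - k', so that k1 - k2 is bounded by the
   Sobolev norm of k - k' at every point. *)
pose k2 t := k1 t - h t.
have pk2 : primitive T k' k2.
  by apply: eq_prim (primB pk ph) => // t _ /=; rewrite opprB addrC subrK.
have [g [pg fE]] := inflow_rate_rep Wk cd rf.
have [g' [pg' f'E]] := inflow_rate_rep Wk' cd' rf'.
have [F [bF FE gF]] := inflow_rep T0 velP ini2 kerP pk pg s.
have [F' [bF' FE' gF']] := inflow_rep T0 velP ini2 kerP pk2 pg' s'.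
have h0 : 0 <= (0 : R) <= T by rewrite lexx ltW.
have k1K t : 0 <= t <= T -> `|k1 t| <= K.
  by move=> tT; apply: le_trans (k1n t tT) _; rewrite /K /W1inf_norm lerDr.
have k12 t : 0 <= t <= T -> `|k1 t - k2 t| <= E.
  move=> tT; rewrite /k2 opprB addrC subrK.
  by apply: le_trans (hn t tT) _; rewrite /E /W1inf_norm lerDr.
have dD : `|d 0 - m| <= volt_D T (speed_const V) N2 m M qi K + `|m|.
  apply: le_trans (ler_normB _ _) _; rewrite lerD2r.
  exact: (volterra_sol_bound T0 velP ini2 kerP ck kn s h0).
have dd := volterra_sol_diff T0 velP ini2 kerP ck ck' kn kkn s s'.
have FF := inflow_formula_diff T0 velP ini2 kerP
  (initial_deriv_lip L0 kbarC2 kbarL) cd cd' bF bF' FE FE' k1K dD dd k12.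
have -> : f_const T L V m qi K M N2 * E =
  2 * (qi * (E + infl_stab T (speed_const V / L) (speed_const V) N2 M qi N2 K
    (volt_D T (speed_const V) N2 m M qi K + `|m|) *
    (delta_const T L V m qi K M N2 * E))) *
  expR (2 * infl_rate (speed_const V) M qi * T).
  by rewrite /f_const; ring.
apply: cont_norm_le; first exact: le_trans (normr_ge0 _) (FF 0 h0).
have ae1 : {ae leb, forall t, 0 <= t <= T -> f t = F t}.
  apply: (ae_imply2 _ fE gF) => t e1 e2 tT; by rewrite e1// e2.
have ae2 : {ae leb, forall t, 0 <= t <= T -> f' t = F' t}.
  apply: (ae_imply2 _ f'E gF') => t e1 e2 tT; by rewrite e1// e2.
by apply: (ae_imply2 _ ae1 ae2) => t e1 e2 tT; rewrite /= e1// e2//; exact: FF.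
Qed.

End Main.

Theorem theorem3p4 (R : realType) :
  exists (C_delta C_f :
      R -> R -> (R -> R) -> R -> R -> R -> R -> R -> R),
  forall (T L : R) (V kbar : R -> R) (phi : R -> R -> R),
  0 < T -> 0 < L ->
  [bounded V s | s in `[0, +oo[] ->
  [lipschitz V s | s in `[0, +oo[] ->
  (forall s, 0 <= s -> 0 <= V s) ->
  Linf (@lebesgue_measure R) `[0, +oo[ kbar ->
  (forall x, 0 <= x -> 0 <= kbar x) ->
  C2_in `[0, +oo[ kbar ->
  (forall x, L < x -> kbar x = 0) ->
  Linf2 `[0, T] `[0, +oo[ phi ->
  (forall t x, 0 <= t <= T -> 0 <= x -> 0 <= phi t x) ->
  C2_in2 `[0, T] `[0, +oo[ phi ->
  (forall t x, 0 <= t <= T -> L < x -> phi t x = 0) ->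
  (forall t, 0 <= t <= T -> mass (phi t) = 1) ->
  (forall t, 0 <= t <= T -> 0 < phi t 0) ->
  (forall k : R -> R, W1inf T k ->
     exists delta : R -> R,
     [/\ volterra_solution T L V kbar phi k delta,
         forall delta', volterra_solution T L V kbar phi k delta' ->
           forall t, 0 <= t <= T -> delta' t = delta t &
         exists f : R -> R,
           inflow_rate T L V k delta f /\
           forall f', inflow_rate T L V k delta f' ->
             {ae @lebesgue_measure R, forall t, 0 <= t <= T -> f' t = f t}]) /\
  (forall k k' delta delta' f f' : R -> R,
     W1inf T k -> W1inf T k' ->
     corresponds T L V kbar phi k delta f ->
     corresponds T L V kbar phi k' delta' f' ->
     Linf_norm (@lebesgue_measure R) `[0, T] (delta \- delta') <=
       C_delta T L V (mass kbar) (phi_min0 T phi)^-1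
         (Linf_norm (@lebesgue_measure R) `[0, T] k)
         (C2_W2inf_norm2 `[0, T] `[0, +oo[ phi)
         (C1_W1inf_norm `[0, +oo[ kbar)
       * Linf_norm (@lebesgue_measure R) `[0, T] (k \- k') /\
     Linf_norm (@lebesgue_measure R) `[0, T] (f \- f') <=
       C_f T L V (mass kbar) (phi_min0 T phi)^-1
         (W1inf_norm T k)
         (C2_W2inf_norm2 `[0, T] `[0, +oo[ phi)
         (C2_W2inf_norm `[0, +oo[ kbar)
       * W1inf_norm T (k \- k')).
Proof.
exists (@delta_const R), (@f_const R).
move=> T L V kbar phi T0 L0 Vb Vl V0 _ _ kC2 kL _ _ pC2 pL _ p0; split.
  move=> k Wk.
  have [dl sd] := volterra_solution_exists T0 L0 Vb Vl V0 kC2 kL pC2 pL p0 Wk.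
  exists dl; split => //.
  - move=> dl' sd' t tT.
    have := delta_stability T0 L0 Vb Vl V0 kC2 kL pC2 pL p0 Wk Wk sd' sd tT.
    (* Uniqueness is the stability estimate for equal observations. *)
    have -> : Linf_norm (@lebesgue_measure R) `[0, T] (k \- k) = 0.
      apply/eqP; rewrite eq_le Linf_norm_ge0 andbT.
      apply: (Linf_norm_le (leb_gt0 R)) => //.
      by apply: nearW => x _ /=; rewrite subrr normr0.
    by rewrite mulr0 normr_le0 subr_eq0 => /eqP.
  - by have [Wd _] := sd; exact: (inflow_rate_exists T0 L0 Vb Vl V0 Wk Wd).
move=> k k' d d' f f' Wk Wk' c c'; split; last first.
  exact: (f_stability T0 L0 Vb Vl V0 kC2 kL pC2 pL p0 Wk Wk' c c').
have [sd _] := c; have [sd' _] := c'.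
have H := delta_stability T0 L0 Vb Vl V0 kC2 kL pC2 pL p0 Wk Wk' sd sd'.
have h0 : 0 <= (0 : R) <= T by rewrite lexx ltW.
apply: (Linf_norm_le (leb_gt0 R)); first exact: le_trans (normr_ge0 _) (H 0 h0).
by apply: nearW => t; rewrite /= in_itv/=; exact: H.
Qed.
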